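(* Let $\mu = \mathcal{N}(a, A)$ and $\nu = \mathcal{N}(b, B)$ be non-degenerate Gaussian distributions on $\mathbb{R}^N$, with Cholesky decompositions $A=LL^{\top}$ and $B = MM^{\top}$ ($L,M$ lower triangular with positive diagonal entries). For $\pi \in \Pi_{bc}(\mu, \nu)$, decompose $\pi$ as a product of regular conditional distributions $$\pi(\mathrm{d}x\,\mathrm{d}y)=\pi_1(\mathrm{d}x_1\mathrm{d}y_1)\,\pi_2(\mathrm{d}x_2\mathrm{d}y_2|x_1,y_1)\cdots\pi_N(\mathrm{d}x_N\mathrm{d}y_N|x_{1:(N-1)},y_{1:(N-1)}).$$ (1) $\pi$ is optimal for $\mathcal{AW}_2(\mu, \nu)$ if and only if, for every $t\in\{1,\dots,N\}$ and for $\pi$-almost all $x_{1:(t-1)}$ and $y_{1:(t-1)}$, $\pi_t(\cdot|x_{1:(t-1)}, y_{1:(t-1)})$ is the comonotonic (resp. counter-monotonic) coupling between $\mu_t(\cdot|x_{1:(t-1)})$ and $\nu_t(\cdot|y_{1:(t-1)})$ when $(L^{\top}M)_{tt} > 0$ (resp. $(L^{\top}M)_{tt} < 0$) (with no condition imposed at those $t$ for which $(L^{\top}M)_{tt}=0$). (2) The optimal coupling is unique if and only if $(L^{\top}M)_{tt} \neq 0$ for all $t$. In this case it is deterministic and is given by $$Y = T X, \qquad T(x) = b + MPL^{-1}(x - a),\qquad X\sim\mu,$$ where $P$ is the diagonal matrix with diagonal entries $\rho_t=+1$ if $(L^{\top}M)_{tt}>0$ and $\rho_t=-1$ if $(L^{\top}M)_{tt}<0$.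 (3) In all cases, every adapted Wasserstein coupling of $(\mu,\nu)$ (under which $(X, Y)$ is jointly Gaussian, possibly degenerate) is optimal for $\mathcal{AW}_2(\mu,\nu)$.
   Context: For Borel probability measures $\mu,\nu$ on $\mathbb{R}^N$, $\Pi(\mu,\nu)$ is the set of couplings, i.e. Borel probability measures $\pi$ on $\mathbb{R}^N\times\mathbb{R}^N$ with marginals $\mu$ and $\nu$. Let $(X,Y)=((X_t)_{t=1}^N,(Y_t)_{t=1}^N)\sim\pi$ and write $X_{1:t}=(X_1,\dots,X_t)$. A coupling $\pi$ is causal in the direction $\mu$ to $\nu$ if for all $t\in\{1,\dots,N\}$ and Borel $E\subset\mathbb{R}^t$, $\mathbb{P}_\pi(Y_{1:t}\in E\mid X_{1:N})=\mathbb{P}_\pi(Y_{1:t}\in E\mid X_{1:t})$ almost surely. It is bicausal if it is causal in both directions (the same condition also holds with $X$ and $Y$ exchanged); $\Pi_{bc}(\mu,\nu)$ is the set of bicausal couplings. For $\mu,\nu$ with finite second moments, $\mathcal{AW}_2^2(\mu,\nu)=\inf_{\pi\in\Pi_{bc}(\mu,\nu)}\int\|x-y\|^2\,\pi(\mathrm{d}x\,\mathrm{d}y)$ ($\|\cdot\|$ Euclidean), and $\pi\in\Pi_{bc}(\mu,\nu)$ is optimal if it attains this infimum. $\mu_t(\cdot|x_{1:(t-1)})$ is the conditional distribution of $X_t$ given $X_{1:(t-1)}=x_{1:(t-1)}$ under $\mu$, and $\nu_t(\cdot|y_{1:(t-1)})$ that of $Y_t$ given $Y_{1:(t-1)}=y_{1:(t-1)}$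 under $\nu$; for $t=1$ the conditioning is empty and these are the marginals of $X_1$, $Y_1$ (likewise $\pi_1$ is the law of $(X_1,Y_1)$). For absolutely continuous (here Gaussian) distributions $\alpha,\beta$ on $\mathbb{R}$ with distribution functions $F_\alpha,F_\beta$, the comonotonic coupling is the one induced by the transport map $F_\beta^{-1}\circ F_\alpha$ from $\alpha$ to $\beta$, and the counter-monotonic coupling is the one induced by $F_\beta^{-1}\circ R\circ F_\alpha$ with $R(u)=1-u$. Adapted Wasserstein coupling: for a diagonal matrix $P$ with diagonal entries $\rho_t\in[-1,1]$, let $\pi^P$ be the law of $(X,Y)\sim\mathcal{N}_{2N}\left(\begin{bmatrix} a \\ b \end{bmatrix},\begin{bmatrix} A & LPM^{\top} \\ MPL^{\top} & B \end{bmatrix}\right)$. An adapted Wasserstein coupling of $(\mu,\nu)$ is any $\pi^P$ such that $\rho_t=+1$ whenever $(L^{\top}M)_{tt}>0$ and $\rho_t=-1$ whenever $(L^{\top}M)_{tt}<0$ ($\rho_t\in[-1,1]$ is arbitrary when $(L^{\top}M)_{tt}=0$). *)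

(* Defs.v *)
From HB Require Import structures.
From mathcomp Require Import all_boot all_order all_algebra.
From mathcomp Require Import all_classical all_reals all_analysis.

Set Implicit Arguments.
Unset Strict Implicit.
Unset Printing Implicit Defensive.

Import Order.TTheory GRing.Theory Num.Theory.
Import numFieldNormedType.Exports.

Local Open Scope classical_set_scope.
Local Open Scope ring_scope.

(* R^n is [n.-tuple R]; its measurable structure is the product sigma-algebra,
   i.e. the Borel one.  Vectors are converted to columns for linear algebra. *)
Definition colv (R : realType) (n : nat) (x : n.-tuple R) : 'cV[R]_n :=
  \col_i tnth x i.

Definition tupv (R : realType) (n : nat) (v : 'cV[R]_n) : n.-tuple R :=
  [tuple v i 0 | i < n].

(* Time is counted from 0: [hist t x] is (x_1, ..., x_t), the strict past of the
   coordinate [tnth x t].  Only used with t <= n, where the default of [nth] is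
   irrelevant. *)
Definition hist (R : realType) (n t : nat) (x : n.-tuple R) : t.-tuple R :=
  [tuple nth 0 x i | i < t].

Definition hist2 (R : realType) (n t : nat) (w : n.-tuple R * n.-tuple R) :
  t.-tuple R * t.-tuple R := (hist t w.1, hist t w.2).

Definition coord2 (R : realType) (n : nat) (t : 'I_n)
  (w : n.-tuple R * n.-tuple R) : R * R := (tnth w.1 t, tnth w.2 t).

Section gaussian.
Context {R : realType}.

(* z_1, ..., z_k are i.i.d. N(0, 1). *)
Definition is_std_gaussian (k : nat) (gamma : probability (k.-tuple R) R) :=
  forall B : 'I_k -> set R, (forall i, measurable (B i)) ->
    gamma [set z | forall i, B i (tnth z i)] =
    (\prod_(i < k) normal_prob 0 1 (B i))%E.

(* N_n(m, Sigma), possibly degenerate: the law of m + S Z with Z standard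
   Gaussian in some R^k and S S^T = Sigma. *)
Definition is_gaussian (n : nat) (m : 'cV[R]_n) (Sigma : 'M[R]_n)
  (P : set (n.-tuple R) -> \bar R) :=
  exists (k : nat) (S : 'M[R]_(n, k)) (gamma : probability (k.-tuple R) R),
    [/\ is_std_gaussian gamma, Sigma = S *m S^T &
        forall E, measurable E ->
          P E = gamma [set z | E (tupv (m + S *m colv z))]].

Definition is_cholesky (n : nat) (A L : 'M[R]_n) :=
  [/\ A = L *m L^T, is_trig_mx L & forall i, 0 < L i i].

End gaussian.

Section conditioning.
Context {R : realType} {d d1 d2} {T : measurableType d}
  {T1 : measurableType d1} {T2 : measurableType d2}.

(* f o Z is a version of P(F | Z). *)
Definition is_cond_prob (P : probability T R) (Z : T -> T1) (F : set T)
  (f : T1 -> R) :=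
  [/\ measurable_fun setT f, P.-integrable setT (fun w => (f (Z w))%:E) &
      forall B, measurable B ->
        (\int[P]_(w in Z @^-1` B) (f (Z w))%:E = P (F `&` Z @^-1` B))%E].

(* k is a regular conditional distribution of W given Z. *)
Definition is_rcd (P : probability T R) (Z : T -> T1) (W : T -> T2)
  (k : R.-pker T1 ~> T2) :=
  forall B C, measurable B -> measurable C ->
    P (Z @^-1` B `&` W @^-1` C) = (\int[P]_(w in Z @^-1` B) k (Z w) C)%E.

End conditioning.

Section bicausal.
Context {R : realType} {N : nat}.
Implicit Types (mu nu : probability (N.-tuple R) R)
  (p : probability (N.-tuple R * N.-tuple R)%type R).

Definition is_coupling mu nu p :=
  forall E, measurable E ->
    p (fst @^-1` E) = mu E /\ p (snd @^-1` E) = nu E.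

(* The process Y is causal with respect to X: P(Y_{1:t} in E | X_{1:N}) and
   P(Y_{1:t} in E | X_{1:t}) agree almost surely.  Versions exist and are
   almost surely unique, so it does not matter which ones are compared. *)
Definition causal p (X Y : N.-tuple R * N.-tuple R -> N.-tuple R) :=
  forall (t : 'I_N) (E : set (t.+1.-tuple R)), measurable E ->
    exists (f : N.-tuple R -> R) (g : t.+1.-tuple R -> R),
      [/\ is_cond_prob p X [set w | E (hist t.+1 (Y w))] f,
          is_cond_prob p (fun w => hist t.+1 (X w))
            [set w | E (hist t.+1 (Y w))] g &
          {ae p, forall w, f (X w) = g (hist t.+1 (X w))}].

Definition is_bicausal mu nu p :=
  [/\ is_coupling mu nu p, causal p fst snd & causal p snd fst].

Definition sqdist (w : N.-tuple R * N.-tuple R) : R :=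
  \sum_(i < N) (tnth w.1 i - tnth w.2 i) ^+ 2.

Definition cost p : \bar R := (\int[p]_w (sqdist w)%:E)%E.

Definition AW2sq mu nu : \bar R :=
  ereal_inf [set cost p | p in is_bicausal mu nu].

Definition is_optimal mu nu p :=
  is_bicausal mu nu p /\ cost p = AW2sq mu nu.

Definition same_law p q := forall E, measurable E -> p E = q E.

(* Optimal couplings exist, and any two have the same law. *)
Definition unique_optimal mu nu :=
  exists p, is_optimal mu nu p /\
    forall q, is_optimal mu nu q -> same_law q p.

End bicausal.

Section monotone_couplings.
Context {R : realType}.

(* p is the law of (X, T X) with X distributed according to alpha. *)
Definition induced_by {d1 d2} {T1 : measurableType d1} {T2 : measurableType d2}
  (alpha : set T1 -> \bar R) (T : T1 -> T2) (p : set (T1 * T2) -> \bar R) :=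
  forall E, measurable E -> p E = alpha [set x | E (x, T x)].

Definition distr_fun (alpha : set R -> \bar R) (x : R) : R :=
  fine (alpha `]-oo, x]%classic).

(* For 0 < u < 1 and beta with a continuous strictly increasing distribution
   function (in particular beta Gaussian), this is the value at u of its
   inverse. *)
Definition quantile (beta : set R -> \bar R) (u : R) : R :=
  inf [set y | u <= distr_fun beta y].

Definition is_comonotonic (alpha beta : set R -> \bar R)
  (p : set (R * R) -> \bar R) :=
  induced_by alpha (fun x => quantile beta (distr_fun alpha x)) p.

Definition is_countermonotonic (alpha beta : set R -> \bar R)
  (p : set (R * R) -> \bar R) :=
  induced_by alpha (fun x => quantile beta (1 - distr_fun alpha x)) p.

End monotone_couplings.

Section adapted_wasserstein.
Context {R : realType} {N : nat}.
Implicit Types (a b : 'cV[R]_N) (A B L M : 'M[R]_N) (rho : 'rV[R]_N).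

(* p is the coupling pi^P for P = diag(rho); its law on R^N x R^N is read on
   R^(N + N) by concatenation. *)
Definition is_gaussian_coupling a b A B L M rho
  (p : probability (N.-tuple R * N.-tuple R)%type R) :=
  let P := diag_mx rho in
  is_gaussian (col_mx a b)
    (block_mx A (L *m P *m M^T) (M *m P *m L^T) B)
    (pushforward p (fun w => cat_tuple w.1 w.2)).

Definition is_adapted_wasserstein a b A B L M
  (p : probability (N.-tuple R * N.-tuple R)%type R) :=
  exists rho, is_gaussian_coupling a b A B L M rho p /\
    forall t, [/\ -1 <= rho 0 t <= 1,
      0 < (L^T *m M) t t -> rho 0 t = 1 &
      (L^T *m M) t t < 0 -> rho 0 t = -1].

(* T(x) = b + M P L^-1 (x - a), where P has diagonal entries +1 or -1 according
   to the sign of those of L^T M (only meaningful when none of them is 0). *)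
Definition optimal_map a b L M (x : N.-tuple R) : N.-tuple R :=
  let P := diag_mx (\row_t Num.sg ((L^T *m M) t t)) in
  tupv (b + M *m P *m invmx L *m (colv x - a)).

End adapted_wasserstein.

(* Main.v *)
Require Import Defs.
From HB Require Import structures.
From mathcomp Require Import all_boot all_order all_algebra.
From mathcomp Require Import all_classical all_reals all_analysis.
From mathcomp Require Import measurable_realfun ring lra.

Set Implicit Arguments.
Unset Strict Implicit.
Unset Printing Implicit Defensive.

Import Order.TTheory GRing.Theory Num.Theory.
Import numFieldNormedType.Exports.

Local Open Scope classical_set_scope.
Local Open Scope ring_scope.

(* Write X = a + L Z and Y = b + M W with Z and W standard Gaussian.  Under a
   bicausal coupling Z_s is independent of (X, Y) up to time s - 1, and so is
   W_s; hence E[Z_s W_t] = 0 for s <> t, and the cost is a constant minus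
   2 sum_j (L^T M)_jj E[Z_j W_j].  As |E[Z_j W_j]| <= 1, with equality iff
   W_j = Z_j a.s. or W_j = - Z_j a.s., optimality means that W_j is Z_j times
   the sign of (L^T M)_jj whenever this entry is not 0.  Conditionally on the
   past, (X_t, Y_t) is an affine function of (Z_t, W_t), and the increasing
   (resp. decreasing) transport map between Gaussian laws on the line is affine.
   Couplings such that W - rho Z is independent of X are causal; this provides
   the couplings with W_j = +-Z_j for each j, and the jointly Gaussian ones. *)

(** A Gaussian law is given only as the law of m + S z, where S may have any number of columns, so a
    degenerate law has no density to work with. Everything is reduced to one fact, the rotation
    invariance of the standard law on the plane: Givens rotations bring a matrix with orthonormal
    rows to lower triangular form, where it can only select coordinates up to sign. Hence L^{-1} S z
    is standard whenever S S^T = L L^T, and S z is independent of V z when S has orthonormal rows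
    and S V^T = 0.

    The independence of Z_s from the past of both processes uses causality at time s - 1: on an
    event that depends on X alone, P(Y_{1:s-1} in C | X) may be replaced by a function of X_{1:s-1},
    which is independent of Z_s.

    Conditional kernels are determined only almost everywhere, with one null set per event; testing
    them on a countable pi-system leaves a single null set. *)

Section pi_lambda.
Context {R : realType} {d1 d2 d} {T1 : measurableType d1} {T2 : measurableType d2}
  {T : measurableType d}.
Variables (P1 : {measure set T1 -> \bar R}) (P2 : {measure set T2 -> \bar R}).

(** Both sides are finite measures of E, namely push-forwards of restrictions. Equality of two laws
    is the case c = 1 with A1 and A2 the whole space; product formulas take for c the probability of
    a fixed event. [P1] is only a finite measure so that a fibre of a kernel can take its place. *)
Lemma finite_law_uniq (G : set (set T)) (A1 : set T1) (A2 : set T2) (c : R)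
    (X1 : T1 -> T) (X2 : T2 -> T) :
  (P1 setT < +oo)%E -> measurable = <<s G >> -> setI_closed G -> G setT ->
  0 <= c -> measurable A1 -> measurable A2 ->
  measurable_fun setT X1 -> measurable_fun setT X2 ->
  (forall E, G E -> P1 (A1 `&` X1 @^-1` E) = c%:E * P2 (A2 `&` X2 @^-1` E))%E ->
  forall E, measurable E ->
    (P1 (A1 `&` X1 @^-1` E) = c%:E * P2 (A2 `&` X2 @^-1` E))%E.
Proof.
move=> P1fin mG IG GT c0 mA1 mA2 mX1 mX2 h E mE.
pose m1 : {measure set T -> \bar R} := pushforward (mrestr P1 mA1) X1.
pose m2 : {measure set T -> \bar R} :=
  mscale (NngNum c0) (pushforward (mrestr P2 mA2) X2).
rewrite [X in P1 X]setIC [X in P2 X]setIC.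
apply: (@measure_unique _ _ _ G (fun=> setT) mG IG _ _ (m1 mX1) (m2 mX2)) => //.
- by rewrite bigcup_const.
- by move=> A GA; rewrite /= /mscale/= /pushforward /mrestr setIC [X in P2 X]setIC h.
- move=> _; rewrite /= /pushforward /mrestr preimage_setT setTI.
  by apply: le_lt_trans P1fin; apply: le_measure; rewrite ?inE.
Qed.

End pi_lambda.

Lemma law_uniq {R : realType} {d1 d2 d} {T1 : measurableType d1}
    {T2 : measurableType d2} {T : measurableType d} (P1 : probability T1 R)
    (P2 : probability T2 R) (G : set (set T)) (A1 : set T1) (A2 : set T2) (c : R)
    (X1 : T1 -> T) (X2 : T2 -> T) :
  measurable = <<s G >> -> setI_closed G -> G setT ->
  0 <= c -> measurable A1 -> measurable A2 ->
  measurable_fun setT X1 -> measurable_fun setT X2 ->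
  (forall E, G E -> P1 (A1 `&` X1 @^-1` E) = c%:E * P2 (A2 `&` X2 @^-1` E))%E ->
  forall E, measurable E ->
    (P1 (A1 `&` X1 @^-1` E) = c%:E * P2 (A2 `&` X2 @^-1` E))%E.
Proof.
by apply: finite_law_uniq; rewrite -ge0_fin_numE// fin_num_measure.
Qed.

Section rectangles.
Context {d} {T : measurableType d} (k : nat).

Definition rectangle : set (set (k.-tuple T)) :=
  [set E | exists2 B : 'I_k -> set T, (forall i, measurable (B i)) &
    E = [set z | forall i, B i (tnth z i)]].

Lemma measurable_rectangle (B : 'I_k -> set T) : (forall i, measurable (B i)) ->
  measurable [set z : k.-tuple T | forall i, B i (tnth z i)].
Proof.
move=> mB.
rewrite (_ : [set z | _] =
    \bigcap_(i in [set: 'I_k]) ((fun z : k.-tuple T => tnth z i) @^-1` B i)).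
  apply: fin_bigcap_measurable => // i _.
  by rewrite -[X in measurable X]setTI; exact: measurable_tnth.
by apply/seteqP; split=> [z /= h i _|z h i]; [exact: h|exact: (h i I)].
Qed.

Lemma measurable_tuple_rectangle :
  @measurable _ (k.-tuple T) = <<s rectangle >>.
Proof.
apply/seteqP; split.
  apply: smallest_sub; first exact: smallest_sigma_algebra.
  move=> E; rewrite -bigcup_seq/= => -[i _ [A mA <-]].
  apply: sub_sigma_algebra; rewrite setTI.
  exists (fun j => if j == i then A else setT).
    by move=> j; case: ifP.
  apply/seteqP; split=> [z/= Az j|z/= /(_ i)]; last by rewrite eqxx.
  by case: eqP => [->|].
apply: smallest_sub; first exact: sigma_algebra_measurable.
by move=> _ [B mB ->]; exact: measurable_rectangle.
Qed.

Lemma rectangle_setI : setI_closed rectangle.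
Proof.
move=> _ _ [A mA ->] [B mB ->]; exists (fun i => A i `&` B i).
  by move=> i; exact: measurableI.
by apply/seteqP; split=> [z/= [h1 h2] i|z/= h]; split=> // i; have [] := h i.
Qed.

Lemma rectangleT : rectangle setT.
Proof. by exists (fun=> setT) => //; apply/seteqP; split. Qed.

End rectangles.

(** * Independence and disintegration *)

Section independence.
Context {R : realType} {d} {T : measurableType d}.
Implicit Types P : probability T R.

Definition indep {d1 d2} {T1 : measurableType d1} {T2 : measurableType d2}
    P (X : T -> T1) (Y : T -> T2) :=
  forall A B, measurable A -> measurable B ->
    P (X @^-1` A `&` Y @^-1` B) = (P (X @^-1` A) * P (Y @^-1` B))%E.

Definition has_law {d1} {T1 : measurableType d1} P (X : T -> T1)
    (Q : set T1 -> \bar R) :=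
  forall A, measurable A -> P (X @^-1` A) = Q A.

Lemma has_law_exists {d1} {T1 : measurableType d1} P (X : T -> T1) :
  measurable_fun setT X -> exists Q : probability T1 R, has_law P X Q.
Proof.
move=> mX.
pose X' : {mfun T >-> T1} := mfun_Sub (mem_set mX).
by exists (distribution P X') => A mA.
Qed.

Section two.
Context {d1 d2} {T1 : measurableType d1} {T2 : measurableType d2}.
Variables (P : probability T R) (X : T -> T1) (Y : T -> T2).
Hypotheses (mX : measurable_fun setT X) (mY : measurable_fun setT Y).

Lemma indep_sym : indep P X Y -> indep P Y X.
Proof. by move=> h A B mA mB; rewrite setIC h// muleC. Qed.

Lemma indep_comp {d3 d4} {T3 : measurableType d3} {T4 : measurableType d4}
    (f : T1 -> T3) (g : T2 -> T4) :
  measurable_fun setT f -> measurable_fun setT g ->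
  indep P X Y -> indep P (f \o X) (g \o Y).
Proof.
move=> mf mg h A B mA mB; apply: (h (f @^-1` A) (g @^-1` B)).
  by rewrite -[X in measurable X]setTI; exact: mf.
by rewrite -[X in measurable X]setTI; exact: mg.
Qed.

Lemma indep_pi_system (G1 : set (set T1)) (G2 : set (set T2)) :
  measurable = <<s G1 >> -> setI_closed G1 -> G1 setT ->
  measurable = <<s G2 >> -> setI_closed G2 -> G2 setT ->
  (forall A B, G1 A -> G2 B ->
    P (X @^-1` A `&` Y @^-1` B) = (P (X @^-1` A) * P (Y @^-1` B))%E) ->
  indep P X Y.
Proof.
move=> m1 I1 g1 m2 I2 g2 h.
have mX' A : measurable A -> measurable (X @^-1` A).
  by move=> mA; rewrite -[X in measurable X]setTI; exact: mX.
have mY' A : measurable A -> measurable (Y @^-1` A).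
  by move=> mA; rewrite -[X in measurable X]setTI; exact: mY.
have fP A : measurable A -> (fine (P A))%:E = P A.
  by move=> mA; rewrite fineK// fin_num_measure.
have mG1 A : G1 A -> measurable A by rewrite m1; exact: sub_sigma_algebra.
have mG2 A : G2 A -> measurable A by rewrite m2; exact: sub_sigma_algebra.
move=> A B mA mB.
(* One factor is extended at a time: first the event of Y, with that of X still in the pi-system,
   then the event of X. *)
have h1 A' : G1 A' -> P (X @^-1` A' `&` Y @^-1` B) = (P (X @^-1` A') * P (Y @^-1` B))%E.
  move=> gA'; rewrite -(fP (X @^-1` A')); last exact/mX'/mG1.
  rewrite -[Y @^-1` B in RHS]setTI.
  apply: (law_uniq m2 I2 g2) => //; first exact/fine_ge0/measure_ge0.
    exact/mX'/mG1.
  by move=> E GE; rewrite setTI fP ?h//; exact/mX'/mG1.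
rewrite setIC muleC -(fP (Y @^-1` B)); last exact/mY'.
rewrite -[X @^-1` A in RHS]setTI.
apply: (law_uniq m1 I1 g1) => //; first exact/fine_ge0/measure_ge0.
  exact/mY'.
move=> E GE; rewrite setTI fP; last exact/mY'.
by rewrite muleC setIC h1.
Qed.

Lemma indep_joint_law (Q1 : probability T1 R) (Q2 : probability T2 R) :
  indep P X Y -> has_law P X Q1 -> has_law P Y Q2 ->
  forall E, measurable E -> P [set w | E (X w, Y w)] = (Q1 \x Q2)%E E.
Proof.
move=> h l1 l2 E mE.
have mXY : measurable_fun setT (fun w => (X w, Y w)).
  exact: measurable_fun_pair.
pose m : {measure set _ -> \bar R} := pushforward P (fun w => (X w, Y w)).
rewrite (product_measure_unique (m' := m mXY))// => A B mA mB.
by rewrite /= /pushforward -l1// -l2// -h.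
Qed.

End two.

(** Fubini for the product law of (H, Z): the law of F(h, Z) is a conditional distribution of F(H,
    Z) given H = h. It serves both to exhibit conditional probabilities in proofs of causality and
    to identify given kernels. *)
Lemma indep_disintegration {d1 d2 d3} {T1 : measurableType d1}
    {T2 : measurableType d2} {T3 : measurableType d3} (P : probability T R)
    (H : T -> T1) (Z : T -> T2) (Q : probability T2 R) (F : T1 * T2 -> T3) B C :
  measurable_fun setT H -> measurable_fun setT Z -> measurable_fun setT F ->
  indep P H Z -> has_law P Z Q -> measurable B -> measurable C ->
  (P (H @^-1` B `&` [set w | C (F (H w, Z w))]) =
   \int[P]_(w in H @^-1` B) Q [set z | C (F (H w, z))])%E.
Proof.
move=> mH mZ mF iHZ lZ mB mC.
have [Q1 lQ1] := has_law_exists P mH.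
pose E := [set x : T1 * T2 | B x.1 /\ C (F x)].
have mE : measurable E.
  rewrite (_ : E = (fst @^-1` B) `&` (F @^-1` C)); last by [].
  apply: measurableI; rewrite -[X in measurable X]setTI; last exact: mF.
  exact: measurable_fst.
have -> : H @^-1` B `&` [set w | C (F (H w, Z w))] = [set w | E (H w, Z w)] by [].
rewrite (indep_joint_law mH mZ iHZ lQ1 lZ)//.
rewrite /product_measure1.
rewrite (eq_measure_integral (pushforward P H)); last first.
  by move=> A mA _; exact/esym/lQ1.
rewrite ge0_integral_pushforward//; last exact: measurable_fun_xsection.
rewrite preimage_setT [RHS]integral_mkcond; apply: eq_integral => w _ /=.
rewrite patchE /xsection/=; case: ifPn => [|].
  rewrite inE /= => Bw; congr (Q _); apply/seteqP; split => [z|z Cz].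
    by rewrite /= inE => -[].
  by rewrite /= inE; split.
rewrite notin_setE /= => Bw; rewrite [X in Q X](_ : _ = set0) ?measure0//.
by apply/seteqP; split=> // z; rewrite /= inE => -[].
Qed.

End independence.

(** * The standard Gaussian law on the line *)

Section lebesgue_affine.
Context {R : realType}.
Notation lam := (@lebesgue_measure R).

(** Lebesgue measure is determined by its values on half-open intervals. For c < 0 the preimage of
    such an interval is half-open on the other side, with the same length. *)
Lemma lebesgue_measure_affine (c d : R) (A : set R) : c != 0 -> measurable A ->
  lam A = (`|c|%:E * lam ((fun x : R => (c * x + d)%R) @^-1` A))%E.
Proof.
move=> c0 mA.
have mf : measurable_fun [set: measurableTypeR R] (fun x : R => (c * x + d : measurableTypeR R)).
  by apply: measurable_funD => //; exact: measurable_funM.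
pose m : {measure set (measurableTypeR R) -> \bar R} :=
  mscale (NngNum (normr_ge0 c)) (pushforward lam (fun x : R => (c * x + d : measurableTypeR R))).
rewrite (@lebesgue_measure_unique _ (m mf))// => _ [[a b] _ <-].
rewrite /= /mscale /= /pushforward.
have c0' : `|c| != 0 by rewrite normr_eq0.
have [cp|cn|/eqP] := ltgtP c 0; last by rewrite (negbTE c0).
- rewrite (_ : _ @^-1` _ = `[(b - d) / c, (a - d) / c[%classic); last first.
    apply/seteqP; split => x /=; rewrite !in_itv/= ?ler_ndivrMr// ?ltr_ndivlMr//.
      by move=> /andP[? ?]; apply/andP; split; lra.
    by move=> /andP[? ?]; apply/andP; split; lra.
  rewrite !lebesgue_measure_itv/= !lte_fin ltr_nM2r ?invr_lt0//.
  rewrite ltrD2r; case: ifP => ab; last by rewrite mule0.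
  rewrite -EFinD -EFinM ltr0_norm//; congr EFin.
  by field; lra.
- rewrite (_ : _ @^-1` _ = `](a - d) / c, (b - d) / c]%classic); last first.
    apply/seteqP; split => x /=; rewrite !in_itv/= ?ltr_pdivrMr// ?ler_pdivlMr//.
      by move=> /andP[? ?]; apply/andP; split; lra.
    by move=> /andP[? ?]; apply/andP; split; lra.
  rewrite !lebesgue_measure_itv/= !lte_fin ltr_pM2r ?invr_gt0//.
  rewrite ltrD2r; case: ifP => ab; last by rewrite mule0.
  rewrite -EFinD -EFinM gtr0_norm//; congr EFin.
  by field; lra.
Qed.

Lemma ge0_integral_affine (c d : R) (f : R -> \bar R) : c != 0 ->
  measurable_fun setT f -> (forall x, 0 <= f x)%E ->
  (\int[lam]_x f x = `|c|%:E * \int[lam]_x f (c * x + d)%R)%E.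
Proof.
move=> c0 mf f0.
have mg : measurable_fun [set: measurableTypeR R] (fun x : R => (c * x + d : measurableTypeR R)).
  by apply: measurable_funD => //; exact: measurable_funM.
pose m : {measure set (measurableTypeR R) -> \bar R} :=
  pushforward lam (fun x : R => (c * x + d : measurableTypeR R)).
rewrite (eq_measure_integral (mscale (NngNum (normr_ge0 c)) (m mg))); last first.
  by move=> A mA _; exact: lebesgue_measure_affine.
rewrite ge0_integral_mscale//; congr (_ * _)%E.
by rewrite ge0_integral_pushforward.
Qed.

(** The rotation splits into two substitutions on the line: u = c x + s y with y fixed, after which
    the second coordinate is (y - s u) / c, then this one with u fixed. The factors |c|^{-1} and |c|
    cancel; the division is the reason for c != 0. *)
Lemma ge0_integral_rotation (c s : R) (h : R * R -> \bar R) : c != 0 -> c ^+ 2 + s ^+ 2 = 1 ->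
  measurable_fun setT h -> (forall x, 0 <= h x)%E ->
  (\int[lam]_x \int[lam]_y h ((c * x + s * y)%R, (c * y - s * x)%R) =
   \int[lam]_x \int[lam]_y h (x, y))%E.
Proof.
move=> c0 cs mh h0.
have mlin (a b : R) : measurable_fun setT (fun w : measurableTypeR R * measurableTypeR R => a * w.1 + b * w.2).
  apply: measurable_funD; apply: measurable_funM => //.
have mlin1 (a b : R) : measurable_fun setT (fun w : measurableTypeR R => a * w + b).
  by apply: measurable_funD => //; exact: measurable_funM.
have mh1 : measurable_fun setT (fun w : measurableTypeR R * measurableTypeR R =>
    h (w.2, (w.1 - s * w.2) / c)).
  apply: measurableT_comp => //; apply: measurable_fun_pair => //.
  apply: eq_measurable_fun (mlin c^-1 (- s / c)) => w _ /=; ring.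
have mh2 : measurable_fun setT (fun w : measurableTypeR R * measurableTypeR R =>
    h (w.1, (w.2 - s * w.1) / c)).
  apply: measurableT_comp => //; apply: measurable_fun_pair => //.
  apply: eq_measurable_fun (mlin (- s / c) (c^-1)) => w _ /=; ring.
rewrite (fubini_tonelli (m1 := lam) (m2 := lam) (fun w => h (c * w.1 + s * w.2, c * w.2 - s * w.1)))//=; last first.
  apply: measurableT_comp => //; apply: measurable_fun_pair; first exact: mlin.
  apply: eq_measurable_fun (mlin (- s) c) => w _ /=; ring.
transitivity (\int[lam]_y (`|c|^-1%:E * \int[lam]_u h (u, ((y - s * u) / c)%R)))%E.
  apply: eq_integral => y _.
  rewrite (@ge0_integral_affine c (s * y) (fun u => h (u, (y - s * u) / c)))//; last first.
    apply: measurableT_comp => //; apply: measurable_fun_pair => //.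
    apply: eq_measurable_fun (mlin1 (- s / c) (y / c)) => w _ /=; ring.
  rewrite muleA -EFinM mulVf ?normr_eq0// mul1e; apply: eq_integral => x _.
  congr (h (_, _)); apply: (mulIf c0); rewrite divfK//.
  transitivity (y * (c ^+ 2 + s ^+ 2) - s * (c * x + s * y)); last by rewrite cs mulr1.
  by ring.
rewrite ge0_integralZl//; last 2 first.
- exact: (measurable_fun_fubini_tonelli_F (m2 := lam) _ mh1).

- by move=> y _; exact: integral_ge0.
rewrite -(fubini_tonelli (m1 := lam) (m2 := lam) (fun w => h (w.1, (w.2 - s * w.1) / c)))//=.
rewrite -ge0_integralZl//; last 2 first.
- exact: (measurable_fun_fubini_tonelli_F (m2 := lam) _ mh2).
- by move=> y _; exact: integral_ge0.
apply: eq_integral => u _.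
rewrite [RHS](@ge0_integral_affine c^-1 (- (s * u) / c) (fun v => h (u, v)))//; last 2 first.
- by rewrite invr_eq0.
- exact: measurableT_comp.
rewrite normfV; congr (_ * _)%E; apply: eq_integral => y _; congr (h (_, _)); ring.
Qed.

End lebesgue_affine.

Section standard_normal.
Context {R : realType}.
Notation lam := (@lebesgue_measure R).
Definition stdn : set R -> \bar R := normal_prob 0 1.

Let stdn0 : stdn set0 = 0%E. Proof. exact: measure0. Qed.

Let stdn_ge0 A : (0 <= stdn A)%E. Proof. exact: measure_ge0. Qed.

Let stdn_sigma_additive : semi_sigma_additive stdn.
Proof. exact: (@measure_semi_sigma_additive _ _ _ (normal_prob 0 1)). Qed.

(* [normal_prob] is a measure on the alias [measurableTypeR R] of [R], whose
   display differs from that of [R]. *)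
HB.instance Definition _ := isMeasure.Build _ _ _ stdn
  stdn0 stdn_ge0 stdn_sigma_additive.

Let stdnT : stdn setT = 1%E. Proof. exact: probability_setT. Qed.

HB.instance Definition _ := Measure_isProbability.Build _ _ _ stdn stdnT.

Lemma stdnE (A : set R) : stdn A = (\int[lam]_(x in A) (normal_pdf 0 1 x)%:E)%E.
Proof. by []. Qed.

Lemma ge0_integral_stdn (f : R -> \bar R) : measurable_fun setT f ->
  (forall x, 0 <= f x)%E ->
  (\int[stdn]_x f x = \int[lam]_x (f x * (normal_pdf 0 1 x)%:E))%E.
Proof.
move=> mf f0.
have mpdf : measurable_fun [set: R] (fun x => (normal_pdf 0 1 x : R)%:E).
  by apply/measurable_EFinP; exact: measurable_normal_pdf.
have dom : (normal_prob 0 1 : probability (measurableTypeR R) R) `<< lam.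
  exact: normal_prob_dominates.
(* Pushing forward along the identity moves the integral to the alias [measurableTypeR R], on which
   [normal_prob] and its Radon-Nikodym derivative live; that derivative is almost everywhere the
   normal density. *)
rewrite (eq_measure_integral (pushforward (normal_prob 0 1)
    (fun x : measurableTypeR R => x : R)))//.
rewrite ge0_integral_pushforward// preimage_setT /=.
rewrite -(Radon_Nikodym_SigmaFinite.change_of_variables dom)//.
apply: ae_eq_integral => //.
- apply: emeasurable_funM => //; apply: (measurable_int lam).
  exact: Radon_Nikodym_SigmaFinite.f_integrable.
- exact: emeasurable_funM.
- apply: ae_eqe_mul2l => /=.
  apply: integral_ae_eq => //=.
  + exact: Radon_Nikodym_SigmaFinite.f_integrable.
  + by move=> E _ mE; rewrite -Radon_Nikodym_SigmaFinite.f_integral.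
Qed.

Lemma stdn_pdf_rotation (c s x y : R) : c ^+ 2 + s ^+ 2 = 1 ->
  normal_pdf 0 1 (c * x + s * y) * normal_pdf 0 1 (c * y - s * x) =
  normal_pdf 0 1 x * normal_pdf 0 1 y :> R.
Proof.
move=> cs; rewrite !normal_pdfE ?oner_eq0//.
rewrite mulrACA [RHS]mulrACA /normal_fun -!expRD; congr (_ * expR _).
rewrite -!mulrDl !subr0; congr (_ / _).
transitivity (- (c ^+ 2 + s ^+ 2) * (x ^+ 2 + y ^+ 2)); first by ring.
by rewrite cs; ring.
Qed.

Lemma stdn_rotation0 (c s : R) (E : set (R * R)) : c != 0 ->
  c ^+ 2 + s ^+ 2 = 1 -> measurable E ->
  (stdn \x stdn)%E [set w | E (c * w.1 + s * w.2, c * w.2 - s * w.1)] =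
  (stdn \x stdn)%E E.
Proof.
move=> c0 cs mE.
have main (F : set (R * R)) : measurable F -> (stdn \x stdn)%E F =
   (\int[lam]_x \int[lam]_y (\1_F (x, y) * normal_pdf 0 1 x * normal_pdf 0 1 y)%:E)%E.
  move=> mF; rewrite /product_measure1 ge0_integral_stdn//; last exact: measurable_fun_xsection.
  apply: eq_integral => x _.
  have mFx : measurable (xsection F x : set R) by exact: measurable_xsection.
  rewrite /= stdnE muleC integral_mkcond -ge0_integralZl//; last 3 first.
  - apply/(measurable_restrictT _ mFx).
    apply/measurable_EFinP/measurable_funTS; exact: measurable_normal_pdf.
  - by move=> y _; rewrite patchE; case: ifP => // _; rewrite lee_fin normal_pdf_ge0.
  - by rewrite lee_fin normal_pdf_ge0.
  apply: eq_integral => y _; rewrite patchE mem_xsection indicE.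
  by case: ifP => _; rewrite ?mule0 ?mul0r// mul1r EFinM.
have mrot : measurable_fun [set: R * R] (fun w : R * R => (c * w.1 + s * w.2, c * w.2 - s * w.1)).
  apply: measurable_fun_pair.
    by apply: measurable_funD; exact: measurable_funM.
  by apply: measurable_funB; exact: measurable_funM.
have mE' : measurable [set w | E (c * w.1 + s * w.2, c * w.2 - s * w.1)].
  by rewrite -[X in measurable X]setTI; exact: mrot.
rewrite (main _ mE') (main _ mE).
have mh : measurable_fun [set: R * R] (fun w : R * R => (\1_E w * normal_pdf 0 1 w.1 * normal_pdf 0 1 w.2)%:E).
  apply/measurable_EFinP; apply: measurable_funM; first apply: measurable_funM => //.
  - by apply: measurableT_comp => //; exact: measurable_normal_pdf.
  - by apply: measurableT_comp => //; exact: measurable_normal_pdf.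
rewrite -(ge0_integral_rotation c0 cs mh) => [|w]; last first.
  by rewrite lee_fin !mulr_ge0// normal_pdf_ge0.
apply: eq_integral => x _; apply: eq_integral => y _ /=.
by rewrite -mulrA -[in RHS]mulrA stdn_pdf_rotation.
Qed.

Lemma stdn_rotation (c s : R) (E : set (R * R)) :
  c ^+ 2 + s ^+ 2 = 1 -> measurable E ->
  (stdn \x stdn)%E [set w | E (c * w.1 + s * w.2, c * w.2 - s * w.1)] =
  (stdn \x stdn)%E E.
Proof.
have [->|c0] := eqVneq c 0; last exact: stdn_rotation0.
(* a quarter turn is the square of an eighth of a turn *)
rewrite expr0n add0r => s1 mE.
pose r : R := Num.sqrt 2^-1.
have r0 : r != 0 by rewrite gt_eqF// sqrtr_gt0 invr_gt0.
have r2 : r ^+ 2 = 2^-1 by rewrite sqr_sqrtr.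
have rs : r ^+ 2 + (s * r) ^+ 2 = 1 by rewrite exprMn s1 r2; lra.
rewrite -(stdn_rotation0 r0 rs mE) -[RHS](stdn_rotation0 r0 rs).
  congr (product_measure1 _ _ _); apply/seteqP.
  have e (w : R * R) : (0 * w.1 + s * w.2, 0 * w.2 - s * w.1) =
    (r * (r * w.1 + s * r * w.2) + s * r * (r * w.2 - s * r * w.1),
     r * (r * w.2 - s * r * w.1) - s * r * (r * w.1 + s * r * w.2)).
    congr pair.
      transitivity ((1 - s ^+ 2) * r ^+ 2 * w.1 + 2 * r ^+ 2 * s * w.2); last by ring.
      by rewrite s1 r2; field.
    transitivity ((1 - s ^+ 2) * r ^+ 2 * w.2 - 2 * r ^+ 2 * s * w.1); last by ring.
    by rewrite s1 r2; field.
  by split=> w /=; rewrite e.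
rewrite -[X in measurable X]setTI.
have mrot : measurable_fun [set: R * R] (fun w : R * R => (r * w.1 + s * r * w.2, r * w.2 - s * r * w.1)).
  apply: measurable_fun_pair.
    by apply: measurable_funD; exact: measurable_funM.
  by apply: measurable_funB; exact: measurable_funM.
exact: mrot.
Qed.

Lemma stdn_opp (A : set R) : measurable A -> stdn (-%R @^-1` A) = stdn A.
Proof.
move=> mA.
have mNA : measurable (-%R @^-1` A).
  rewrite -[X in measurable X]setTI.
  have mN : measurable_fun setT (-%R : R -> R) by exact: measurable_funN.
  exact: mN.
rewrite !stdnE integral_mkcond [RHS]integral_mkcond.
rewrite [RHS](@ge0_integral_affine _ (-1) 0)//.
- rewrite normrN1 mul1e; apply: eq_integral => x _.
  rewrite mulN1r addr0 !patchE /=.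
  have -> : (x \in -%R @^-1` A) = (- x \in A) by apply/idP/idP; rewrite !inE.
  case: ifP => // _; rewrite !normal_pdfE ?oner_eq0//.
  by rewrite /normal_fun !subr0 sqrrN.
- apply/(measurable_restrictT _ mA).
  by apply/measurable_EFinP/measurable_funTS; exact: measurable_normal_pdf.
- by move=> x; rewrite patchE; case: ifP => // _; rewrite lee_fin normal_pdf_ge0.
Qed.

(** Otherwise the density, positive everywhere, would vanish almost everywhere on an interval of
    positive length. *)
Lemma stdn_itv_gt0 (x y : R) : x < y -> (0 < stdn `]x, y])%E.
Proof.
move=> xy; rewrite lt0e measure_ge0 andbT; apply/eqP => n0.
have mpdf : measurable_fun [set: R] (fun x => (normal_pdf 0 1 x : R)%:E).
  by apply/measurable_EFinP; exact: measurable_normal_pdf.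
have : ae_eq lam `]x, y]%classic (fun x => (normal_pdf 0 1 x : R)%:E) (cst 0%E).
  apply/ae_eq_integral_abs => //; first exact: measurable_funTS.
  rewrite -[RHS]n0 stdnE; apply: eq_integral => z _.
  by rewrite gee0_abs// lee_fin normal_pdf_ge0.
move=> [M [mM M0 sM]].
suff : (lam `]x, y] <= lam M)%E.
  by rewrite M0 lebesgue_measure_itv/= lte_fin xy -EFinD lee_fin subr_le0 leNgt xy.
apply: le_measure; rewrite ?inE// => z xyz; apply: sM => /= /(_ xyz) [].
rewrite normal_pdfE ?oner_eq0// => /eqP.
by rewrite mulf_eq0 !gt_eqF// ?expR_gt0// normal_peak_gt0.
Qed.

Lemma stdn_second_moment : (\int[stdn]_x (x ^+ 2)%:E < +oo)%E.
Proof.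
have msq : measurable_fun [set: R] (fun x : R => (x ^+ 2)%:E).
  by apply/measurable_EFinP; exact: measurable_funX.
rewrite ge0_integral_stdn//; last by move=> x; rewrite lee_fin sqr_ge0.
have s0 : Num.sqrt 2 != 0 :> R by rewrite gt_eqF// sqrtr_gt0.
have s2 : (Num.sqrt 2 : R) ^+ 2 = 2 by rewrite sqr_sqrtr.
(* The integrand is dominated by K times the density of N(0, 2): one factor exp(-x^2/4) of
   exp(-x^2/2) is kept, the other absorbs x^2 because x^2 exp(-x^2/4) <= 4. The quotient of peaks
   exchanges the normalising constants. *)
pose K : R := 4 * normal_peak 1 / normal_peak (Num.sqrt 2).
have K0 : 0 <= K by rewrite divr_ge0 ?mulr_ge0 ?normal_peak_ge0.
apply: (@le_lt_trans _ _ (\int[lam]_x (K * normal_pdf 0 (Num.sqrt 2) x)%:E)%E).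
  apply: ge0_le_integral => //.
  - by move=> x _; rewrite -EFinM lee_fin mulr_ge0 ?sqr_ge0 ?normal_pdf_ge0.
  - by apply: emeasurable_funM => //; apply/measurable_EFinP; exact: measurable_normal_pdf.
  - by apply/measurable_EFinP/measurable_funM => //; exact: measurable_normal_pdf.
  - move=> x _; rewrite -EFinM lee_fin !normal_pdfE ?oner_eq0//.
    have -> : K * (normal_peak (Num.sqrt 2) * normal_fun 0 (Num.sqrt 2) x) =
       4 * normal_peak 1 * normal_fun 0 (Num.sqrt 2) x.
      by rewrite /K mulrA divfK// gt_eqF// normal_peak_gt0.
    have -> : normal_fun 0 1 x = normal_fun 0 (Num.sqrt 2) x * expR (- (x ^+ 2 / 4)).
      by rewrite /normal_fun s2 -expRD; congr expR; rewrite !subr0; field.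
    have h : x ^+ 2 * expR (- (x ^+ 2 / 4)) <= 4.
      rewrite expRN ler_pdivrMr ?expR_gt0//.
      have := expR_ge1Dx (x ^+ 2 / 4); lra.
    have : 0 <= normal_peak 1 * normal_fun 0 (Num.sqrt 2) x.
      by rewrite mulr_ge0 ?normal_peak_ge0 ?normal_fun_ge0.
    by nra.
rewrite -[ltLHS]/(\int[lam]_x (K%:E * (normal_pdf 0 (Num.sqrt 2) x)%:E))%E.
rewrite ge0_integralZl//.
- by rewrite integral_normal_pdf mule1 ltry.
- by apply/measurable_EFinP; exact: measurable_normal_pdf.
- by move=> x _; rewrite lee_fin normal_pdf_ge0.
Qed.

End standard_normal.

(** * Standard Gaussian vectors *)

Section gaussian_vectors.
Context {R : realType} {d} {T : measurableType d} (P : probability T R).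

Lemma measurable_preimageT {d1 d2} {T1 : measurableType d1} {T2 : measurableType d2}
    (f : T1 -> T2) (A : set T2) :
  measurable_fun setT f -> measurable A -> measurable (f @^-1` A).
Proof. by move=> mf mA; rewrite -[X in measurable X]setTI; exact: mf. Qed.

Definition std_vec (k : nat) (X : T -> k.-tuple R) :=
  measurable_fun setT X /\
  forall B : 'I_k -> set R, (forall i, measurable (B i)) ->
    P [set w | forall i, B i (tnth (X w) i)] = (\prod_(i < k) stdn (B i))%E.

Lemma measurable_coord (k : nat) (X : T -> k.-tuple R) i :
  measurable_fun setT X -> measurable_fun setT (fun w => tnth (X w) i).
Proof. by move/measurable_fun_tnthP => /(_ i). Qed.

Lemma std_vec_coord (k : nat) (X : T -> k.-tuple R) i :
  std_vec X -> has_law P (fun w => tnth (X w) i) stdn.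
Proof.
move=> [mX sX] A mA.
have := sX (fun j => if j == i then A else setT).
rewrite (bigD1 i)//= eqxx big1 ?mule1 => [<-|j /negbTE ->]; last exact: probability_setT.
  congr (P _); apply/seteqP; split=> w /=; last by move=> /(_ i); rewrite eqxx.
  by move=> Aw j; case: eqP => // ->.
by move=> j; case: ifP.
Qed.

(** Zeroing the other coordinates, instead of extracting a shorter tuple, keeps every subfamily in
    the same type. *)
Definition mask (k : nat) (J : pred 'I_k) (z : k.-tuple R) : k.-tuple R :=
  [tuple if J i then tnth z i else 0 | i < k].

Lemma measurable_mask (k : nat) (J : pred 'I_k) : measurable_fun setT (@mask k J).
Proof.
apply/measurable_fun_tnthP => i; rewrite (_ : _ \o _ = fun z => if J i then tnth z i else 0).
  by case: (J i) => //; exact: measurable_tnth.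
by apply/funext => z /=; rewrite tnth_mktuple.
Qed.

Lemma std_vec_indep_mask (k : nat) (X : T -> k.-tuple R) (J : pred 'I_k) :
  std_vec X -> indep P (mask J \o X) (mask (predC J) \o X).
Proof.
move=> [mX sX].
apply: indep_pi_system (@measurable_tuple_rectangle _ R k) _ _
    (@measurable_tuple_rectangle _ R k) _ _ _.
- exact: measurableT_comp (measurable_mask _) mX.
- exact: measurableT_comp (measurable_mask _) mX.
- exact: rectangle_setI.
- exact: rectangleT.
- exact: rectangle_setI.
- exact: rectangleT.
move=> _ _ [B1 mB1 ->] [B2 mB2 ->].
(* The preimage of a rectangle under [mask K] is again a rectangle; at a masked coordinate its side
   is everything or nothing, according to whether 0 lies in [B i]. Each coordinate therefore
   constrains only one of the two events. *)
pose C (K : pred 'I_k) (B : 'I_k -> set R) i := (fun x => if K i then x else 0) @^-1` B i.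
have mC K B : (forall i, measurable (B i)) -> forall i, measurable (C K B i).
  by move=> mB i; apply: measurable_preimageT => //; case: (K i).
have CE K B : (mask K \o X) @^-1` [set z | forall i, B i (tnth z i)] =
    [set w | forall i, C K B i (tnth (X w) i)].
  by apply/seteqP; split=> w /= h i; have := h i; rewrite /C /= tnth_mktuple.
rewrite !CE (sX _ (mC _ _ mB1)) (sX _ (mC _ _ mB2)).
pose D i := C J B1 i `&` C (predC J) B2 i.
rewrite (_ : _ `&` _ = [set w | forall i, D i (tnth (X w) i)]); last first.
  apply/seteqP; split=> w /=; first by move=> [h1 h2] i; split.
  by move=> h; split=> i; have [] := h i.
rewrite sX => [|i]; last by apply: measurableI; exact: mC.
rewrite -big_split /=; apply: eq_bigr => i _.
rewrite /D /C /=; case: (J i) => /=.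
  have [b|b] := pselect (B2 i 0).
    rewrite (_ : (fun=> 0) @^-1` B2 i = setT) ?setIT ?probability_setT ?mule1//.
    by apply/seteqP; split.
  rewrite (_ : (fun=> 0) @^-1` B2 i = set0) ?setI0 ?measure0 ?mule0//.
  by apply/seteqP; split.
have [b|b] := pselect (B1 i 0).
  rewrite (_ : (fun=> 0) @^-1` B1 i = setT) ?setTI ?probability_setT ?mul1e//.
  by apply/seteqP; split.
rewrite (_ : (fun=> 0) @^-1` B1 i = set0) ?set0I ?measure0 ?mul0e//.
by apply/seteqP; split.
Qed.

Definition rot (k : nat) (i j : 'I_k) (c s : R) (z : k.-tuple R) : k.-tuple R :=
  [tuple if l == i then c * tnth z i + s * tnth z j
         else if l == j then c * tnth z j - s * tnth z i else tnth z l | l < k].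

Lemma measurable_rot (k : nat) (i j : 'I_k) (c s : R) : measurable_fun setT (rot i j c s).
Proof.
apply/measurable_fun_tnthP => l.
rewrite (_ : _ \o _ = fun z => if l == i then c * tnth z i + s * tnth z j
         else if l == j then c * tnth z j - s * tnth z i else tnth z l); last first.
  by apply/funext => z /=; rewrite tnth_mktuple.
have mt (a : R) (m : 'I_k) : measurable_fun setT (fun z : k.-tuple R => a * tnth z m).
  by apply: measurable_funM => //; exact: measurable_tnth.
case: (l == i); first exact: measurable_funD.
case: (l == j); first exact: measurable_funB.
exact: measurable_tnth.
Qed.

(** Coordinates i and j are independent of all others, by masking, and their joint law is the
    rotation invariant product on the plane. *)
Lemma std_vec_rot (k : nat) (X : T -> k.-tuple R) (i j : 'I_k) (c s : R) :
  i != j -> c ^+ 2 + s ^+ 2 = 1 -> std_vec X -> std_vec (rot i j c s \o X).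
Proof.
move=> ij cs sX; have [mX hX] := sX.
split; first exact: measurableT_comp (measurable_rot _ _ _ _) mX.
move=> B mB.
have ind J := std_vec_indep_mask J sX.
have mmask J : measurable_fun setT (@mask k J \o X).
  exact: measurableT_comp (measurable_mask _) mX.
pose J := pred2 i j.
have indij : indep P (fun w => tnth (X w) i) (fun w => tnth (X w) j).
  have := indep_comp (measurable_tnth i) (measurable_tnth j) (ind (pred1 i)).
  congr indep; apply/funext => w /=; rewrite tnth_mktuple /= ?eqxx//.
  by rewrite eq_sym ij.
have lawij := indep_joint_law (measurable_coord i mX) (measurable_coord j mX)
  indij (std_vec_coord i sX) (std_vec_coord j sX).
pose E := [set x : R * R | B i (c * x.1 + s * x.2) /\ B j (c * x.2 - s * x.1)].
have mrot2 : measurable_fun [set: R * R] (fun w : R * R => (c * w.1 + s * w.2, c * w.2 - s * w.1)).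
  apply: measurable_fun_pair.
    by apply: measurable_funD; exact: measurable_funM.
  by apply: measurable_funB; exact: measurable_funM.
have mE : measurable E.
  exact: (measurable_preimageT mrot2 (measurableX (mB i) (mB j))).
have PE : P [set w | E (tnth (X w) i, tnth (X w) j)] = (stdn (B i) * stdn (B j))%E.
  rewrite lawij//; transitivity ((stdn \x stdn)%E (B i `*` B j)).
    by rewrite -(stdn_rotation cs (measurableX (mB i) (mB j))).
  exact: product_measure1E.
(* The constraints on the coordinates left alone by the rotation. *)
pose F := [set z : k.-tuple R | forall l, (if J l then setT else B l) (tnth z l)].
have mBJ l : measurable ((if J l then setT else B l) : set R) by case: ifP.
have PF : P [set w | F (X w)] = (\prod_(l < k | ~~ J l) stdn (B l))%E.
  rewrite (hX _ mBJ : P [set w | F (X w)] = _) [RHS]big_mkcond /=; apply: eq_bigr => l _.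
  by rewrite /J /=; case: (_ || _) => //=; exact: probability_setT.
have -> : [set w | forall l, B l (tnth ((rot i j c s \o X) w) l)] =
   [set w | E (tnth (X w) i, tnth (X w) j)] `&` [set w | F (X w)].
  apply/seteqP; split=> w /=.
    move=> h; split.
      have := h i; have := h j.
      by rewrite !tnth_mktuple eqxx eq_sym (negbTE ij) eqxx.
    move=> l; have := h l; rewrite tnth_mktuple /J /=.
    by case: (l == i) => //; case: (l == j).
  move=> [[h1 h2] h3] l; have := h3 l; rewrite tnth_mktuple /J /=.
  by have [->//|_] := eqVneq l i; have [->//|_] := eqVneq l j.
have := ind J.
move=> /(_ [set z | E (tnth z i, tnth z j)] F).
rewrite /= (_ : (mask J \o X) @^-1` [set z | E (tnth z i, tnth z j)] =
   [set w | E (tnth (X w) i, tnth (X w) j)]); last first.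
  by apply/seteqP; split=> w /=; rewrite !tnth_mktuple /= !eqxx ?orbT.
rewrite (_ : (mask (predC J) \o X) @^-1` F = [set w | F (X w)]); last first.
  apply/seteqP; split=> w /= h l; have := h l; rewrite !tnth_mktuple /J/=;
    by case: (_ || _).
move=> ->.
- rewrite PE PF [RHS](bigD1 i)//= [X in _ = (_ * X)%E](bigD1 j)/=; last by rewrite eq_sym.
  by rewrite muleA; congr (_ * _)%E; apply: eq_bigl => l; rewrite negb_or andbC.
- apply: (measurable_preimageT _ mE).
  by apply: measurable_fun_pair; exact: measurable_tnth.
- exact: (measurable_rectangle mBJ).
Qed.

Lemma std_vec_signed_select (n k : nat) (X : T -> k.-tuple R) (f : 'I_n -> 'I_k)
    (e : 'I_n -> R) : injective f -> (forall i, e i ^+ 2 = 1) -> std_vec X ->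
  std_vec (fun w => [tuple e i * tnth (X w) (f i) | i < n]).
Proof.
move=> injf e1 [mX hX]; split.
  apply/measurable_fun_tnthP => i; rewrite (_ : _ \o _ = fun w => e i * tnth (X w) (f i)).
    by apply: measurable_funM => //; exact: measurable_coord.
  by apply/funext => w /=; rewrite tnth_mktuple.
move=> B mB.
(* The constraint is carried back to source coordinate l. By injectivity of [f] there is at most
   one; a coordinate outside the image of [f] is unconstrained and contributes a factor 1. *)
pose C l := if [pick i | f i == l] is Some i then (fun x => e i * x) @^-1` B i else setT.
have mC l : measurable (C l).
  rewrite /C; case: pickP => // i _.
  by apply: measurable_preimageT => //; exact: measurable_funM.
have CE i : C (f i) = (fun x => e i * x) @^-1` B i.
  rewrite /C; case: pickP => [j /eqP/injf ->//|/(_ i)]; by rewrite eqxx.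
rewrite (_ : [set w | _] = [set w | forall l, C l (tnth (X w) l)]); last first.
  apply/seteqP; split=> w /= h i; last by have := h (f i); rewrite CE tnth_mktuple.
  by rewrite /C; case: pickP => // j /eqP <-; have := h j; rewrite tnth_mktuple.
rewrite hX//; transitivity (\prod_(i < n) stdn (C (f i)))%E.
  rewrite (partition_big f predT)//=; apply: eq_bigr => l _.
  rewrite (eq_bigr (fun=> stdn (C l))) => [|i /eqP ->//].
  rewrite {1}/C; case: pickP => [i /eqP <-|h].
    by rewrite (big_pred1 i) ?CE// => j /=; rewrite (inj_eq injf).
  by rewrite probability_setT big_pred0.
apply: eq_bigr => i _; rewrite CE.
have : (e i - 1) * (e i + 1) = 0 by rewrite -subr_sqr e1 expr1n subrr.
move/eqP; rewrite mulf_eq0 subr_eq0 addr_eq0 => /orP[]/eqP ->.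
  by congr (stdn _); apply/seteqP; split=> x /=; rewrite mul1r.
rewrite -[RHS]stdn_opp//.
by congr (stdn _); apply/seteqP; split=> x /=; rewrite mulN1r.
Qed.

End gaussian_vectors.

(** * Plane rotations and orthogonal invariance *)

Section givens.
Context {R : realType} (k : nat).
Implicit Types (i j a b : 'I_k).

(** Right multiplication combines columns i and j, as needed to annihilate entries, while the
    transpose acts on vectors as [rot i j c s]. *)
Definition givens i j (c s : R) : 'M[R]_k := \matrix_(a, b)
  if b == i then (if a == i then c else if a == j then s else 0)
  else if b == j then (if a == i then - s else if a == j then c else 0)
  else (a == b)%:R.

Lemma sum_two (F : 'I_k -> R) i j x y : i != j ->
  \sum_l F l * (if l == i then x else if l == j then y else 0) = F i * x + F j * y.
Proof.
move=> ij; rewrite (bigD1 i)//= eqxx (bigD1 j)/=; last by rewrite eq_sym.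
rewrite eqxx eq_sym (negbTE ij) big1 ?addr0// => l /andP[/negbTE -> /negbTE ->].
by rewrite mulr0.
Qed.

Lemma mul_givensE (n : nat) (Q : 'M[R]_(n, k)) i j (c s : R) (r : 'I_n) b : i != j ->
  (Q *m givens i j c s) r b =
  if b == i then c * Q r i + s * Q r j
  else if b == j then c * Q r j - s * Q r i else Q r b.
Proof.
move=> ij; rewrite mxE; under eq_bigr do rewrite mxE.
have [bi|bi] := eqVneq b i; first by rewrite sum_two//; ring.
have [bj|bj] := eqVneq b j; first by rewrite sum_two//; ring.
rewrite (bigD1 b)//= eqxx mulr1 big1 ?addr0// => l /negbTE ->.
by rewrite mulr0.
Qed.

Lemma givens_orth i j (c s : R) : i != j -> c ^+ 2 + s ^+ 2 = 1 ->
  givens i j c s *m (givens i j c s)^T = 1%:M.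
Proof.
move=> ij cs; apply: mulmx1C; apply/matrixP => a b.
have ji : (j == i) = false by rewrite eq_sym (negbTE ij).
have ii : (i == j) = false by rewrite (negbTE ij).
rewrite mul_givensE// !mxE !eqxx ?ii ?ji.
have [E|bi] := eqVneq b i.
  subst b; rewrite ?ii; have [E|ai] := eqVneq a i; first by rewrite -[RHS]cs; ring.
  have [E|aj] := eqVneq a j; first by rewrite /=; ring.
  by rewrite /=; ring.
have [E|bj] := eqVneq b j.
  subst b; have [E|ai] := eqVneq a i; first by subst a; rewrite ?ii /=; ring.
  have [E|aj] := eqVneq a j; first by rewrite -[RHS]cs; ring.
  by rewrite /=; ring.
have [E|ai] := eqVneq a i; first by subst a; rewrite eq_sym (negbTE bi).
have [E|aj] := eqVneq a j; first by subst a; rewrite eq_sym (negbTE bj).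
by rewrite eq_sym.
Qed.

Lemma givens_trE i j (c s : R) (z : k.-tuple R) : i != j ->
  tupv ((givens i j c s)^T *m colv z) = rot i j c s z.
Proof.
move=> ij; apply: eq_from_tnth => l; rewrite !tnth_mktuple.
have -> : (givens i j c s)^T *m colv z = ((colv z)^T *m givens i j c s)^T.
  by rewrite trmx_mul trmxK.
by rewrite mxE mul_givensE// !mxE.
Qed.

End givens.

Section orthogonal_invariance.
Context {R : realType} {d} {T : measurableType d} (P : probability T R).

Definition mulv (n k : nat) (S : 'M[R]_(n, k)) (z : k.-tuple R) : n.-tuple R :=
  tupv (S *m colv z).

Lemma colvK (n : nat) (z : n.-tuple R) : tupv (colv z) = z.
Proof. by apply: eq_from_tnth => i; rewrite tnth_mktuple mxE. Qed.

Lemma tupvK (n : nat) (v : 'cV[R]_n) : colv (tupv v) = v.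
Proof. by apply/colP => i; rewrite mxE tnth_mktuple. Qed.

Lemma mulvA (m n k : nat) (S1 : 'M[R]_(m, n)) (S2 : 'M[R]_(n, k)) z :
  mulv S1 (mulv S2 z) = mulv (S1 *m S2) z.
Proof. by rewrite /mulv tupvK mulmxA. Qed.

Lemma mul1v (k : nat) (z : k.-tuple R) : mulv 1%:M z = z.
Proof. by rewrite /mulv mul1mx colvK. Qed.

Lemma measurable_affine (n k : nat) (m : 'cV[R]_n) (S : 'M[R]_(n, k)) :
  measurable_fun setT (fun z : k.-tuple R => tupv (m + S *m colv z)).
Proof.
apply/measurable_fun_tnthP => i.
rewrite (_ : _ \o _ = fun z => m i 0 + \sum_l S i l * tnth z l).
  apply: measurable_funD => //; apply: measurable_sum => l.
  by apply: measurable_funM => //; exact: measurable_tnth.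
apply/funext => z /=; rewrite tnth_mktuple !mxE; congr (_ + _).
by apply: eq_bigr => l _; rewrite mxE.
Qed.

Lemma measurable_mulv (n k : nat) (S : 'M[R]_(n, k)) : measurable_fun setT (mulv S).
Proof.
have := measurable_affine 0 S; congr measurable_fun.
by apply/funext => z; rewrite add0r.
Qed.

(** The transpose is there because S z = (S U)(U^T z). Being stable under products and containing
    the Givens rotations, this class carries the invariance along the triangularisation, with no
    need to factor a given orthogonal matrix. *)
Definition std_preserving (k : nat) (U : 'M[R]_k) :=
  U *m U^T = 1%:M /\ forall X, std_vec P X -> std_vec P (mulv (U^T) \o X).

Lemma std_preserving1 k : std_preserving (1%:M : 'M[R]_k).
Proof.
split=> [|X]; first by rewrite trmx1 mul1mx.
by rewrite trmx1; congr std_vec; apply/funext => w /=; rewrite mul1v.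
Qed.

Lemma std_preservingM k (U1 U2 : 'M[R]_k) :
  std_preserving U1 -> std_preserving U2 -> std_preserving (U1 *m U2).
Proof.
move=> [orth1 h1] [orth2 h2]; split=> [|X sX].
  by rewrite trmx_mul mulmxA -(mulmxA U1) orth2 mulmx1.
have := h2 _ (h1 _ sX); congr std_vec; apply/funext => w /=.
by rewrite mulvA trmx_mul.
Qed.

Lemma std_preserving_givens k (i j : 'I_k) (c s : R) : i != j ->
  c ^+ 2 + s ^+ 2 = 1 -> std_preserving (givens i j c s).
Proof.
move=> ij cs; split=> [|X sX]; first exact: givens_orth.
have := std_vec_rot ij cs sX; congr std_vec; apply/funext => w /=.
by rewrite /mulv givens_trE.
Qed.

(* Entry (r, c) is annihilated by rotating columns r and c; the entries already
   annihilated vanish in both of these columns. *)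
Lemma std_triangularize_step (n k : nat) (Q : 'M[R]_(n, k)) (r c : nat) :
  (exists2 U, std_preserving U & forall (i : 'I_n) (j : 'I_k), (i < j)%N ->
    (i < r)%N || (i == r :> nat) && (j < c)%N -> (Q *m U) i j = 0) ->
  exists2 U, std_preserving U & forall (i : 'I_n) (j : 'I_k), (i < j)%N ->
    (i < r)%N || (i == r :> nat) && (j < c.+1)%N -> (Q *m U) i j = 0.
Proof.
move=> [U sU hU].
(* Unless r < c, c < k and r < n, the new condition concerns no entry above the diagonal. *)
have [rc|cr] := ltnP r c; last first.
  exists U => // i j ij /orP[ir|/andP[/eqP ir]]; first by apply: hU; rewrite ?ir.
  by rewrite ltnS => jc; move: (leq_trans ij (leq_trans jc cr)); rewrite ir ltnn.
have [ck|kc] := ltnP c k; last first.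
  exists U => // i j ij /orP[ir|/andP[/eqP ir _]]; first by apply: hU; rewrite ?ir.
  by apply: hU; rewrite // ir eqxx (leq_trans (ltn_ord j) kc) orbT.
have [rn|nr] := ltnP r n; last first.
  exists U => // i j ij _; apply: hU => //.
  by rewrite (leq_trans (ltn_ord i) nr).
pose i0 := Ordinal rn; pose j0 := Ordinal (ltn_trans rc ck); pose j1 := Ordinal ck.
have j01 : j0 != j1 by rewrite -(inj_eq val_inj)/= neq_ltn rc.
pose u := (Q *m U) i0 j0; pose v := (Q *m U) i0 j1.
have [c0 [s0 [cs cv]]] : exists c0 s0 : R, c0 ^+ 2 + s0 ^+ 2 = 1 /\ c0 * v - s0 * u = 0.
  (* (c0, s0) is the unit vector along (u, v), or (1, 0) if u = v = 0. *)
  have [uv0|uv0] := eqVneq (u ^+ 2 + v ^+ 2) 0.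
    exists 1, 0; split; first by rewrite expr1n expr0n addr0.
    move/eqP: uv0; rewrite paddr_eq0 ?sqr_ge0// !sqrf_eq0 => /andP[_ /eqP ->].
    by rewrite mulr0 mul0r subr0.
  pose q := Num.sqrt (u ^+ 2 + v ^+ 2).
  have q2 : q ^+ 2 = u ^+ 2 + v ^+ 2 by rewrite sqr_sqrtr// addr_ge0 ?sqr_ge0.
  have q0 : q != 0 by rewrite -sqrf_eq0 q2.
  exists (u / q), (v / q); split; last by field.
  by rewrite !exprMn -mulrDl -q2 -exprMn mulfV// expr1n.
exists (U *m givens j0 j1 c0 s0).
  exact: std_preservingM sU (std_preserving_givens j01 cs).
move=> i j ij hij; rewrite mulmxA mul_givensE//.
have h00 : (i < r)%N -> (Q *m U) i j0 = 0 /\ (Q *m U) i j1 = 0.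
  move=> ir; split; apply: hU; rewrite ?ir//=.
  exact: ltn_trans ir rc.
have [Ej|jj0] := eqVneq j j0.
  have ir : (i < r)%N by rewrite -[r]/(val j0) -Ej.
  by have [-> ->] := h00 ir; rewrite !mulr0 addr0.
have [Ej|jj1] := eqVneq j j1.
  have [ir|ri] := ltnP i r; first by have [-> ->] := h00 ir; rewrite !mulr0 subr0.
  move: hij; rewrite ltnNge ri /= => /andP[/eqP ir _].
  by have -> : i = i0 by exact: val_inj.
apply: hU => //; move: hij => /orP[->//|/andP[-> jc]].
rewrite ltnS leq_eqVlt in jc; case/orP: jc => [/eqP jc|->]; last by rewrite orbT.
by move: jj1; rewrite -(inj_eq val_inj)/= jc eqxx.
Qed.

Lemma triangularize_entries (n k : nat) (Q : 'M[R]_(n, k)) (r c : nat) :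
  exists2 U, std_preserving U & forall (i : 'I_n) (j : 'I_k), (i < j)%N ->
    (i < r)%N || (i == r :> nat) && (j < c)%N -> (Q *m U) i j = 0.
Proof.
elim: r c => [|r IHr] c; elim: c => [|c IHc].
- by exists 1%:M => [|i j _]; [exact: std_preserving1|rewrite !ltn0 andbF].
- exact: std_triangularize_step IHc.
(* Having processed all k columns of row r amounts to starting row r + 1. *)
- have [U sU hU] := IHr k; exists U => // i j ij.
  rewrite ltn0 andbF orbF ltnS leq_eqVlt => /orP[ir|ir]; apply: hU => //.
    by rewrite ir ltn_ord orbT.
  by rewrite ir.
- exact: std_triangularize_step IHc.
Qed.

Lemma std_triangularize (n k : nat) (Q : 'M[R]_(n, k)) :
  exists2 U, std_preserving U & is_trig_mx (Q *m U).
Proof.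
have [U sU hU] := triangularize_entries Q n 0.
exists U => //; apply/is_trig_mxP => i j ij; apply: hU => //.
by rewrite ltn_ord.
Qed.

(** Induction on the row: the earlier rows are signed unit vectors, so orthogonality to them kills
    the entries left of the diagonal, triangularity kills those to the right, and the norm 1 leaves
    a diagonal entry of square 1. A row with index at least k would be zero. *)
Lemma orthonormal_trig (n k : nat) (Q : 'M[R]_(n, k)) :
  Q *m Q^T = 1%:M -> is_trig_mx Q -> forall i : 'I_n, exists l : 'I_k,
    [/\ l = i :> nat, Q i l ^+ 2 = 1 & forall l', l' != l -> Q i l' = 0].
Proof.
move=> QQ /is_trig_mxP tQ i.
have [m] := ubnP i; elim: m i => // m IHm i; rewrite ltnS => im.
have lt0 (j : 'I_k) : (j < i)%N -> Q i j = 0.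
  move=> ji; have jn : (j < n)%N := ltn_trans ji (ltn_ord i).
  have [l [lj Ql hl]] := IHm (Ordinal jn) (leq_trans ji im).
  have El : l = j by apply: val_inj.
  have /matrixP/(_ i (Ordinal jn)) := QQ.
  rewrite !mxE (bigD1 l)//= !mxE big1 ?addr0 => [|l' ll']; last by rewrite mxE hl// mulr0.
  have -> : (i == Ordinal jn) = false by apply/eqP => /(congr1 val) /= E; rewrite E ltnn in ji.
  move/eqP; rewrite mulf_eq0 El => /orP[/eqP//|/eqP Q0].
  by move: Ql; rewrite El Q0 expr0n /= => /esym/eqP; rewrite oner_eq0.
have hne (j : 'I_k) : j != i :> nat -> Q i j = 0.
  by rewrite neq_ltn => /orP[/lt0//|/tQ].
have /matrixP/(_ i i) := QQ; rewrite !mxE eqxx.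
have [ik|ki] := ltnP i k; last first.
  rewrite big1 => [/esym/eqP|j _]; first by rewrite oner_eq0.
  by rewrite hne ?mul0r// neq_ltn (leq_trans (ltn_ord j) ki).
rewrite (bigD1 (Ordinal ik))//= mxE big1 ?addr0 => [Q1|j ji]; last by rewrite hne ?mul0r.
by exists (Ordinal ik); split => // l' /hne.
Qed.

Lemma std_diagonalize (n k : nat) (S : 'M[R]_(n, k)) : S *m S^T = 1%:M ->
  exists (U : 'M[R]_k) (f : 'I_n -> 'I_k) (e : 'I_n -> R),
    [/\ std_preserving U, injective f, forall i, e i ^+ 2 = 1 &
        forall i l, (S *m U) i l = if l == f i then e i else 0].
Proof.
move=> SS; have [U [UU sU] tU] := std_triangularize S.
have QQ : (S *m U) *m (S *m U)^T = 1%:M.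
  by rewrite trmx_mul mulmxA -(mulmxA S) UU mulmx1.
have h := orthonormal_trig QQ tU.
have [f hf] := boolp.choice h.
exists U, f, (fun i => (S *m U) i (f i)); split=> //.
- move=> i j fij; apply: val_inj => /=.
  by have [<- _ _] := hf i; have [<- _ _] := hf j; rewrite fij.
- by move=> i; have [] := hf i.
- by move=> i l; case: eqP => [->//|/eqP]; have [_ _] := hf i; exact.
Qed.

(** S X = (S U)(U^T X), where U^T X is standard and S U only selects distinct coordinates up to
    sign. *)
Lemma std_vec_orthonormal (n k : nat) (S : 'M[R]_(n, k)) (X : T -> k.-tuple R) :
  S *m S^T = 1%:M -> std_vec P X -> std_vec P (mulv S \o X).
Proof.
move=> SS sX; have [U [f [e [[UU sU] fi e1 SU]]]] := std_diagonalize SS.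
have := std_vec_signed_select fi e1 (sU _ sX); congr std_vec; apply/funext => w /=.
rewrite -[in RHS](mul1v (X w)) -UU -mulvA mulvA.
apply: eq_from_tnth => i; rewrite !tnth_mktuple [RHS]mxE.
rewrite (bigD1 (f i))//= SU eqxx big1 ?addr0 => [|l /negbTE li]; last by rewrite SU li mul0r.
by rewrite /mulv tupvK.
Qed.

(** In the coordinates U^T X, S uses only the coordinates selected by [f], and orthogonality makes
    the corresponding columns of V U vanish; so the two images are functions of complementary
    masks. *)
Lemma std_vec_indep_orthogonal (n m k : nat) (S : 'M[R]_(n, k)) (V : 'M[R]_(m, k))
    (X : T -> k.-tuple R) :
  S *m S^T = 1%:M -> S *m V^T = 0 -> std_vec P X ->
  indep P (mulv S \o X) (mulv V \o X).
Proof.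
move=> SS SV sX; have [U [f [e [[UU sU] fi e1 SU]]]] := std_diagonalize SS.
have VU i l : (V *m U) l (f i) = 0.
  have : ((S *m U) *m (V *m U)^T) i l = 0.
    by rewrite trmx_mul mulmxA -(mulmxA S) UU mulmx1 SV mxE.
  rewrite mxE (bigD1 (f i))//= SU eqxx big1 ?addr0 => [|j /negbTE ji]; last first.
    by rewrite SU ji mul0r.
  rewrite [_^T _ _]mxE => /eqP; rewrite mulf_eq0 => /orP[/eqP e0|/eqP//].
  by have := e1 i; rewrite e0 expr0n /= => /esym/eqP; rewrite oner_eq0.
pose J := [pred l | l \in codom f].
have SE p (Q : 'M[R]_(p, k)) w : mulv Q (X w) = mulv (Q *m U) (mulv (U^T) (X w)).
  by rewrite mulvA -mulmxA UU mulmx1.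
have := indep_comp (measurable_mulv (S *m U)) (measurable_mulv (V *m U))
  (std_vec_indep_mask J (sU _ sX)).
congr indep; apply/funext => w /=.
  rewrite [RHS]SE.
  apply: eq_from_tnth => i; rewrite !tnth_mktuple [LHS]mxE [RHS]mxE; apply: eq_bigr => l _.
  rewrite SU !mxE tnth_mktuple; case: eqP => [->|]; last by rewrite !mul0r.
  by rewrite /= codom_f.
rewrite [RHS]SE.
apply: eq_from_tnth => i; rewrite !tnth_mktuple [LHS]mxE [RHS]mxE; apply: eq_bigr => l _.
rewrite [X in _ * X = _]mxE [X in _ = _ * X]mxE tnth_mktuple /=; case: ifP => //.
by move=> /negbFE/codomP[j ->]; rewrite VU !mul0r.
Qed.

End orthogonal_invariance.

(** * Square-integrable variables *)

Section square_integrable.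
Context {R : realType} {d} {T : measurableType d} (P : probability T R).
Implicit Types f g : T -> R.

Lemma ge0_integral_law {d1} {T1 : measurableType d1} (X : T -> T1)
    (Q : {measure set T1 -> \bar R}) (f : T1 -> \bar R) :
  measurable_fun setT X -> has_law P X Q ->
  measurable_fun setT f -> (forall x, 0 <= f x)%E ->
  (\int[P]_w f (X w) = \int[Q]_x f x)%E.
Proof.
move=> mX lX mf f0.
transitivity (\int[pushforward P X]_x f x)%E.
  by rewrite ge0_integral_pushforward// preimage_setT.
by apply: eq_measure_integral => A mA _; exact: lX.
Qed.

Lemma integral_law {d1} {T1 : measurableType d1} (X : T -> T1)
    (Q : {measure set T1 -> \bar R}) (f : T1 -> \bar R) :
  measurable_fun setT X -> has_law P X Q ->
  measurable_fun setT f -> P.-integrable setT (f \o X) ->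
  (\int[P]_w f (X w) = \int[Q]_x f x)%E.
Proof.
move=> mX lX mf intf.
transitivity (\int[pushforward P X]_x f x)%E.
  by rewrite integral_pushforward// preimage_setT.
by apply: eq_measure_integral => A mA _; exact: lX.
Qed.

Definition mean f : R := Rintegral P setT f.

Definition L2 f :=
  measurable_fun setT f /\ P.-integrable setT (EFin \o (fun w => f w ^+ 2)).

Lemma L2M f g : L2 f -> L2 g -> P.-integrable setT (EFin \o (fun w => f w * g w)).
Proof.
move=> [mf f2] [mg g2]; apply: le_integrable (integrableD measurableT f2 g2) => //.
  by apply/measurable_EFinP; exact: measurable_funM.
move=> w _; change (`|f w * g w|%:E <= `|f w ^+ 2 + g w ^+ 2|%:E)%E.
rewrite lee_fin [leRHS]ger0_norm ?addr_ge0 ?sqr_ge0//.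
rewrite normrM -(real_normK (num_real (f w))) -(real_normK (num_real (g w))).
have := sqr_ge0 (`|f w| - `|g w|); have := normr_ge0 (f w); have := normr_ge0 (g w).
nra.
Qed.

Lemma L2Z c f : L2 f -> L2 (fun w => c * f w).
Proof.
move=> [mf f2]; split; first exact: measurable_funM.
have := integrableZl measurableT (c ^+ 2) f2.
by apply: eq_integrable => // w _ /=; rewrite exprMn EFinM.
Qed.

Lemma L2D f g : L2 f -> L2 g -> L2 (fun w => f w + g w).
Proof.
move=> Lf Lg; have [mf f2] := Lf; have [mg g2] := Lg; split; first exact: measurable_funD.
have := integrableD measurableT (integrableD measurableT f2 g2)
  (integrableZl measurableT 2 (L2M Lf Lg)).
apply: eq_integrable => // w _ /=; rewrite -EFinM -!EFinD; congr EFin; ring.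
Qed.

Lemma L2_cst c : L2 (cst c).
Proof.
by split=> //; exact: (finite_measure_integrable_cst P (c ^+ 2)).
Qed.

Lemma L2_integrable f : L2 f -> P.-integrable setT (EFin \o f).
Proof.
move=> Lf; have := L2M Lf (L2_cst 1); apply: eq_integrable => // w _ /=.
by rewrite mulr1.
Qed.

Lemma integrable_sum_mean (I : finType) (F : I -> T -> R) :
  (forall i, P.-integrable setT (EFin \o F i)) ->
  P.-integrable setT (EFin \o (fun w => \sum_i F i w)) /\
  mean (fun w => \sum_i F i w) = \sum_i mean (F i).
Proof.
move=> intF; elim: (index_enum I) => [|i s [IH1 IH2]].
  split; last first.
    by rewrite big_nil /mean; under eq_Rintegral do rewrite big_nil; rewrite Rintegral_cst// mul0r.
  under [X in _ \o X]eq_fun do rewrite big_nil.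
  exact: (finite_measure_integrable_cst P 0).
split; last first.
  rewrite big_cons -IH2 -RintegralD//.
  by apply: eq_Rintegral => w _; rewrite big_cons.
have := integrableD measurableT (intF i) IH1.
by apply: eq_integrable => // w _ /=; rewrite big_cons EFinD.
Qed.

Lemma L2_sum (I : finType) (F : I -> T -> R) : (forall i, L2 (F i)) ->
  L2 (fun w => \sum_i F i w).
Proof.
move=> LF; elim: (index_enum I) => [|i s IH].
  by under [X in L2 X]eq_fun do rewrite big_nil; exact: (L2_cst 0).
under [X in L2 X]eq_fun do rewrite big_cons.
exact: L2D.
Qed.

Lemma mean_pythagoras (I : finType) (F : I -> T -> R) : (forall i, L2 (F i)) ->
  (forall i j, i != j -> mean (fun w => F i w * F j w) = 0) ->
  mean (fun w => (\sum_i F i w) ^+ 2) = \sum_i mean (fun w => F i w ^+ 2).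
Proof.
move=> LF oF.
transitivity (mean (fun w => \sum_i \sum_j F i w * F j w)).
  by apply: eq_Rintegral => w _; rewrite expr2 mulr_suml; apply: eq_bigr => i _; rewrite mulr_sumr.
rewrite (integrable_sum_mean _).2 => [|i]; last first.
  by apply: (integrable_sum_mean _).1 => j; exact: L2M.
apply: eq_bigr => i _; rewrite (integrable_sum_mean _).2 => [|j]; last exact: L2M.
rewrite (bigD1 i)//= big1 ?addr0 => [|j ji]; last by rewrite oF// eq_sym.
by apply: eq_Rintegral => w _; rewrite expr2.
Qed.

Lemma mean_sqr_eq0 f : L2 f -> mean (fun w => f w ^+ 2) = 0 -> {ae P, forall w, f w = 0}.
Proof.
move=> [mf f2] m0.
have : (\int[P]_w `|(f w ^+ 2)%:E| = 0)%E.
  under eq_integral do rewrite /= ger0_norm ?sqr_ge0//.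
  by rewrite -(fineK (integrable_fin_num measurableT f2)) -[fine _]/(mean _) m0.
have mf2 : measurable_fun setT (fun w => (f w ^+ 2)%:E).
  by apply/measurable_EFinP; exact: measurable_funX.
move=> /(ae_eq_integral_abs P measurableT mf2).
apply: filterS => w /(_ I) [] /eqP; rewrite sqrf_eq0 => /eqP//.
Qed.

Lemma eq_ae_mean f g : measurable_fun setT f -> measurable_fun setT g ->
  {ae P, forall w, f w = g w} -> mean f = mean g.
Proof.
move=> mf mg fg; congr fine; apply: ae_eq_integral => //.
- exact/measurable_EFinP.
- exact/measurable_EFinP.
- by apply: filterS fg => w /= -> _.
Qed.

(** The variance of N(0, 1), left as a symbol throughout; it stands for the bound 1 on the
    correlations of innovations. *)
Definition std_var : R := fine (\int[stdn]_x (x ^+ 2)%:E).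

Lemma std_L2 (Z : T -> R) : measurable_fun setT Z -> has_law P Z stdn ->
  L2 Z /\ mean (fun w => Z w ^+ 2) = std_var.
Proof.
move=> mZ lZ.
have msq : measurable_fun [set: R] (fun x : R => (x ^+ 2)%:E).
  by apply/measurable_EFinP; exact: measurable_funX.
have e : (\int[P]_w (Z w ^+ 2)%:E = \int[stdn]_x (x ^+ 2)%:E)%E.
  apply: (ge0_integral_law mZ lZ) => // x.
  by rewrite lee_fin sqr_ge0.
split; last by congr fine.
split=> //; apply/integrableP; split.
  by apply: measurableT_comp msq mZ.
under eq_integral do rewrite /= ger0_norm ?sqr_ge0//.
by rewrite e; exact: stdn_second_moment.
Qed.

(* (Z, W) and (-Z, W) have the same law. *)
Lemma mean_std_mul_indep (Z W : T -> R) : measurable_fun setT Z -> L2 W ->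
  has_law P Z stdn -> indep P Z W -> mean (fun w => Z w * W w) = 0.
Proof.
move=> mZ LW lZ iZW; have [mW _] := LW; have [LZ _] := std_L2 mZ lZ.
have mNZ : measurable_fun setT (fun w => - Z w) by exact: measurable_funN.
have mopp : measurable_fun setT (-%R : R -> R) by exact: measurable_funN.
have lNZ : has_law P (fun w => - Z w) stdn.
  move=> A mA; rewrite -stdn_opp// -lZ//.
  exact: measurable_preimageT.
have iNZW : indep P (fun w => - Z w) W.
  exact: (indep_comp mopp (@measurable_id _ _ setT) iZW).
have [Q lQ] := has_law_exists P mW.
have mp (U : T -> R) : measurable_fun setT U -> measurable_fun setT (fun w => (U w, W w)).
  by move=> mU; exact: measurable_fun_pair.
have mm : measurable_fun setT (fun x : R * R => (x.1 * x.2)%:E).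
  by apply/measurable_EFinP; exact: measurable_funM.
have E (U : T -> R) : measurable_fun setT U -> L2 U -> has_law P U stdn -> indep P U W ->
    (\int[P]_w (U w * W w)%:E = \int[stdn \x Q]_x (x.1 * x.2)%:E)%E.
  move=> mU LU lU iU.
  apply: (integral_law (mp _ mU) (indep_joint_law mU mW iU lU lQ)) => //.
  exact: L2M.
have h : mean (fun w => Z w * W w) = mean (fun w => - Z w * W w).
  rewrite /mean /Rintegral E// E//.
  by have := L2Z (-1) LZ; under [X in L2 X]eq_fun do rewrite mulN1r.
have h2 : mean (fun w => - Z w * W w) = - mean (fun w => Z w * W w).
  rewrite -mulN1r -RintegralZl//; last exact: L2M.
  by apply: eq_Rintegral => w _; rewrite mulN1r mulNr.
by rewrite h2 in h; lra.
Qed.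

Lemma ge0_integral_indep {d1 d2} {T1 : measurableType d1} {T2 : measurableType d2}
    (Z : T -> T1) (H : T -> T2) (B : set T1) (k : T2 -> \bar R) :
  measurable_fun setT Z -> measurable_fun setT H -> indep P Z H ->
  measurable B -> measurable_fun setT k -> (forall h, 0 <= k h)%E ->
  (\int[P]_(w in Z @^-1` B) k (H w) = P (Z @^-1` B) * \int[P]_w k (H w))%E.
Proof.
move=> mZ mH iZH mB mk k0.
have [Q1 l1] := has_law_exists P mZ; have [Q2 l2] := has_law_exists P mH.
have mB2 : measurable (fst @^-1` B : set (T1 * T2)).
  exact: measurable_preimageT measurable_fst mB.
have mphi : measurable_fun setT ((k \o snd) \_ (fst @^-1` B) : T1 * T2 -> \bar R).
  apply/(measurable_restrictT _ mB2)/measurable_funTS.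
  exact: measurableT_comp mk measurable_snd.
have phi0 (x : T1 * T2) : (0 <= ((k \o snd) \_ (fst @^-1` B)) x)%E.
  by rewrite patchE; case: ifP => //= _; exact: k0.
have mZH : measurable_fun setT (fun w => (Z w, H w)) by exact: measurable_fun_pair.
rewrite integral_mkcond.
transitivity (\int[Q1 \x Q2]_x ((k \o snd) \_ (fst @^-1` B)) x)%E.
  rewrite -(ge0_integral_law mZH (indep_joint_law mZ mH iZH l1 l2))//.
rewrite fubini_tonelli1// (ge0_integral_law mH l2 mk k0).
rewrite l1// muleC -(integral_cst Q1)// [RHS]integral_mkcond.
apply: eq_integral => z _; rewrite /= [RHS]patchE; case: ifPn => zB.
  by apply: eq_integral => h _; rewrite patchE /= mem_set//; exact: set_mem zB.
transitivity (\int[Q2]_h cst 0 h)%E; last exact: integral0.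
apply: eq_integral => h _; rewrite patchE memNset//=.
by move/mem_set; exact/negP.
Qed.

(** The nonnegative case is Tonelli on the product law; it is applied to the positive and negative
    parts, and integrability allows the factor to be distributed over their difference. *)
Lemma integral_indep {d1 d2} {T1 : measurableType d1} {T2 : measurableType d2}
    (Z : T -> T1) (H : T -> T2) (B : set T1) (C : set T2) (g : T2 -> R) :
  measurable_fun setT Z -> measurable_fun setT H -> indep P Z H ->
  measurable B -> measurable C -> measurable_fun setT g ->
  P.-integrable setT (fun w => (g (H w))%:E) ->
  (\int[P]_(w in Z @^-1` B `&` H @^-1` C) (g (H w))%:E =
   P (Z @^-1` B) * \int[P]_(w in H @^-1` C) (g (H w))%:E)%E.
Proof.
move=> mZ mH iZH mB mC mg ig.
have mEg : measurable_fun setT (EFin \o g) by exact/measurable_EFinP.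
have mHC : measurable (H @^-1` C) by exact: measurable_preimageT.
have key (k : T2 -> \bar R) : measurable_fun setT k -> (forall h, 0 <= k h)%E ->
  (\int[P]_(w in Z @^-1` B `&` H @^-1` C) k (H w) =
   P (Z @^-1` B) * \int[P]_(w in H @^-1` C) k (H w))%E.
  move=> mk k0; rewrite [X in (_ * X)%E]integral_mkcond integral_mkcondr.
  have e : (k \o H) \_ (H @^-1` C) = (k \_ C) \o H.
    by apply/funext => w; rewrite /= !patchE; congr (if _ then _ else _); apply/idP/idP; rewrite !inE.
  rewrite e; apply: (ge0_integral_indep mZ mH iZH mB).
    by apply/(measurable_restrictT _ mC)/measurable_funTS.
  by move=> h; rewrite patchE; case: ifP => //= _; exact: k0.
have igC : P.-integrable (H @^-1` C) ((EFin \o g) \o H).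
  exact: integrableS measurableT mHC (@subsetT _ _) ig.
rewrite integralE [X in (_ * X)%E]integralE.
have -> : (fun w => (g (H w))%:E) = (EFin \o g) \o H by [].
rewrite funepos_comp funeneg_comp.
rewrite (key _ (measurable_funepos mEg))// (key _ (measurable_funeneg mEg))//.
have fP : P (Z @^-1` B) \is a fin_num.
  by rewrite fin_num_measure//; exact: measurable_preimageT.
have ad := integrable_add_def mHC igC; rewrite funepos_comp funeneg_comp in ad.
by rewrite (muleBr fP ad).
Qed.

End square_integrable.

(** * Histories, whitening and causality *)

Section histories.
Context {R : realType} {N : nat}.
Implicit Types x y : N.-tuple R.

Lemma nth_tnth x (i : 'I_N) : nth 0 x i = tnth x i.
Proof. by rewrite (tnth_nth 0). Qed.

Lemma tnth_hist t x (i : 'I_t) : tnth (hist t x) i = nth 0 x i.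
Proof. by rewrite tnth_mktuple. Qed.

Lemma measurable_nth (i : nat) : measurable_fun setT (fun x => nth 0 x i).
Proof.
have [iN|Ni] := ltnP i N.
  rewrite (_ : (fun x => _) = fun x => tnth x (Ordinal iN)); first exact: measurable_tnth.
  by apply/funext => x; rewrite (tnth_nth 0).
rewrite (_ : (fun x => _) = cst 0)//.
by apply/funext => x; rewrite nth_default// size_tuple.
Qed.

Lemma measurable_hist t : measurable_fun setT (fun x => hist t x).
Proof.
apply/measurable_fun_tnthP => i.
rewrite (_ : _ \o _ = fun x => nth 0 x i); first exact: measurable_nth.
by apply/funext => x /=; rewrite tnth_hist.
Qed.

Lemma eq_hist t x y : (forall i : 'I_N, (i < t)%N -> tnth x i = tnth y i) ->
  hist t x = hist t y.
Proof.
move=> h; apply: eq_from_tnth => i; rewrite !tnth_hist.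
have [iN|Ni] := ltnP i N; last by rewrite !nth_default ?size_tuple.
by have := h (Ordinal iN) (ltn_ord i); rewrite -!nth_tnth.
Qed.

Lemma hist_coord t x y (i : 'I_N) : hist t x = hist t y -> (i < t)%N ->
  tnth x i = tnth y i.
Proof.
move=> h it; have := congr1 (fun z => tnth z (Ordinal it)) h.
by rewrite !tnth_hist /= !nth_tnth.
Qed.

End histories.
Arguments measurable_hist {R N} t.

(* Extends a history by zeros, so that a function of the past can be written as
   a function of the whole path. *)
Definition pad {R : realType} (N t : nat) (h : t.-tuple R) : N.-tuple R := hist N h.

Lemma tnth_pad_hist {R : realType} (N t : nat) (x : N.-tuple R) (i : 'I_N) :
  (i < t)%N -> tnth (pad N (hist t x)) i = tnth x i.
Proof. by move=> it; rewrite tnth_hist (nth_tnth _ (Ordinal it)) tnth_hist nth_tnth. Qed.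

Lemma hist_pad {R : realType} (N t s : nat) (x : N.-tuple R) : (s <= t)%N ->
  hist s (pad N (hist t x)) = hist s x.
Proof.
by move=> st; apply: eq_hist => i si; rewrite tnth_pad_hist// (leq_trans si).
Qed.

Section whitening.
Context {R : realType} {N : nat}.
Implicit Types (L : 'M[R]_N) (a : 'cV[R]_N) (x z : N.-tuple R).

Definition whiten L a x : N.-tuple R := tupv (invmx L *m (colv x - a)).

Definition unwhiten L a z : N.-tuple R := tupv (a + L *m colv z).

Definition pos_trig L := is_trig_mx L /\ forall i, 0 < L i i.

Lemma pos_trig_unit L : pos_trig L -> L \in unitmx.
Proof.
move=> [tL dL]; rewrite unitmxE det_trig// unitfE; apply/prodf_neq0 => i _.
by rewrite gt_eqF.
Qed.

Lemma whitenK L a x : pos_trig L -> unwhiten L a (whiten L a x) = x.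
Proof.
move=> pL; rewrite /unwhiten /whiten tupvK mulmxA mulmxV ?pos_trig_unit// mul1mx.
by rewrite addrC subrK colvK.
Qed.

Lemma unwhitenK L a z : pos_trig L -> whiten L a (unwhiten L a z) = z.
Proof.
move=> pL; rewrite /unwhiten /whiten tupvK addrC addKr mulmxA mulVmx ?pos_trig_unit//.
by rewrite mul1mx colvK.
Qed.

Lemma measurable_unwhiten L a : measurable_fun setT (unwhiten L a).
Proof. exact: measurable_affine. Qed.

Lemma measurable_whiten L a : measurable_fun setT (whiten L a).
Proof.
have := measurable_affine (- (invmx L *m a)) (invmx L); congr measurable_fun.
by apply/funext => x; rewrite /whiten mulmxBr addrC.
Qed.

(** The conditional mean of coordinate i given the earlier ones, expressed through the earlier
    innovations. *)
Definition drift L a (i : 'I_N) x : R :=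
  a i 0 + \sum_(j < N | (j < i)%N) L i j * tnth (whiten L a x) j.

Lemma tnth_unwhiten L a z (i : 'I_N) : is_trig_mx L ->
  tnth (unwhiten L a z) i =
  a i 0 + \sum_(j < N | (j < i)%N) L i j * tnth z j + L i i * tnth z i.
Proof.
move=> /is_trig_mxP tL; rewrite tnth_mktuple !mxE -addrA; congr (_ + _).
rewrite (bigID (fun j : 'I_N => (j < i)%N))/=; congr (_ + _).
  by apply: eq_bigr => j _; rewrite mxE.
rewrite (bigD1 i) ?ltnn//= mxE big1 ?addr0// => j /andP[ij ji].
rewrite tL ?mul0r// ltn_neqAle leqNgt ij andbT.
by rewrite -(inj_eq val_inj) in ji; rewrite eq_sym.
Qed.

Lemma tnth_drift L a x (i : 'I_N) : pos_trig L ->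
  tnth x i = drift L a i x + L i i * tnth (whiten L a x) i.
Proof.
by move=> pL; rewrite -{1}(whitenK a x pL) tnth_unwhiten//; case: pL.
Qed.

(** Forward substitution: each innovation is recovered from its coordinate and the earlier
    innovations, after cancelling the positive diagonal entry. With [eq_unwhiten], a path and its
    innovations carry the same information at each time. *)
Lemma eq_whiten L a x y (t : nat) : pos_trig L ->
  (forall j : 'I_N, (j < t)%N -> tnth x j = tnth y j) ->
  forall i : 'I_N, (i < t)%N -> tnth (whiten L a x) i = tnth (whiten L a y) i.
Proof.
move=> pL xy i; have [m] := ubnP i; elim: m i => // m IHm i; rewrite ltnS => im it.
have := xy i it; rewrite (tnth_drift a x i pL) (tnth_drift a y i pL) /drift.
rewrite (eq_bigr (fun j => L i j * tnth (whiten L a y) j)) => [|j ji]; last first.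
  by rewrite IHm//; [exact: leq_trans ji im|exact: ltn_trans ji it].
by move/addrI/mulfI; apply; case: pL => _ /(_ i) /gt_eqF ->.
Qed.

Lemma eq_unwhiten L a x y (t : nat) : pos_trig L ->
  (forall j : 'I_N, (j < t)%N -> tnth x j = tnth y j) ->
  forall i : 'I_N, (i < t)%N -> tnth (unwhiten L a x) i = tnth (unwhiten L a y) i.
Proof.
move=> [tL _] xy i it; rewrite !tnth_unwhiten// xy//; congr (_ + _ + _).
by apply: eq_bigr => j ji; rewrite xy// (ltn_trans ji it).
Qed.

Lemma drift_hist L a x y (i : 'I_N) : pos_trig L -> hist i x = hist i y ->
  drift L a i x = drift L a i y.
Proof.
move=> pL h; congr (_ + _); apply: eq_bigr => j ji; congr (_ * _).
by apply: eq_whiten ji => // k; exact: hist_coord.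
Qed.

Lemma measurable_drift L a (i : 'I_N) : measurable_fun setT (drift L a i).
Proof.
have -> : drift L a i = fun x => a i 0 + \sum_(j < N) (if (j < i)%N then L i j else 0) * tnth (whiten L a x) j.
  apply/funext => x; rewrite /drift big_mkcond; congr (_ + _); apply: eq_bigr => j _.
  by case: ifP => // _; rewrite mul0r.
apply: measurable_funD => //; apply: measurable_sum => j.
apply: measurable_funM => //; apply: measurable_coord; exact: measurable_whiten.
Qed.

End whitening.

Section gaussian_law.
Context {R : realType}.

Lemma std_vec_law_uniq {d1 d2} {T1 : measurableType d1} {T2 : measurableType d2}
    (P1 : probability T1 R) (P2 : probability T2 R) (k : nat)
    (X1 : T1 -> k.-tuple R) (X2 : T2 -> k.-tuple R) (E : set (k.-tuple R)) :
  std_vec P1 X1 -> std_vec P2 X2 -> measurable E -> P1 (X1 @^-1` E) = P2 (X2 @^-1` E).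
Proof.
move=> [mX1 h1] [mX2 h2] mE; rewrite -[X1 @^-1` E]setTI -[X2 @^-1` E]setTI -[RHS]mul1e.
apply: (law_uniq (@measurable_tuple_rectangle _ R k)) => //.
- exact: rectangle_setI.
- exact: rectangleT.
- by move=> _ [B mB ->]; rewrite !setTI mul1e [LHS]h1// [RHS]h2.
Qed.

Lemma is_std_gaussian_vec (k : nat) (gamma : probability (k.-tuple R) R) :
  is_std_gaussian gamma -> std_vec gamma (fun z => z).
Proof. by split. Qed.

(** S need not be square, but S S^T = L L^T makes the rows of L^{-1} S orthonormal. *)
Lemma gaussian_whiten (N : nat) (a : 'cV[R]_N) (A L : 'M[R]_N)
    (mu : probability (N.-tuple R) R) :
  is_cholesky A L -> is_gaussian a A mu -> std_vec mu (whiten L a).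
Proof.
move=> [AL tL dL] [k [S [gamma [sg AS hE]]]].
have pL : pos_trig L by [].
have SS : (invmx L *m S) *m (invmx L *m S)^T = 1%:M.
  rewrite trmx_mul mulmxA -(mulmxA (invmx L)) -AS AL mulmxA mulVmx ?pos_trig_unit// mul1mx.
  by rewrite -trmx_mul mulVmx ?pos_trig_unit// trmx1.
have [_ hQ] := std_vec_orthonormal SS (is_std_gaussian_vec sg).
split=> [|B mB]; first exact: measurable_whiten.
rewrite -hQ// hE; last first.
  exact: (measurable_preimageT (measurable_whiten L a) (measurable_rectangle mB)).
congr (gamma _); apply/funext => z /=; congr (forall i, B i (tnth _ i)).
by apply/funext => i; rewrite /whiten tupvK addrC addKr /mulv mulmxA.
Qed.

Lemma std_vec_comp_coupling (N : nat) (mu nu : probability (N.-tuple R) R)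
    (p : probability (N.-tuple R * N.-tuple R)%type R) (f : N.-tuple R -> N.-tuple R) :
  is_coupling mu nu p ->
  (std_vec mu f -> std_vec p (f \o fst)) /\ (std_vec nu f -> std_vec p (f \o snd)).
Proof.
move=> hp; split=> -[mf hf]; split=> [|B mB].
- exact: measurableT_comp.
- rewrite -hf// -(hp _ _).1//.
  exact: (measurable_preimageT mf (measurable_rectangle mB)).
- exact: measurableT_comp.
- rewrite -hf// -(hp _ _).2//.
  exact: (measurable_preimageT mf (measurable_rectangle mB)).
Qed.

End gaussian_law.

(** The past of X is unchanged when innovation s is replaced by 0, so it is a function of the other
    innovations. *)
Lemma innovation_indep_hist {R : realType} {N : nat} {d} {T : measurableType d}
    (p : probability T R) (X : T -> N.-tuple R) (L : 'M[R]_N) (a : 'cV[R]_N) (s : 'I_N) :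
  pos_trig L -> std_vec p (whiten L a \o X) ->
  indep p (fun w => tnth (whiten L a (X w)) s) (fun w => hist s (X w)).
Proof.
move=> pL sX.
have mh : measurable_fun setT (fun z : N.-tuple R => hist s (unwhiten L a z)).
  exact: measurableT_comp (measurable_hist s) (measurable_unwhiten L a).
have := indep_comp (measurable_tnth s) mh (std_vec_indep_mask (pred1 s) sX).
have -> : (fun z => tnth z s) \o (mask (pred1 s) \o (whiten L a \o X)) = fun w => tnth (whiten L a (X w)) s.
  by apply/funext => w /=; rewrite tnth_mktuple /= eqxx.
congr indep; apply/funext => w /=; apply: eq_hist => i si.
rewrite -[in RHS](whitenK a (X w) pL); apply: eq_unwhiten si => // j js.
by rewrite tnth_mktuple /= -(inj_eq val_inj)/= neq_ltn js.
Qed.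

Section causality.
Context {R : realType} {N : nat} (p : probability (N.-tuple R * N.-tuple R)%type R).
Variables (X Y : N.-tuple R * N.-tuple R -> N.-tuple R).
Hypotheses (mX : measurable_fun setT X) (mY : measurable_fun setT Y).
Variables (L : 'M[R]_N) (a : 'cV[R]_N).
Hypotheses (pL : pos_trig L) (sX : std_vec p (whiten L a \o X)).

Let Z w := whiten L a (X w).

(** The event that Z_s is in B and the past of X is in C1 depends on X alone. Integrating P(past of
    Y in C2 | X) over it, causality replaces the integrand by a function g of the past of X; this is
    independent of Z_s, so P(Z_s in B) factors out, and the remaining integral is the probability
    that both pasts are in C1 and C2. *)
Lemma causal_innovation_indep (s : 'I_N) : causal p X Y ->
  indep p (fun w => tnth (Z w) s) (fun w => (hist s (X w), hist s (Y w))).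
Proof.
move=> cXY.
have mZ : measurable_fun setT (fun w => tnth (Z w) s).
  apply: measurable_coord; exact: measurableT_comp (measurable_whiten _ _) mX.
have mHX t : measurable_fun setT (fun w => hist t (X w)).
  exact: measurableT_comp (measurable_hist t) mX.
have mHY t : measurable_fun setT (fun w => hist t (Y w)).
  exact: measurableT_comp (measurable_hist t) mY.
have iH := innovation_indep_hist (s := s) pL sX.
have mH : measurable_fun setT (fun w => (hist s (X w), hist s (Y w))).
  exact: (measurable_fun_pair (mHX s) (mHY s)).
apply: (@indep_pi_system _ _ _ _ _ _ _ _ _ _ mZ mH measurable
  [set A `*` B | A in measurable & B in measurable]) => //.
- by rewrite sigma_algebra_id//; exact: sigma_algebra_measurable.
- exact: measurableI.
- exact: measurable_prod_measurableType.
- move=> _ _ [A1 mA1 [A2 mA2 <-]] [B1 mB1 [B2 mB2 <-]].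
  by exists (A1 `&` B1); [exact: measurableI|exists (A2 `&` B2); [exact: measurableI|rewrite setXI]].
- by exists setT => //; exists setT => //; rewrite setXTT.
move=> B _ mB [C1 mC1 [C2 mC2 <-]].
have -> : (fun w => (hist s (X w), hist s (Y w))) @^-1` (C1 `*` C2) =
  (fun w => hist s (X w)) @^-1` C1 `&` (fun w => hist s (Y w)) @^-1` C2 by [].
(* At s = 0 the histories are the empty tuple, so every event about them is certain or impossible.
   For s = u + 1, causality is used at index u, whose sets live on [hist u.+1], the strict past of
   s. *)
case: s mZ iH mH C1 C2 mC1 mC2 => [[|u] us] mZ iH mH C1 C2 mC1 mC2.
  have CT (C : set (0.-tuple R)) (U : N.-tuple R * N.-tuple R -> N.-tuple R) :
      (fun w => hist 0 (U w)) @^-1` C = setT \/ (fun w => hist 0 (U w)) @^-1` C = set0.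
    have [C0|C0] := pselect (C [tuple]); [left|right]; apply/seteqP; split=> w //=.
      by rewrite (tuple0 (hist 0 (U w))).
    by rewrite (tuple0 (hist 0 (U w))).
  rewrite /=; case: (CT C2 Y) => ->; first by rewrite setIT iH.
  by rewrite !setI0 measure0 mule0.
pose t : 'I_N := Ordinal (ltnW us).
have [f [g [[mf intf hf] [mg intg hg] fg]]] := cXY t C2 mC2.
pose z x := tnth (whiten L a x) (Ordinal us).
have mz : measurable_fun setT z by exact: measurable_coord (measurable_whiten L a).
have mD : measurable (z @^-1` B `&` hist u.+1 @^-1` C1).
  apply: measurableI; first exact: measurable_preimageT mz mB.
  exact: (measurable_preimageT (measurable_hist u.+1) mC1).
have mHX1 : measurable ((fun w => hist u.+1 (X w)) @^-1` C1).
  exact: (measurable_preimageT (mHX u.+1) mC1).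
set F := (fun w => hist u.+1 (Y w)) @^-1` C2.
transitivity (p (F `&` X @^-1` (z @^-1` B `&` hist u.+1 @^-1` C1))).
  by congr (p _); rewrite setIA setIC.
rewrite -[LHS](hf _ mD).
transitivity (\int[p]_(w in X @^-1` (z @^-1` B `&` hist u.+1 @^-1` C1)) (g (hist u.+1 (X w)))%:E)%E.
  apply: ae_eq_integral => //.
  - exact: measurable_preimageT mX mD.
  - by apply/measurable_EFinP/measurable_funTS; exact: measurableT_comp mf mX.
  - by apply/measurable_EFinP/measurable_funTS; exact: measurableT_comp mg (mHX u.+1).
  - by apply: filterS fg => w /= -> _.
rewrite [LHS](integral_indep mZ (mHX u.+1) iH mB mC1 mg intg).
by congr (_ * _)%E; rewrite [LHS](hg _ mC1) setIC.
Qed.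

End causality.

(** * The cost of bicausal couplings *)

Section orthogonality.
Context {R : realType} {N : nat} (p : probability (N.-tuple R * N.-tuple R)%type R).

Lemma indep_cst {d} {T : measurableType d} (P : probability T R) (Z : T -> R) (c : R) :
  indep P Z (cst c).
Proof.
move=> A B mA mB; have [Bc|Bc] := pselect (B c).
  rewrite (_ : cst c @^-1` B = setT); last by apply/seteqP; split.
  by rewrite setIT probability_setT mule1.
rewrite (_ : cst c @^-1` B = set0); last by apply/seteqP; split.
by rewrite setI0 measure0 mule0.
Qed.

Lemma mean_std {d} {T : measurableType d} (P : probability T R) (Z : T -> R) :
  measurable_fun setT Z -> has_law P Z stdn -> mean P Z = 0.
Proof.
move=> mZ lZ; rewrite -(mean_std_mul_indep mZ (L2_cst P 1) lZ (@indep_cst _ _ P Z 1)).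
by apply: eq_Rintegral => w _; rewrite mulr1.
Qed.

Lemma mean_mulC {d} {T : measurableType d} (P : probability T R) (f g : T -> R) :
  mean P (fun w => f w * g w) = mean P (fun w => g w * f w).
Proof. by apply: eq_Rintegral => w _; rewrite mulrC. Qed.

Lemma std_vec_L2 {d} {T : measurableType d} (P : probability T R) k (X : T -> k.-tuple R) i :
  std_vec P X -> L2 P (fun w => tnth (X w) i).
Proof.
move=> sX; have [mX _] := sX.
exact: (std_L2 (measurable_coord i mX) (std_vec_coord i sX)).1.
Qed.

(** For j < i both factors with index j are functions of the joint past at time i, read off after
    padding by zeros, and Z_i is independent of that past. *)
Lemma innovation_orth (X Y : N.-tuple R * N.-tuple R -> N.-tuple R)
    (L M : 'M[R]_N) (a b : 'cV[R]_N) (i j : 'I_N) :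
  measurable_fun setT X -> measurable_fun setT Y ->
  pos_trig L -> pos_trig M ->
  std_vec p (whiten L a \o X) -> std_vec p (whiten M b \o Y) ->
  causal p X Y -> (j < i)%N ->
  mean p (fun w => tnth (whiten L a (X w)) i * tnth (whiten L a (X w)) j) = 0 /\
  mean p (fun w => tnth (whiten L a (X w)) i * tnth (whiten M b (Y w)) j) = 0.
Proof.
move=> mX mY pL pM sX sY cXY ji.
have iZ := @causal_innovation_indep _ _ p X Y mX mY L a pL sX i cXY.
have mZ : measurable_fun setT (fun w => tnth (whiten L a (X w)) i).
  exact: measurable_coord sX.1.
have lZ := std_vec_coord i sX.
have mpast (Q : 'M[R]_N) (c : 'cV[R]_N) :
    measurable_fun setT (fun h : i.-tuple R => tnth (whiten Q c (pad N h)) j).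
  apply: measurable_coord; apply: measurableT_comp (measurable_whiten Q c) _.
  exact: (@measurable_hist R i N).
have past (Q : 'M[R]_N) (c : 'cV[R]_N) (U : N.-tuple R * N.-tuple R -> N.-tuple R) w : pos_trig Q ->
    tnth (whiten Q c (pad N (hist i (U w)))) j = tnth (whiten Q c (U w)) j.
  move=> pQ; have h := @eq_whiten _ _ Q c (pad N (hist i (U w))) (U w) i pQ _ j ji.
  by apply: h => k ki; rewrite tnth_pad_hist.
split; apply: mean_std_mul_indep => //.
- exact: std_vec_L2 sX.
- have := indep_comp (@measurable_id _ _ setT)
    (measurableT_comp (mpast L a) measurable_fst) iZ.
  by congr indep; apply/funext => w /=; rewrite past.
- exact: std_vec_L2 sY.
- have := indep_comp (@measurable_id _ _ setT)
    (measurableT_comp (mpast M b) measurable_snd) iZ.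
  by congr indep; apply/funext => w /=; rewrite past.
Qed.

End orthogonality.

Section cost.
Context {R : realType} {N : nat}.
Variables (L M : 'M[R]_N) (a b : 'cV[R]_N).
Hypotheses (pL : pos_trig L) (pM : pos_trig M).
Notation v := (@std_var R).

(** The part of the cost that depends on the marginals only. *)
Definition cost_offset : R :=
  \sum_(i < N) ((a i 0 - b i 0) ^+ 2 + \sum_(j < N) (L i j ^+ 2 + M i j ^+ 2) * v).

Definition innov_corr (p : probability (N.-tuple R * N.-tuple R)%type R) (j : 'I_N) : R :=
  mean p (fun w => tnth (whiten L a w.1) j * tnth (whiten M b w.2) j).

Definition sym_causal (p : probability (N.-tuple R * N.-tuple R)%type R) :=
  [/\ std_vec p (whiten L a \o fst), std_vec p (whiten M b \o snd),
      causal p fst snd & causal p snd fst].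

Variable p : probability (N.-tuple R * N.-tuple R)%type R.
Hypothesis hp : sym_causal p.

Let Z (j : 'I_N) (w : N.-tuple R * N.-tuple R) := tnth (whiten L a w.1) j.
Let W (j : 'I_N) (w : N.-tuple R * N.-tuple R) := tnth (whiten M b w.2) j.

Let LZ j : L2 p (Z j). Proof. by case: hp => s _ _ _; exact: std_vec_L2 s. Qed.
Let LW j : L2 p (W j). Proof. by case: hp => _ s _ _; exact: std_vec_L2 s. Qed.

Let Zvar j : mean p (fun w => Z j w ^+ 2) = v.
Proof.
case: hp => s _ _ _.
exact: (std_L2 (measurable_coord j s.1) (std_vec_coord j s)).2.
Qed.

Let Wvar j : mean p (fun w => W j w ^+ 2) = v.
Proof.
case: hp => _ s _ _.
exact: (std_L2 (measurable_coord j s.1) (std_vec_coord j s)).2.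
Qed.

Let ZZ i j : i != j -> mean p (fun w => Z i w * Z j w) = 0.
Proof.
case: hp => sZ sW c1 c2; rewrite -(inj_eq val_inj)/= neq_ltn => /orP[ij|ji].
  rewrite mean_mulC; exact: (innovation_orth measurable_fst measurable_snd pL pM sZ sW c1 ij).1.
exact: (innovation_orth measurable_fst measurable_snd pL pM sZ sW c1 ji).1.
Qed.

Let WW i j : i != j -> mean p (fun w => W i w * W j w) = 0.
Proof.
case: hp => sZ sW c1 c2; rewrite -(inj_eq val_inj)/= neq_ltn => /orP[ij|ji].
  rewrite mean_mulC; exact: (innovation_orth measurable_snd measurable_fst pM pL sW sZ c2 ij).1.
exact: (innovation_orth measurable_snd measurable_fst pM pL sW sZ c2 ji).1.
Qed.

Let ZW i j : i != j -> mean p (fun w => Z i w * W j w) = 0.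
Proof.
case: hp => sZ sW c1 c2; rewrite -(inj_eq val_inj)/= neq_ltn => /orP[ij|ji].
  rewrite mean_mulC; exact: (innovation_orth measurable_snd measurable_fst pM pL sW sZ c2 ij).2.
exact: (innovation_orth measurable_fst measurable_snd pL pM sZ sW c1 ji).2.
Qed.

Lemma mean_bilinear (x y x' y' : R) (i j : 'I_N) :
  mean p (fun w => (x * Z i w - y * W i w) * (x' * Z j w - y' * W j w)) =
  x * x' * mean p (fun w => Z i w * Z j w) + y * y' * mean p (fun w => W i w * W j w)
  - x * y' * mean p (fun w => Z i w * W j w) - x' * y * mean p (fun w => Z j w * W i w).
Proof.
have iZ c k l : p.-integrable setT (EFin \o (fun w => c * (Z k w * Z l w))).
  exact: integrableZl (L2M (LZ k) (LZ l)).
have iW c k l : p.-integrable setT (EFin \o (fun w => c * (W k w * W l w))).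
  exact: integrableZl (L2M (LW k) (LW l)).
have iM c k l : p.-integrable setT (EFin \o (fun w => c * (Z k w * W l w))).
  exact: integrableZl (L2M (LZ k) (LW l)).
rewrite /mean -!RintegralZl//; try exact: L2M.
rewrite -RintegralD//.
rewrite -RintegralB//; last first.
  have := integrableD measurableT (iZ (x * x') i j) (iW (y * y') i j).
  by apply: eq_integrable => // w _ /=; rewrite EFinD.
rewrite -RintegralB//; last first.
  have := integrableB measurableT (integrableD measurableT (iZ (x * x') i j) (iW (y * y') i j)) (iM (x * y') i j).
  by apply: eq_integrable => // w _ /=; rewrite EFinB EFinD.
by apply: eq_Rintegral => w _; ring.
Qed.

(** X_i - Y_i is a_i - b_i plus the sum over j of L_ij Z_j - M_ij W_j. These terms are centred and
    orthogonal for distinct j, so the mean square is a sum over j. *)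
Lemma cost_sym_causal : cost p =
  (cost_offset - 2 * \sum_(j < N) (L^T *m M) j j * innov_corr p j)%:E.
Proof.
pose F (i j : 'I_N) w := L i j * Z j w - M i j * W j w.
have LF i j : L2 p (F i j).
  have := L2D (L2Z (L i j) (LZ j)) (L2Z (- M i j) (LW j)).
  by congr L2; apply/funext => w; rewrite /F mulNr.
pose S i w := \sum_j F i j w.
have LS i : L2 p (S i) by exact: L2_sum.
pose G i w := (a i 0 - b i 0) + S i w.
have LG i : L2 p (G i) by exact: (L2D (L2_cst p _) (LS i)).
have sqE w : sqdist w = \sum_i G i w ^+ 2.
  apply: eq_bigr => i _; congr (_ ^+ 2).
  rewrite -{1}(whitenK a w.1 pL) -{1}(whitenK b w.2 pM) !tnth_mktuple !mxE /G /S /F.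
  rewrite sumrB /Z /W.
  under eq_bigr do rewrite mxE. under [X in _ - (_ + X)]eq_bigr do rewrite mxE.
  by rewrite opprD addrACA.
have [intG meanG] := integrable_sum_mean (fun i => (LG i).2).
rewrite /cost; under eq_integral do rewrite sqE.
rewrite -(fineK (integrable_fin_num measurableT intG)) -[fine _]/(mean _ _) meanG; congr EFin.
have meanF i j : mean p (F i j) = 0.
  rewrite /mean RintegralB//; last 2 first.
  - exact: (L2_integrable (L2Z _ (LZ j))).
  - exact: (L2_integrable (L2Z _ (LW j))).
  rewrite !RintegralZl//; [|exact: L2_integrable|exact: L2_integrable].
  case: hp => sZ sW _ _.
  rewrite -/(mean p (Z j)) -/(mean p (W j)).
  rewrite (mean_std (measurable_coord j sZ.1) (std_vec_coord j sZ)).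
  by rewrite (mean_std (measurable_coord j sW.1) (std_vec_coord j sW)) !mulr0 subrr.
have meanS i : mean p (S i) = 0.
  rewrite (integrable_sum_mean (fun j => L2_integrable (LF i j))).2.
  by rewrite big1.
have meanS2 i : mean p (fun w => S i w ^+ 2) =
   \sum_j ((L i j ^+ 2 + M i j ^+ 2) * v - 2 * (L i j * M i j) * innov_corr p j).
  rewrite (mean_pythagoras (LF i)) => [|j k jk].
    apply: eq_bigr => j _; transitivity (mean p (fun w => F i j w * F i j w)).
      by apply: eq_Rintegral => w _; rewrite expr2.
    rewrite mean_bilinear -/(innov_corr p j).
    have -> : mean p (fun w => Z j w * Z j w) = v.
      by rewrite -(Zvar j); apply: eq_Rintegral => w _; rewrite expr2.
    have -> : mean p (fun w => W j w * W j w) = v.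
      by rewrite -(Wvar j); apply: eq_Rintegral => w _; rewrite expr2.
    by rewrite /innov_corr /Z /W; ring.
  by rewrite mean_bilinear ZZ// WW// ZW// ZW 1?eq_sym// !mulr0 !addr0 !subr0.
have meanG2 i : mean p (fun w => G i w ^+ 2) = (a i 0 - b i 0) ^+ 2 + mean p (fun w => S i w ^+ 2).
  set c := a i 0 - b i 0.
  have i1 : p.-integrable setT (EFin \o (fun w => c ^+ 2)).
    exact: (finite_measure_integrable_cst p (c ^+ 2)).
  have i2 : p.-integrable setT (EFin \o (fun w => 2 * c * S i w)).
    exact: (L2_integrable (L2Z _ (LS i))).
  have i12 : p.-integrable setT (EFin \o (fun w => c ^+ 2 + 2 * c * S i w)).
    have := integrableD measurableT i1 i2.
    by apply: eq_integrable => // w _ /=; rewrite EFinD.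
  transitivity (mean p (fun w => c ^+ 2 + 2 * c * S i w + S i w ^+ 2)).
    by apply: eq_Rintegral => w _; rewrite /G -/c; ring.
  rewrite /mean RintegralD//; last exact: (LS i).2.
  have m1 : mean p (fun=> c ^+ 2) = c ^+ 2.
    by rewrite /mean Rintegral_cst//= probability_setT/= mulr1.
  rewrite RintegralD// -/(mean p (fun=> c ^+ 2)) m1 RintegralZl//; last exact: L2_integrable.
  by rewrite -/(mean p (S i)) meanS mulr0 addr0.
under eq_bigr do rewrite meanG2 meanS2 sumrB addrA.
rewrite sumrB; congr (_ - _).
(* Summing over i first, the products L_ij M_ij add up to the diagonal entry (L^T M)_jj. *)
rewrite exchange_big mulr_sumr; apply: eq_bigr => j _ /=.
rewrite -mulr_suml -mulr_sumr mulrA; congr (_ * _ * _).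
by rewrite mxE; apply: eq_bigr => i _; rewrite mxE.
Qed.

End cost.

(** * Causality from an independent residual *)

Section residual.
Context {R : realType} {N : nat} (p : probability (N.-tuple R * N.-tuple R)%type R).

(** Every event about V has probability 0 or 1. This covers couplings whose residual vanishes almost
    surely. *)
Lemma indep_ae_cst {d d1 d2} {T : measurableType d} {T1 : measurableType d1}
    {T2 : measurableType d2} (P : probability T R) (X : T -> T1) (V : T -> T2) (c : T2) :
  measurable_fun setT X -> measurable_fun setT V -> {ae P, forall w, V w = c} ->
  indep P X V.
Proof.
move=> mX mV aeV A B mA mB.
have mXA := measurable_preimageT mX mA; have mVB := measurable_preimageT mV mB.
have null S : measurable S -> (forall w, S w -> V w <> c) -> P S = 0%E.
  move=> mS hS; apply: measure_negligible => //; apply: negligibleS aeV => w Sw /=.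
  exact: hS.
have [Bc|Bc] := pselect (B c); last first.
  rewrite (null (V @^-1` B))// ?mule0 => [|w Bw Vc]; last by apply: Bc; rewrite -Vc.
  by apply: null => [|w [_ Bw] Vc]; [exact: measurableI|apply: Bc; rewrite -Vc].
have nC : P (~` (V @^-1` B)) = 0%E.
  by apply: null => [|w Bw Vc]; [exact: measurableC|apply: Bw; rewrite /= Vc].
have -> : P (V @^-1` B) = 1%E.
  by have := probability_setC P (measurableC mVB); rewrite setCK nC sube0.
rewrite mule1 -[in RHS](setIT (X @^-1` A)) -(setUv (V @^-1` B)) setIUr measureU//.
- rewrite [X in (_ + X)%E](_ : _ = 0%E) ?adde0//.
  apply: null => [|w [_ Bw] Vc]; last by apply: Bw; rewrite /= Vc.
  by apply: measurableI => //; exact: measurableC.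
- exact: measurableI.
- by apply: measurableI => //; exact: measurableC.
- by rewrite setIACA setICr setI0.
Qed.

Variables (X Y : N.-tuple R * N.-tuple R -> N.-tuple R).
Hypotheses (mX : measurable_fun setT X) (mY : measurable_fun setT Y).
Variables (L M : 'M[R]_N) (a b : 'cV[R]_N) (rho : 'I_N -> R).
Hypotheses (pL : pos_trig L) (pM : pos_trig M).

Definition residual (w : N.-tuple R * N.-tuple R) : N.-tuple R :=
  [tuple tnth (whiten M b (Y w)) i - rho i * tnth (whiten L a (X w)) i | i < N].

Lemma measurable_residual : measurable_fun setT residual.
Proof.
apply/measurable_fun_tnthP => i.
rewrite (_ : _ \o _ = fun w => tnth (whiten M b (Y w)) i - rho i * tnth (whiten L a (X w)) i).
  apply: measurable_funB; first exact: measurable_coord (measurableT_comp (measurable_whiten M b) mY).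
  apply: measurable_funM => //.
  exact: measurable_coord (measurableT_comp (measurable_whiten L a) mX).
by apply/funext => w /=; rewrite tnth_mktuple.
Qed.

(** By triangularity Y up to time t is a function phi of X up to time t and of the residual.
    Integrating the residual out gives a function g of X up to time t, which is a conditional
    probability both given all of X and given X up to time t. *)
Lemma causal_of_residual : indep p X residual -> causal p X Y.
Proof.
move=> iXV t E mE.
have mV := measurable_residual.
have [Q lQ] := has_law_exists p mV.
pose phi (x : t.+1.-tuple R * N.-tuple R) : t.+1.-tuple R := hist t.+1
  (unwhiten M b [tuple rho i * tnth (whiten L a (pad N x.1)) i + tnth x.2 i | i < N]).
have mphi : measurable_fun setT phi.
  apply: measurableT_comp (measurable_hist t.+1) _.
  apply: measurableT_comp (measurable_unwhiten M b) _.
  apply/measurable_fun_tnthP => i.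
  rewrite (_ : _ \o _ = fun x => rho i * tnth (whiten L a (pad N x.1)) i + tnth x.2 i); last first.
    by apply/funext => x /=; rewrite tnth_mktuple.
  apply: measurable_funD; last exact: measurable_coord measurable_snd.
  apply: measurable_funM => //; apply: measurable_coord.
  apply: measurableT_comp (measurable_whiten L a) _.
  exact: measurableT_comp (@measurable_hist R t.+1 N) measurable_fst.
have phiE w : hist t.+1 (Y w) = phi (hist t.+1 (X w), residual w).
  rewrite /phi -[in LHS](whitenK b (Y w) pM); apply: eq_hist => i it.
  apply: (@eq_unwhiten _ _ M b _ _ t.+1 pM) it => j jt.
  rewrite [RHS]tnth_mktuple /= [tnth (residual w) j]tnth_mktuple.
  have -> : tnth (whiten L a (pad N (hist t.+1 (X w)))) j = tnth (whiten L a (X w)) j.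
    have h := @eq_whiten _ _ L a (pad N (hist t.+1 (X w))) (X w) t.+1 pL _ j jt.
    by apply: h => k kt; rewrite tnth_pad_hist.
  by rewrite addrC subrK.
pose g h := fine (Q [set v | E (phi (h, v))]).
have mphiE : measurable (phi @^-1` E) by exact: measurable_preimageT.
have gE h : ((g h)%:E = Q (xsection (phi @^-1` E) h))%E.
  rewrite -(fineK (fin_num_measure Q _ (measurable_xsection h mphiE))); congr (fine (Q _))%:E.
  by apply/seteqP; split=> v; rewrite /xsection /= inE.
have mg : measurable_fun setT g.
  apply/measurable_EFinP; rewrite (_ : _ \o _ = Q \o xsection (phi @^-1` E)).
    exact: measurable_fun_xsection.
  by apply/funext => h /=; rewrite gE.
have g01 h : 0 <= g h <= 1.
  rewrite -!lee_fin gE measure_ge0 probability_le1//.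
  exact: measurable_xsection.
(* Treats both conditionings at once: H is either X or its history, and k extracts the history from
   it. *)
have cond d' (T' : measurableType d') (H : N.-tuple R * N.-tuple R -> T') (k : T' -> t.+1.-tuple R) :
    measurable_fun setT H -> measurable_fun setT k -> (forall w, k (H w) = hist t.+1 (X w)) ->
    indep p H residual ->
    is_cond_prob p H [set w | E (hist t.+1 (Y w))] (g \o k).
  move=> mH mk kH iH.
  have mgk : measurable_fun setT (g \o k) by exact: measurableT_comp.
  split=> // [|B mB].
    apply: (@le_integrable _ _ _ _ _ measurableT _ (cst 1%E)).
    - by apply/measurable_EFinP; exact: measurableT_comp mgk mH.
    - move=> w _ /=; rewrite lee_fin normr1 ger0_norm; by have /andP[] := g01 (k (H w)).
    - exact: (finite_measure_integrable_cst p 1).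
  have mF : measurable_fun setT (fun x : T' * N.-tuple R => phi (k x.1, x.2)).
    apply: (measurableT_comp mphi); apply: measurable_fun_pair => //.
    exact: measurableT_comp mk measurable_fst.
  have := indep_disintegration mH mV mF iH lQ mB mE.
  rewrite setIC => h.
  rewrite (_ : [set w | E (hist t.+1 (Y w))] = [set w | E (phi (k (H w), residual w))]).
    rewrite [RHS]h; apply: eq_integral => w _ /=.
    rewrite gE; congr (Q _).
    by apply/seteqP; split=> v; rewrite /xsection /= inE.
  by apply/seteqP; split=> w /=; rewrite phiE kH.
exists (g \o hist t.+1), g; split.
- by apply: cond => //; exact: measurable_hist.
- rewrite -[g]/(g \o id); apply: cond => //.
  + exact: measurableT_comp (measurable_hist t.+1) mX.
  + exact: (indep_comp (measurable_hist t.+1) (@measurable_id _ _ setT) iXV).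
- exact: aeW.
Qed.

End residual.

Lemma ae_prob1 {R : realType} {d} {T : measurableType d} (P : probability T R) (E : set T) :
  measurable E -> P E = 1%E -> {ae P, forall w, E w}.
Proof.
move=> mE PE; exists (~` E); split=> //; first exact: measurableC.
by transitivity (1 - P E)%E; [exact: probability_setC|rewrite PE subee].
Qed.

(** * Optimal value and optimal couplings in terms of innovations *)

Section optimality.
Context {R : realType} {N : nat}.
Variables (L M : 'M[R]_N) (a b : 'cV[R]_N) (mu nu : probability (N.-tuple R) R).
Hypotheses (pL : pos_trig L) (pM : pos_trig M).
Hypotheses (smu : std_vec mu (whiten L a)) (snu : std_vec nu (whiten M b)).
Notation v := (@std_var R).
Notation D j := ((L^T *m M) j j).
Notation Z j := (fun w : N.-tuple R * N.-tuple R => tnth (whiten L a w.1) j).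
Notation W j := (fun w : N.-tuple R * N.-tuple R => tnth (whiten M b w.2) j).

Lemma bicausal_sym_causal p : is_bicausal mu nu p -> sym_causal L M a b p.
Proof.
move=> [cp c1 c2]; have [h _] := std_vec_comp_coupling (whiten L a) cp.
have [_ h'] := std_vec_comp_coupling (whiten M b) cp.
by split=> //; [exact: h|exact: h'].
Qed.

Section corr.
Variable p : probability (N.-tuple R * N.-tuple R)%type R.
Hypothesis hp : sym_causal L M a b p.
Notation r j := (innov_corr L M a b p j).

Let sZ : std_vec p (whiten L a \o fst). Proof. by case: hp. Qed.
Let sW : std_vec p (whiten M b \o snd). Proof. by case: hp. Qed.

(** Cauchy-Schwarz by hand: nonnegativity of the left side bounds the correlation, and its vanishing
    is the case of equality. *)
Lemma mean_sqr_diff (e : R) j : e ^+ 2 = 1 ->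
  mean p (fun w => (Z j w - e * W j w) ^+ 2) = 2 * v - 2 * e * r j.
Proof.
move=> e1; have := mean_bilinear hp 1 e 1 e j j.
have vZ := (std_L2 (measurable_coord j sZ.1) (std_vec_coord j sZ)).2.
have vW := (std_L2 (measurable_coord j sW.1) (std_vec_coord j sW)).2.
rewrite [X in X = _ -> _](_ : _ = mean p (fun w => (Z j w - e * W j w) ^+ 2)); last first.
  by apply: eq_Rintegral => w _; rewrite !mul1r expr2.
move=> ->; rewrite -/(r j).
have -> : mean p (fun w => Z j w * Z j w) = v.
  by rewrite -vZ; apply: eq_Rintegral => w _; rewrite expr2.
have -> : mean p (fun w => W j w * W j w) = v.
  by rewrite -vW; apply: eq_Rintegral => w _; rewrite expr2.
transitivity ((1 + e ^+ 2) * v - 2 * e * r j); first by ring.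
by rewrite e1; ring.
Qed.

Let LZW (e : R) j : L2 p (fun w => Z j w - e * W j w).
Proof.
have := L2D (std_vec_L2 j sZ) (L2Z (- e) (std_vec_L2 j sW)).
by congr L2; apply/funext => w /=; rewrite mulNr.
Qed.

Lemma innov_corr_le (e : R) j : e ^+ 2 = 1 -> e * r j <= v.
Proof.
move=> e1; have : 0 <= mean p (fun w => (Z j w - e * W j w) ^+ 2).
  by apply: Rintegral_ge0 => w _; exact: sqr_ge0.
by rewrite mean_sqr_diff//; lra.
Qed.

Lemma innov_corr_eqP (e : R) j : e ^+ 2 = 1 ->
  e * r j = v <-> {ae p, forall w, W j w = e * Z j w}.
Proof.
move=> e1; split=> [er|].
  have : mean p (fun w => (Z j w - e * W j w) ^+ 2) = 0.
    by rewrite mean_sqr_diff// -mulrA er subrr.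
  move/(mean_sqr_eq0 (LZW e j)); apply: filterS => w /eqP; rewrite subr_eq0 => /eqP ->.
  by rewrite mulrA -expr2 e1 mul1r.
move=> WZ.
have mZ := measurable_coord j sZ.1; have mW := measurable_coord j sW.1.
have mm : measurable_fun setT (fun w => (Z j w - e * W j w) ^+ 2).
  by apply: measurable_funX; apply: measurable_funB => //; exact: measurable_funM.
have : mean p (fun w => (Z j w - e * W j w) ^+ 2) = 0.
  rewrite (eq_ae_mean (g := cst 0) mm)//.
    by rewrite /mean Rintegral_cst// mul0r.
  by apply: filterS WZ => w ->; rewrite mulrA -expr2 e1 mul1r subrr expr0n.
by rewrite mean_sqr_diff//; lra.
Qed.

End corr.

Definition sign_coupling (e : 'I_N -> R) (p : probability (N.-tuple R * N.-tuple R)%type R) :=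
  is_bicausal mu nu p /\ forall j, {ae p, forall w, W j w = e j * Z j w}.

(** The law of (x, T x), where T multiplies the innovations by the signs e. Since e_j^2 = 1, both W
    - e Z and Z - e W vanish almost surely, so the residual criterion applies in both directions. *)
Lemma sign_coupling_exists (e : 'I_N -> R) : (forall j, e j ^+ 2 = 1) ->
  exists p, sign_coupling e p.
Proof.
move=> e1.
pose S x := [tuple e j * tnth (whiten L a x) j | j < N].
have sS : std_vec mu S := std_vec_signed_select (@inj_id _) e1 smu.
pose Tm x := unwhiten M b (S x).
have mT : measurable_fun setT Tm by exact: measurableT_comp (measurable_unwhiten M b) sS.1.
have mF : measurable_fun setT (fun x => (x, Tm x)) by exact: measurable_fun_pair.
have [p lp] := has_law_exists mu mF.
have mZ j : measurable_fun setT (Z j).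
  exact: measurable_coord (measurableT_comp (measurable_whiten L a) measurable_fst).
have mW j : measurable_fun setT (W j).
  exact: measurable_coord (measurableT_comp (measurable_whiten M b) measurable_snd).
have aeWZ j : {ae p, forall w, W j w = e j * Z j w}.
  have mE : measurable [set w | W j w = e j * Z j w].
    have mdiff : measurable_fun setT (fun w => W j w - e j * Z j w).
      by apply: measurable_funB => //; exact: measurable_funM.
    have := measurable_preimageT mdiff (measurable_set1 0); congr measurable.
    apply/seteqP; split=> w /= /eqP h; apply/eqP; first by rewrite -subr_eq0.
    by rewrite subr_eq0.
  apply: (ae_prob1 mE); rewrite -lp// (_ : _ @^-1` _ = setT) ?probability_setT//.
  by apply/seteqP; split=> x //= _; rewrite unwhitenK// tnth_mktuple.
have aeZW j : {ae p, forall w, Z j w = e j * W j w}.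
  by apply: filterS (aeWZ j) => w ->; rewrite mulrA -expr2 e1 mul1r.
have ae_all (X Y : N.-tuple R * N.-tuple R -> N.-tuple R) (P Q : 'M[R]_N) c c' :
    (forall j, {ae p, forall w, tnth (whiten Q c' (Y w)) j = e j * tnth (whiten P c (X w)) j}) ->
    {ae p, forall w, residual X Y P Q c c' e w = [tuple 0 | _ < N]}.
  move=> h; have : {ae p, forall w, forall j, tnth (whiten Q c' (Y w)) j = e j * tnth (whiten P c (X w)) j}.
    exact: filter_forall.
  apply: filterS => w hw; apply: eq_from_tnth => j; by rewrite [LHS]tnth_mktuple [RHS]tnth_mktuple hw subrr.
exists p; split=> //; split.
- move=> E mE; split.
    by rewrite -lp//; exact: (measurable_preimageT measurable_fst).
  rewrite -lp; last exact: (measurable_preimageT measurable_snd).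
  rewrite (_ : _ @^-1` _ = S @^-1` (unwhiten M b @^-1` E)); last by [].
  rewrite (std_vec_law_uniq sS snu); last exact: (measurable_preimageT (measurable_unwhiten M b)).
  by congr (nu _); apply/seteqP; split=> y /=; rewrite whitenK.
- apply: (causal_of_residual measurable_fst measurable_snd pL pM (rho := e)).
  apply: indep_ae_cst measurable_fst (measurable_residual _ _ _ _ _ _ _) (ae_all _ _ _ _ _ _ aeWZ);
    [exact: measurable_fst|exact: measurable_snd].
- apply: (causal_of_residual measurable_snd measurable_fst pM pL (rho := e)).
  apply: indep_ae_cst measurable_snd (measurable_residual _ _ _ _ _ _ _) (ae_all _ _ _ _ _ _ aeZW);
    [exact: measurable_snd|exact: measurable_fst].
Qed.

(** Unlike [Num.sg], it has square 1 even where the diagonal entry is 0, as a sign coupling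
    requires; the value 1 there is a choice. *)
Definition opt_sign (j : 'I_N) : R := if D j < 0 then -1 else 1.

Lemma opt_sign_sqr j : opt_sign j ^+ 2 = 1.
Proof. by rewrite /opt_sign; case: ifP => _; rewrite ?sqrrN expr1n. Qed.

Lemma opt_sign_norm j : D j * opt_sign j = `|D j|.
Proof. rewrite /opt_sign; have [h|h] := ltP (D j) 0; first by rewrite mulrN1 ltr0_norm.
by rewrite mulr1 ger0_norm. Qed.

Definition opt_value : R := cost_offset L M a b - 2 * \sum_(j < N) `|D j| * v.

Lemma corr_le_norm p j : sym_causal L M a b p -> D j * innov_corr L M a b p j <= `|D j| * v.
Proof.
move=> hp; rewrite -opt_sign_norm -mulrA.
have -> : D j * innov_corr L M a b p j = D j * opt_sign j * (opt_sign j * innov_corr L M a b p j).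
  transitivity (D j * innov_corr L M a b p j * opt_sign j ^+ 2); last by ring.
  by rewrite opt_sign_sqr mulr1.
rewrite [leRHS]mulrA opt_sign_norm ler_wpM2l//.
by apply: innov_corr_le => //; exact: opt_sign_sqr.
Qed.

Lemma cost_eq_opt p : sym_causal L M a b p ->
  (forall j, D j * innov_corr L M a b p j = `|D j| * v) -> cost p = opt_value%:E.
Proof.
move=> hp h; rewrite (cost_sym_causal pL pM hp); congr (_ - _ * _)%:E.
exact: eq_bigr.
Qed.

Lemma AW2sq_opt : AW2sq mu nu = opt_value%:E.
Proof.
apply/eqP; rewrite eq_le; apply/andP; split.
  have [p [bp ep]] := sign_coupling_exists opt_sign_sqr.
  have hp := bicausal_sym_causal bp.
  rewrite -(cost_eq_opt hp); first by apply: ereal_inf_lbound; exists p.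
  move=> j; have /(innov_corr_eqP hp j (opt_sign_sqr j)) h := ep j.
  rewrite -opt_sign_norm -h.
  transitivity (D j * innov_corr L M a b p j * opt_sign j ^+ 2); last by ring.
  by rewrite opt_sign_sqr mulr1.
apply: le_ereal_inf_tmp => _ [p bp <-].
rewrite (cost_sym_causal pL pM (bicausal_sym_causal bp)) lee_fin.
rewrite lerD2l lerN2 ler_pM2l//; apply: ler_sum => j _.
exact: corr_le_norm (bicausal_sym_causal bp).
Qed.

(** Each term of the cost is bounded separately, so at the optimum the nonnegative gaps
    [|D j| * v - D j * innov_corr L M a b p j] sum to 0 and all vanish; where D j is not 0 it can be
    cancelled, leaving the case of equality for the correlation. *)
Lemma optimal_iff p : is_bicausal mu nu p -> is_optimal mu nu p <->
  forall j, (0 < D j -> {ae p, forall w, W j w = 1 * Z j w}) /\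
            (D j < 0 -> {ae p, forall w, W j w = -1 * Z j w}).
Proof.
move=> bp; have hp := bicausal_sym_causal bp; split.
  move=> [_]; rewrite AW2sq_opt (cost_sym_causal pL pM hp) => -[] /addrI/oppr_inj.
  have two : (2 : R) != 0 by rewrite pnatr_eq0.
  move/(mulfI two) => h j.
  have hj : D j * innov_corr L M a b p j = `|D j| * v.
    have : \sum_j (`|D j| * v - D j * innov_corr L M a b p j) = 0.
      by rewrite sumrB h subrr.
    move/eqP; rewrite psumr_eq0 => [/allP/(_ j (mem_index_enum _))|i _].
      by rewrite subr_eq0 => /eqP.
    by rewrite subr_ge0; exact: corr_le_norm.
  split=> Dj; apply/(innov_corr_eqP hp); rewrite ?sqrrN ?expr1n//.
    by apply: (mulfI (lt0r_neq0 Dj)); rewrite mul1r hj gtr0_norm.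
  apply: (mulfI (ltr0_neq0 Dj)); rewrite mulrA mulrN1 mulNr hj ltr0_norm//.
  by rewrite mulNr opprK.
move=> h; split=> //; rewrite AW2sq_opt; apply: cost_eq_opt => // j.
have [Dp|Dn|D0] := ltgtP 0 (D j).
- have /(innov_corr_eqP hp) := (h j).1 Dp; rewrite expr1n mul1r => -> //.
  by rewrite gtr0_norm.
- have /(innov_corr_eqP hp) := (h j).2 Dn; rewrite sqrrN expr1n => <- //.
  by rewrite ltr0_norm// mulrA mulrN1 opprK.
- by rewrite -D0 normr0 !mul0r.
Qed.

End optimality.

(** * Conditional kernels *)

Section countable_pi_systems.
Context {R : realType}.

(** Countability lets almost everywhere be exchanged with the quantifier over the generators. *)
Definition countable_pi_system {d} {T : measurableType d} (G : nat -> set T) :=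
  [/\ measurable = <<s range G >>, setI_closed (range G) & range G setT].

(** The [option] around [rat] gives the whole line a code of its own; natural numbers that code
    nothing are sent to it as well. *)
Definition rational_ray (n : nat) : set R :=
  if (unpickle n : option (option rat)) is Some (Some q)
  then `]-oo, ratr q[%classic else setT.

Lemma rational_rayE (q : rat) :
  rational_ray (pickle (Some q : option rat)) = `]-oo, ratr q[%classic.
Proof. by rewrite /rational_ray pickleK. Qed.

Lemma rational_rayP (n : nat) : rational_ray n = setT \/
  exists q : rat, rational_ray n = `]-oo, ratr q[%classic.
Proof.
rewrite /rational_ray; case: (unpickle n) => [[q|]|]; [right|by left|by left].
by exists q.
Qed.

Lemma rational_ray_setI : setI_closed (range rational_ray).
Proof.
have key (q q' : rat) : q <= q' ->
    `]-oo, ratr q[%classic `<=` (`]-oo, ratr q'[%classic : set R).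
  move=> qq x /=; rewrite !in_itv/= => /lt_le_trans; apply.
  by rewrite ler_rat.
move=> _ _ [n _ <-] [m _ <-].
have [->|[q nq]] := rational_rayP n; first by rewrite setTI; exists m.
have [->|[q' mq]] := rational_rayP m; first by rewrite setIT; exists n.
have [qq|/ltW qq] := leP q q'.
  by exists n => //; rewrite nq mq setIidl//; exact: key.
by exists m => //; rewrite nq mq setIidr//; exact: key.
Qed.

Lemma rational_ray_pi_system : countable_pi_system rational_ray.
Proof.
split; [|exact: rational_ray_setI|].
- rewrite -[LHS]/((R.-ocitv.-measurable).-sigma.-measurable).
  rewrite RGenInftyO.measurableE.
  apply/seteqP; split; apply: smallest_sub; try exact: smallest_sigma_algebra.
    move=> _ [x ->]; rewrite (_ : `]-oo, x[%classic =
        \bigcup_(n in [set n | rational_ray n `<=` `]-oo, x[]) rational_ray n).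
      apply: (@bigcup_measurable _ (g_sigma_algebraType (range rational_ray))) => n _.
      by apply: sub_sigma_algebra; exists n.
    apply/seteqP; split=> [y /=|y [n /= sub]]; last exact: sub.
    rewrite in_itv/= => yx; have [q] := rat_in_itvoo yx.
    rewrite in_itv/= => /andP[yq qx].
    exists (pickle (Some q : option rat)); rewrite /= rational_rayE ?in_itv//=.
    by move=> z /=; rewrite !in_itv/= => /lt_trans; apply.
  move=> _ [n _ <-]; have [->|[q ->]] := rational_rayP n.
    exact: (@measurableT _ (g_sigma_algebraType (@RGenInftyO.G R))).
  by apply: sub_sigma_algebra; exists (ratr q).
- by exists (pickle (None : option rat)) => //; rewrite /rational_ray pickleK.
Qed.

Definition prod_pi_system {T1 T2 : Type} (G1 : nat -> set T1) (G2 : nat -> set T2)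
    (n : nat) : set (T1 * T2) :=
  if (unpickle n : option (nat * nat)) is Some ij then G1 ij.1 `*` G2 ij.2 else setT.

Lemma prod_countable_pi_system {d1 d2} {T1 : measurableType d1} {T2 : measurableType d2}
    (G1 : nat -> set T1) (G2 : nat -> set T2) :
  countable_pi_system G1 -> countable_pi_system G2 ->
  countable_pi_system (prod_pi_system G1 G2).
Proof.
move=> [m1 I1 [t1 _ T1E]] [m2 I2 [t2 _ T2E]].
have gE i j : prod_pi_system G1 G2 (pickle (i, j)) = G1 i `*` G2 j.
  by rewrite /prod_pi_system pickleK.
have gP n : exists i j, prod_pi_system G1 G2 n = G1 i `*` G2 j.
  rewrite /prod_pi_system; case: (unpickle n) => [[i j]|]; first by exists i, j.
  by exists t1, t2; rewrite T1E T2E setXTT.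
have mG1 i : measurable (G1 i) by rewrite m1; apply: sub_sigma_algebra; exists i.
have mG2 i : measurable (G2 i) by rewrite m2; apply: sub_sigma_algebra; exists i.
set S := <<s range (prod_pi_system G1 G2) >>.
(* The sets A with this property form a sigma-algebra, and it contains the generators because the
   whole second factor belongs to [G2]. *)
have S1 A : measurable A -> S (fst @^-1` A).
  rewrite m1; move: A; apply: smallest_sub.
    suff : sigma_algebra setT [set B | S ((fst : T1 * T2 -> T1) @^-1` B)] by [].
    have := @sigma_algebra_image (T1 * T2)%type T1 setT fst _ (smallest_sigma_algebra setT (range (prod_pi_system G1 G2))).
    by congr sigma_algebra; apply/funext => B; rewrite /image_set_system/= setTI.
  move=> _ [i _ <-]; rewrite /= (_ : fst @^-1` G1 i = G1 i `*` G2 t2).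
    by apply: sub_sigma_algebra; exists (pickle (i, t2)) => //; rewrite gE.
  by rewrite T2E; apply/seteqP; split=> [[x y]|[x y] []].
have S2 A : measurable A -> S (snd @^-1` A).
  rewrite m2; move: A; apply: smallest_sub.
    suff : sigma_algebra setT [set B | S ((snd : T1 * T2 -> T2) @^-1` B)] by [].
    have := @sigma_algebra_image (T1 * T2)%type T2 setT snd _ (smallest_sigma_algebra setT (range (prod_pi_system G1 G2))).
    by congr sigma_algebra; apply/funext => B; rewrite /image_set_system/= setTI.
  move=> _ [i _ <-]; rewrite /= (_ : snd @^-1` G2 i = G1 t1 `*` G2 i).
    by apply: sub_sigma_algebra; exists (pickle (t1, i)) => //; rewrite gE.
  by rewrite T1E; apply/seteqP; split=> [[x y]|[x y] []].
split.
- rewrite measurable_prod_measurableType; apply/seteqP; split.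
    apply: smallest_sub; first exact: smallest_sigma_algebra.
    move=> _ [A mA [B mB <-]].
    rewrite (_ : A `*` B = fst @^-1` A `&` snd @^-1` B); last by apply/seteqP; split.
    apply: (@measurableI _ (g_sigma_algebraType (range (prod_pi_system G1 G2)))).
      exact: S1.
    exact: S2.
  apply: smallest_sub; first exact: smallest_sigma_algebra.
  move=> _ [n _ <-]; have [i [j ->]] := gP n.
  by apply: sub_sigma_algebra; exists (G1 i) => //; exists (G2 j).
- move=> _ _ [n _ <-] [m _ <-]; have [i [j ->]] := gP n; have [i' [j' ->]] := gP m.
  have [k1 _ k1E] : range G1 (G1 i `&` G1 i') by apply: I1; [exists i|exists i'].
  have [k2 _ k2E] : range G2 (G2 j `&` G2 j') by apply: I2; [exists j|exists j'].
  by rewrite -setXI -k1E -k2E; exists (pickle (k1, k2)) => //; rewrite gE.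
- by exists (pickle (t1, t2)) => //; rewrite gE T1E T2E setXTT.
Qed.
End countable_pi_systems.

Lemma ae_eq_prob {R : realType} {d} {T : measurableType d} (P : probability T R)
    (A B : set T) : measurable A -> measurable B ->
  {ae P, forall w, A w <-> B w} -> P A = P B.
Proof.
move=> mA mB AB; rewrite -[A]setIT -[B]setIT -!integral_indic//.
apply: ae_eq_integral => //.
- by apply/measurable_EFinP; exact: measurable_indic.
- by apply/measurable_EFinP; exact: measurable_indic.
- apply: filterS AB => w hw _; rewrite !indicE; congr (_%:R%:E).
  by congr (nat_of_bool _); apply/idP/idP; rewrite !inE => /hw.
Qed.

Section kernels.
Context {R : realType} {d d1 d2} {T : measurableType d} {T1 : measurableType d1}
  {T2 : measurableType d2}.
Variables (P : probability T R) (H : T -> T1) (W : T -> T2) (Z : T -> R).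
Hypotheses (mH : measurable_fun setT H) (mW : measurable_fun setT W) (mZ : measurable_fun setT Z).

Lemma ae_pushforward (S : T1 -> Prop) :
  {ae pushforward P H, forall h, S h} -> {ae P, forall w, S (H w)}.
Proof.
move=> [A [mA A0 SA]]; exists (H @^-1` A); split => //.
  exact: measurable_preimageT.
by move=> w; exact: SA.
Qed.

(** Replaces the push-forward by a bundled probability with the same null sets, so that almost
    everywhere statements can be combined as members of a filter. *)
Lemma ae_law (Q : probability T1 R) (S : T1 -> Prop) : has_law P H Q ->
  {ae pushforward P H, forall h, S h} <-> {ae Q, forall h, S h}.
Proof.
by move=> lQ; split=> -[A [mA A0 SA]]; exists A; split=> //; move: A0; rewrite /pushforward/= lQ.
Qed.

Lemma kernel_ae_unique (k1 k2 : T1 -> set T2 -> \bar R) (G : nat -> set T2) :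
  (forall n, measurable (G n)) ->
  (forall h C, measurable C -> (0 <= k1 h C <= 1)%E) ->
  (forall h C, measurable C -> (0 <= k2 h C <= 1)%E) ->
  (forall C, measurable C -> measurable_fun setT (k1 ^~ C)) ->
  (forall C, measurable C -> measurable_fun setT (k2 ^~ C)) ->
  (forall B C, measurable B -> measurable C ->
    \int[P]_(w in H @^-1` B) k1 (H w) C = \int[P]_(w in H @^-1` B) k2 (H w) C)%E ->
  {ae pushforward P H, forall h, forall n, k1 h (G n) = k2 h (G n)}.
Proof.
move=> mG k101 k201 mk1 mk2 k12.
have [Q lQ] := has_law_exists P mH.
apply/(ae_law _ lQ); apply: ae_foralln => n.
have int k : (forall h C, measurable C -> (0 <= k h C <= 1)%E) ->
   (forall C, measurable C -> measurable_fun setT (k ^~ C)) -> Q.-integrable setT (k ^~ (G n)).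
  move=> k01 mk; apply: (@le_integrable _ _ _ _ _ measurableT _ (cst 1%E)).
  - exact: mk.
  - move=> h _; have /andP[k0 k1'] := k01 h _ (mG n).
    by rewrite gee0_abs// /= normr1.
  - exact: (finite_measure_integrable_cst Q 1).
have := @integral_ae_eq _ _ _ Q setT measurableT (k2 ^~ (G n)) (k1 ^~ (G n)) (int _ k101 mk1) (mk2 _ (mG n)).
move=> h; have : ae_eq Q setT (k1^~ (G n)) (k2^~ (G n)).
  apply: h => E _ mE.
  have law k : (forall h C, measurable C -> (0 <= k h C <= 1)%E) ->
      (forall C, measurable C -> measurable_fun setT (k ^~ C)) ->
      (\int[Q]_(x in E) k x (G n) = \int[P]_(w in H @^-1` E) k (H w) (G n))%E.
    move=> k01 mk; transitivity (\int[pushforward P H]_(x in E) k x (G n))%E.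
      by apply: eq_measure_integral => A mA _; exact/esym/lQ.
    rewrite ge0_integral_pushforward//.
      by apply: measurable_funTS; exact: mk.
    by move=> x _; have /andP[] := k01 x _ (mG n).
  by rewrite (law _ k101 mk1) (law _ k201 mk2) k12.
by apply: filterS => x /(_ I).
Qed.

(** Sending h to the law of F(h, Z) is itself a conditional distribution, by [indep_disintegration].
    It agrees with k on the countable pi-system outside one null set, hence on all measurable sets
    there. *)
Lemma rcd_explicit (k : R.-pker T1 ~> T2) (F : T1 * R -> T2) (G : nat -> set T2) :
  countable_pi_system G ->
  measurable_fun setT F -> indep P H Z -> has_law P Z stdn ->
  {ae P, forall w, W w = F (H w, Z w)} -> is_rcd P H W k ->
  {ae pushforward P H, forall h, forall C, measurable C -> k h C = stdn [set z | C (F (h, z))]}.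
Proof.
move=> [mG IG GT] mF iHZ lZ WF rcdk.
have mGn n : measurable (G n) by rewrite mG; apply: sub_sigma_algebra; exists n.
pose k2 (h : T1) (C : set T2) := stdn [set z | C (F (h, z))].
have k2E h C : measurable C -> k2 h C = stdn (xsection (F @^-1` C) h).
  move=> mC; congr (stdn _).
  by apply/seteqP; split=> z; rewrite /xsection /= inE.
have mFC C : measurable C -> measurable (F @^-1` C) by exact: measurable_preimageT.
have h : {ae pushforward P H, forall h, forall n, k h (G n) = k2 h (G n)}.
  apply: (@kernel_ae_unique (fun h C => k h C) k2 G) => //.
  - move=> h C mC; rewrite measure_ge0/= -(prob_kernel (s := k) h).
    by apply: le_measure; rewrite ?inE.
  - move=> h C mC; rewrite k2E// measure_ge0 probability_le1//.
    by apply: measurable_xsection; exact: mFC.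
  - by move=> C mC; exact: measurable_kernel.
  - move=> C mC; rewrite (_ : k2 ^~ C = stdn \o xsection (F @^-1` C)).
      by apply: measurable_fun_xsection; exact: mFC.
    by apply/funext => h; exact: k2E.
  - move=> B C mB mC; rewrite -rcdk//.
    rewrite -(indep_disintegration mH mZ mF iHZ lZ mB mC).
    have mHB := measurable_preimageT mH mB.
    have mWC := measurable_preimageT mW mC.
    have mFHZ : measurable [set w | C (F (H w, Z w))].
      apply: (measurable_preimageT (f := fun w => F (H w, Z w))) => //.
      apply: (measurableT_comp mF); exact: measurable_fun_pair.
    apply: ae_eq_prob; [exact: measurableI|exact: measurableI|].
    by apply: filterS WF => w /= ->.
have kE h0 : (forall n, k h0 (G n) = k2 h0 (G n)) -> forall C, measurable C -> k h0 C = k2 h0 C.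
  move=> hG C mC.
  have mF0 : measurable_fun setT (fun z => F (h0, z)) by exact: measurableT_comp.
  have kT : (k h0 setT < +oo)%E by rewrite prob_kernel ltry.
  have := @finite_law_uniq R _ _ _ T2 R T2 (k h0) stdn (range G) setT setT 1
    id (fun z => F (h0, z)) kT mG IG GT ler01 measurableT measurableT
    (@measurable_id _ _ setT) mF0.
  move=> /(_ _ C mC); rewrite !setTI mul1e; apply.
  by move=> _ [n _ <-]; rewrite !setTI mul1e hG.
by move: h => [A [mA A0 SA]]; exists A; split=> // h0 nh; apply: SA => hG; exact/nh/kE.
Qed.
End kernels.

(** * Monotone transport between Gaussian laws on the line *)

Section monotone_gaussian.
Context {R : realType}.

Definition affine_law (m s : R) (al : set R -> \bar R) :=
  forall C, measurable C -> al C = stdn [set z | C (m + s * z)].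

Definition std_cdf : R -> R := distr_fun stdn.

Lemma std_cdfE x : (std_cdf x)%:E = stdn `]-oo, x].
Proof. by rewrite /std_cdf /distr_fun fineK// fin_num_measure. Qed.

Lemma std_cdf_lt x y : x < y -> std_cdf x < std_cdf y.
Proof.
move=> xy; rewrite -lte_fin !std_cdfE.
rewrite (_ : `]-oo, y]%classic = `]-oo, x] `|` `]x, y]); last first.
  apply/seteqP; split=> z /=; rewrite !in_itv/=.
    by move=> zy; have [zx|xz] := leP z x; [left|right]; rewrite ?xz.
  by case=> [zx|/andP[]//]; apply: le_trans zx (ltW xy).
rewrite measureU//; last first.
  apply/seteqP; split=> z //= []; rewrite !in_itv/= => zx /andP[xz _].
  by move: (lt_le_trans xz zx); rewrite ltxx.
by rewrite lteDl ?fin_num_measure// stdn_itv_gt0.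
Qed.

Lemma std_cdf_le x y : (std_cdf x <= std_cdf y) = (x <= y).
Proof.
have [xy|yx] := leP x y; last by apply/negbTE; rewrite -ltNge std_cdf_lt.
by move: xy; rewrite le_eqVlt => /orP[/eqP->|/std_cdf_lt/ltW ->//]; rewrite lexx.
Qed.

Lemma stdn_set1 (x : R) : stdn [set x] = 0.
Proof.
have /null_content_dominatesP := @normal_prob_dominates R 0 1.
move=> h; apply: (h [set x] _ (lebesgue_measure_set1 x)).
exact: measurable_set1.
Qed.

Lemma std_cdfN x : 1 - std_cdf x = std_cdf (- x).
Proof.
apply: EFin_inj; rewrite EFinB !std_cdfE -[RHS]stdn_opp//.
transitivity (stdn (~` `]-oo, x])).
  by apply/esym; exact: probability_setC.
(* The reflected ray is closed at x and the complement is open there; the difference is an atom of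
   mass 0. *)
rewrite (_ : -%R @^-1` _ = [set x] `|` ~` `]-oo, x]); last first.
  apply/seteqP; split=> z /=; rewrite !in_itv/= lerN2.
    by rewrite [x <= z]le_eqVlt => /orP[/eqP->|xz]; [left|right; apply/negP; rewrite -ltNge].
  by case=> [->//|/negP]; rewrite -ltNge => /ltW.
rewrite measureU//=; last 2 first.
- exact: measurableC.
- by apply/seteqP; split=> z //= [->]; rewrite in_itv/= lexx.
by rewrite stdn_set1 add0e.
Qed.

Lemma distr_fun_affine m s al z : 0 < s -> affine_law m s al ->
  distr_fun al (m + s * z) = std_cdf z.
Proof.
move=> s0 lal; rewrite /std_cdf /distr_fun lal//; congr (fine (stdn _)).
by apply/seteqP; split=> y /=; rewrite !in_itv/= lerD2l ler_pM2l.
Qed.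

(** Strict monotonicity of the distribution function turns the set under the infimum into a closed
    half-line. *)
Lemma quantile_affine m s be z : 0 < s -> affine_law m s be ->
  quantile be (std_cdf z) = m + s * z.
Proof.
move=> s0 lbe; rewrite /quantile (_ : [set y | _] = `[m + s * z, +oo[%classic).
  by rewrite inf_itv.
apply/seteqP; split=> y /=; rewrite in_itv/= andbT.
  have yE : y = m + s * ((y - m) / s) by rewrite mulrCA divff ?gt_eqF// mulr1 subrKC.
  by rewrite {1}yE (distr_fun_affine _ s0 lbe) std_cdf_le => h; rewrite yE lerD2l ler_pM2l.
have yE : y = m + s * ((y - m) / s) by rewrite mulrCA divff ?gt_eqF// mulr1 subrKC.
by move=> h; rewrite yE (distr_fun_affine _ s0 lbe) std_cdf_le; move: h; rewrite {1}yE lerD2l ler_pM2l.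
Qed.

(** The points m1 + s1 z exhaust the line, so F is affine and in particular measurable; s2 may be
    negative, which covers both kinds of monotone coupling. *)
Lemma induced_by_affine m1 s1 m2 s2 al (F : R -> R) (p : set (R * R) -> \bar R) :
  affine_law m1 s1 al -> s1 != 0 -> (forall z, F (m1 + s1 * z) = m2 + s2 * z) ->
  induced_by al F p <->
  forall E, measurable E -> p E = stdn [set z | E (m1 + s1 * z, m2 + s2 * z)].
Proof.
move=> lal s10 FE.
have Fx : F = fun x => m2 + s2 * ((x - m1) / s1).
  by apply/funext => x; rewrite -FE mulrCA divff// mulr1 subrKC.
have alE E : measurable E -> al [set x | E (x, F x)] = stdn [set z | E (m1 + s1 * z, m2 + s2 * z)].
  move=> mE; rewrite lal.
    by congr (stdn _); apply/seteqP; split=> z /=; rewrite FE.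
  apply: (measurable_preimageT (f := fun x => (x, F x))) => //.
  rewrite Fx; apply: measurable_fun_pair => //.
  by apply: measurable_funD => //; apply: measurable_funM => //; apply: measurable_funM => //; exact: measurable_funB.
by split=> h E mE; rewrite h// alE.
Qed.

(** The factor [s2 * 1] is left unsimplified to match [signed_step] with e = 1. *)
Lemma comonotonic_affine m1 s1 m2 s2 al be p : 0 < s1 -> 0 < s2 ->
  affine_law m1 s1 al -> affine_law m2 s2 be ->
  is_comonotonic al be p <->
  forall E, measurable E -> p E = stdn [set z | E (m1 + s1 * z, m2 + s2 * 1 * z)].
Proof.
move=> s10 s20 lal lbe; apply: induced_by_affine => //; first by rewrite gt_eqF.
by move=> z; rewrite (distr_fun_affine _ s10 lal) (quantile_affine _ s20 lbe) mulr1.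
Qed.

Lemma countermonotonic_affine m1 s1 m2 s2 al be p : 0 < s1 -> 0 < s2 ->
  affine_law m1 s1 al -> affine_law m2 s2 be ->
  is_countermonotonic al be p <->
  forall E, measurable E -> p E = stdn [set z | E (m1 + s1 * z, m2 + s2 * -1 * z)].
Proof.
move=> s10 s20 lal lbe; apply: induced_by_affine => //; first by rewrite gt_eqF.
move=> z; rewrite (distr_fun_affine _ s10 lal) std_cdfN (quantile_affine _ s20 lbe).
by rewrite mulrN mulrN1 mulNr.
Qed.
End monotone_gaussian.

(** * Kernels of the marginals and of a bicausal coupling *)

Section conditional_kernels.
Context {R : realType} {N : nat}.

Section one_marginal.
Variables (L : 'M[R]_N) (a : 'cV[R]_N) (mu : probability (N.-tuple R) R).
Hypotheses (pL : pos_trig L) (smu : std_vec mu (whiten L a)).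

Lemma drift_pad (x : N.-tuple R) (t : 'I_N) : drift L a t (pad N (hist t x)) = drift L a t x.
Proof. by apply: drift_hist => //; exact: hist_pad. Qed.

Lemma measurable_drift_pad {d} {T : measurableType d} (t : 'I_N) (f : T -> t.-tuple R) :
  measurable_fun setT f -> measurable_fun setT (fun x => drift L a t (pad N (f x))).
Proof.
move=> mf; apply: (measurableT_comp (measurable_drift L a t)).
exact: (measurableT_comp (@measurable_hist R t N) mf).
Qed.

(** The coordinate is its drift, a function of the past, plus [L t t] times an innovation
    independent of the past. *)
Lemma marginal_kernel (t : 'I_N) (k : R.-pker (t.-tuple R) ~> R) :
  is_rcd mu (hist t) (fun x => tnth x t) k ->
  {ae pushforward mu (hist t), forall h,
    affine_law (drift L a t (pad N h)) (L t t) (k h)}.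
Proof.
pose F (hz : t.-tuple R * R) := drift L a t (pad N hz.1) + L t t * hz.2.
move=> rk; apply: (rcd_explicit (measurable_hist t) (measurable_tnth t)
  (measurable_coord t smu.1) rational_ray_pi_system (F := F) _ _ _ _ rk).
- apply: measurable_funD; first exact: measurable_drift_pad measurable_fst.
  by apply: measurable_funM.
- by apply: indep_sym; exact: (innovation_indep_hist (X := id) pL smu).
- exact: std_vec_coord.
- by apply: nearW => x; rewrite /F/= drift_pad -tnth_drift.
Qed.

End one_marginal.

Variables (L M : 'M[R]_N) (a b : 'cV[R]_N) (mu nu : probability (N.-tuple R) R).
Hypotheses (pL : pos_trig L) (pM : pos_trig M).
Hypotheses (smu : std_vec mu (whiten L a)) (snu : std_vec nu (whiten M b)).
Variable p : probability (N.-tuple R * N.-tuple R)%type R.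
Hypothesis bp : is_bicausal mu nu p.
Variable t : 'I_N.
Notation Z := (fun w : N.-tuple R * N.-tuple R => tnth (whiten L a w.1) t).
Notation W := (fun w : N.-tuple R * N.-tuple R => tnth (whiten M b w.2) t).

Let sp := bicausal_sym_causal smu snu bp.

(** The next pair of coordinates when the joint past is [hz.1] and the innovations are Z_t = [hz.2]
    and W_t = e Z_t. *)
Definition signed_step (e : R) (hz : (t.-tuple R * t.-tuple R) * R) : R * R :=
  (drift L a t (pad N hz.1.1) + L t t * hz.2,
   drift M b t (pad N hz.1.2) + M t t * e * hz.2).

Lemma measurable_signed_step e : measurable_fun setT (signed_step e).
Proof.
apply: measurable_fun_pair; apply: measurable_funD.
- apply: measurable_drift_pad.
  exact: measurableT_comp measurable_fst measurable_fst.
- by apply: measurable_funM.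
- apply: measurable_drift_pad.
  exact: measurableT_comp measurable_snd measurable_fst.
- by apply: measurable_funM.
Qed.

Lemma measurable_hist2 : measurable_fun setT (@hist2 R N t).
Proof.
apply: measurable_fun_pair; first exact: measurableT_comp (measurable_hist t) measurable_fst.
exact: measurableT_comp (measurable_hist t) measurable_snd.
Qed.

Lemma measurable_coord2 : measurable_fun setT (@coord2 R N t).
Proof.
apply: measurable_fun_pair; first exact: measurableT_comp (measurable_tnth t) measurable_fst.
exact: measurableT_comp (measurable_tnth t) measurable_snd.
Qed.

Lemma coord2_step e w : W w = e * Z w -> coord2 t w = signed_step e (hist2 t w, Z w).
Proof.
move=> We; rewrite /coord2 /signed_step /= !drift_pad// -mulrA -We.
by congr (_, _); exact: tnth_drift.
Qed.

Let mZ : measurable_fun setT Z.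
Proof. by case: sp => sX _ _ _; exact: (measurable_coord t sX.1). Qed.

Lemma indep_hist2_innovation : indep p (hist2 t) Z.
Proof.
case: sp => sX _ c1 _.
by apply: indep_sym; have := causal_innovation_indep measurable_fst measurable_snd pL sX (s := t) c1.
Qed.

(** The direct implication is [rcd_explicit]. Conversely, the kernel determines the joint law of
    past and present, which becomes that of the past and its signed step; the relation W_t = e Z_t
    is an event about past and present, so its probability can be computed under the second law,
    where it is certain. *)
Lemma step_kernelP (k : R.-pker (t.-tuple R * t.-tuple R) ~> (R * R)%type) (e : R) :
  is_rcd p (hist2 t) (coord2 t) k ->
  {ae p, forall w, W w = e * Z w} <->
  {ae pushforward p (hist2 t), forall h, forall E, measurable E ->
     k h E = stdn [set z | E (signed_step e (h, z))]}.
Proof.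
move=> rk; have iHZ := indep_hist2_innovation.
have lZ : has_law p Z stdn by case: sp => sX _ _ _; exact: std_vec_coord sX.
have mF := measurable_signed_step e.
split=> [We|/ae_pushforward kE].
  apply: (rcd_explicit measurable_hist2 measurable_coord2 mZ
    (prod_countable_pi_system rational_ray_pi_system rational_ray_pi_system) mF iHZ lZ _ rk).
  by apply: filterS We => w; exact: coord2_step.
have law E : measurable E ->
    p [set w | E (hist2 t w, coord2 t w)] = p [set w | E (hist2 t w, signed_step e (hist2 t w, Z w))].
  have mHW : measurable_fun setT (fun w => (@hist2 R N t w, coord2 t w)).
    exact: measurable_fun_pair measurable_hist2 measurable_coord2.
  have mHF : measurable_fun setT (fun w => (hist2 t w, signed_step e (hist2 t w, Z w))).
    apply: measurable_fun_pair measurable_hist2 _.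
    apply: (measurableT_comp mF); exact: measurable_fun_pair measurable_hist2 mZ.
  move=> mE; have := law_uniq (P1 := p) (P2 := p) (G := [set A `*` B | A in measurable & B in measurable])
    (measurable_prod_measurableType _ _) _ _ ler01 measurableT measurableT mHW mHF.
  move=> /(_ _ _ _ _ mE); rewrite !setTI mul1e; apply.
  - move=> _ _ [A1 mA1 [A2 mA2 <-]] [B1 mB1 [B2 mB2 <-]].
    by exists (A1 `&` B1); [exact: measurableI|exists (A2 `&` B2); [exact: measurableI|rewrite setXI]].
  - by exists setT => //; exists setT => //; rewrite setXTT.
  - move=> _ [B mB [C mC <-]]; rewrite !setTI mul1e.
    transitivity (p (hist2 t @^-1` B `&` coord2 t @^-1` C)); first by [].
    transitivity (\int[p]_(w in hist2 t @^-1` B) stdn [set z | C (signed_step e (hist2 t w, z))])%E.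
      rewrite rk//; have mHB := measurable_preimageT measurable_hist2 mB.
      apply: ae_eq_integral => //.
      + apply: measurable_funTS; apply: measurableT_comp (measurable_kernel k C mC) measurable_hist2.
      + have mE' := measurable_preimageT mF mC.
        rewrite (_ : (fun x => _) = (stdn \o xsection (signed_step e @^-1` C)) \o hist2 t).
          apply: measurable_funTS; apply: measurableT_comp measurable_hist2.
          exact: measurable_fun_xsection.
        apply/funext => x /=; congr (stdn _).
        by apply/seteqP; split=> z; rewrite /xsection /= inE.
      + by apply: filterS (kE measurable_hist2) => w /(_ C mC).
    exact/esym/(indep_disintegration measurable_hist2 mZ mF iHZ lZ mB mC).
pose m2 (h : t.-tuple R * t.-tuple R) := drift M b t (pad N h.2).
pose m1 (h : t.-tuple R * t.-tuple R) := drift L a t (pad N h.1).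
(* W_t - e Z_t as a function of past and present, multiplied by [L t t * M t t] to avoid
   divisions. *)
pose g (hc : (t.-tuple R * t.-tuple R) * (R * R)) :=
  L t t * (hc.2.2 - m2 hc.1) - M t t * e * (hc.2.1 - m1 hc.1).
have mg : measurable_fun setT g.
  have mm1 : measurable_fun setT (fun hc : (t.-tuple R * t.-tuple R) * (R * R) => m1 hc.1).
    by apply: measurable_drift_pad; exact: measurableT_comp measurable_fst measurable_fst.
  have mm2 : measurable_fun setT (fun hc : (t.-tuple R * t.-tuple R) * (R * R) => m2 hc.1).
    by apply: measurable_drift_pad; exact: measurableT_comp measurable_snd measurable_fst.
  have mc1 : measurable_fun setT (fun hc : (t.-tuple R * t.-tuple R) * (R * R) => hc.2.1).
    exact: measurableT_comp measurable_fst measurable_snd.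
  have mc2 : measurable_fun setT (fun hc : (t.-tuple R * t.-tuple R) * (R * R) => hc.2.2).
    exact: measurableT_comp measurable_snd measurable_snd.
  by apply: measurable_funB; apply: measurable_funM => //; exact: measurable_funB.
have mg0 : measurable [set hc | g hc = 0] := measurable_preimageT mg (measurable_set1 0).
have gw w : g (hist2 t w, coord2 t w) = L t t * M t t * (W w - e * Z w).
  rewrite /g /m1 /m2 /= !drift_pad// (tnth_drift a w.1 t pL) (tnth_drift b w.2 t pM).
  by rewrite ![_ + _ * _ - _]addrC !addKr; ring.
have mg0' : measurable [set w | g (hist2 t w, coord2 t w) = 0].
  exact: (measurable_preimageT (measurable_fun_pair measurable_hist2 measurable_coord2) mg0).
have : {ae p, forall w, g (hist2 t w, coord2 t w) = 0}.
  apply: (ae_prob1 mg0'); rewrite (law _ mg0) (_ : [set w | _] = setT) ?probability_setT//.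
  apply/seteqP; split=> w //= _; rewrite /g /m1 /m2 /=.
  by rewrite ![_ + _ * _ - _]addrC !addKr; ring.
apply: filterS => w; rewrite gw => /eqP.
have LM : L t t * M t t != 0 by rewrite gt_eqF// mulr_gt0 ?pL.2 ?pM.2.
by rewrite mulf_eq0 (negbTE LM)/= subr_eq0 => /eqP.
Qed.
End conditional_kernels.

Section kernel_characterization.
Context {R : realType} {N : nat}.
Variables (L M : 'M[R]_N) (a b : 'cV[R]_N) (mu nu : probability (N.-tuple R) R).
Hypotheses (pL : pos_trig L) (pM : pos_trig M).
Hypotheses (smu : std_vec mu (whiten L a)) (snu : std_vec nu (whiten M b)).
Variable p : probability (N.-tuple R * N.-tuple R)%type R.
Hypothesis bp : is_bicausal mu nu p.

(** Null sets of the two marginal histories lift to null sets of the joint history because p has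
    marginals mu and nu. This transfers what is known of the kernels of mu and nu. *)
Lemma ae_hist2 (t : nat) (S1 S2 : t.-tuple R -> Prop) :
  {ae pushforward mu (hist t), forall h, S1 h} ->
  {ae pushforward nu (hist t), forall h, S2 h} ->
  {ae pushforward p (hist2 t), forall h, S1 h.1 /\ S2 h.2}.
Proof.
move=> [A1 [mA1 A10 SA1]] [A2 [mA2 A20 SA2]].
have mH1 := measurable_preimageT (measurable_hist (N := N) t) mA1.
have mH2 := measurable_preimageT (measurable_hist (N := N) t) mA2.
have [cp _ _] := bp.
exists (fst @^-1` A1 `|` snd @^-1` A2); split.
- by apply: measurableU; [exact: measurable_preimageT measurable_fst _|exact: measurable_preimageT measurable_snd _].
- rewrite /pushforward; apply/eqP; rewrite eq_le measure_ge0 andbT.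
  have mf1 : measurable (fst @^-1` (hist t @^-1` A1) : set (N.-tuple R * N.-tuple R)).
    exact: measurable_preimageT measurable_fst mH1.
  have mf2 : measurable (snd @^-1` (hist t @^-1` A2) : set (N.-tuple R * N.-tuple R)).
    exact: measurable_preimageT measurable_snd mH2.
  have sub : (p (fst @^-1` (hist t @^-1` A1) `|` snd @^-1` (hist t @^-1` A2)) <=
      p (fst @^-1` (hist t @^-1` A1)) + p (snd @^-1` (hist t @^-1` A2)))%E.
    exact: measureU2.
  apply: le_trans sub _.
  have -> : p (fst @^-1` (hist t @^-1` A1)) = 0 by exact: etrans (cp _ mH1).1 A10.
  have -> : p (snd @^-1` (hist t @^-1` A2)) = 0 by exact: etrans (cp _ mH2).2 A20.
  by rewrite adde0.
- move=> h /= /not_andP[nh|nh]; [left|right]; [exact: SA1|exact: SA2].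
Qed.

Lemma optimal_kernelP (mu_ nu_ : forall t : 'I_N, R.-pker (t.-tuple R) ~> R)
    (p_ : forall t : 'I_N, R.-pker (t.-tuple R * t.-tuple R) ~> (R * R)%type) :
  (forall t : 'I_N, is_rcd mu (hist t) (fun x => tnth x t) (mu_ t)) ->
  (forall t : 'I_N, is_rcd nu (hist t) (fun y => tnth y t) (nu_ t)) ->
  (forall t : 'I_N, is_rcd p (hist2 t) (coord2 t) (p_ t)) ->
  is_optimal mu nu p <->
  forall t : 'I_N,
    {ae pushforward p (hist2 t), forall h : t.-tuple R * t.-tuple R,
       (0 < (L^T *m M) t t -> is_comonotonic (mu_ t h.1) (nu_ t h.2) (p_ t h)) /\
       ((L^T *m M) t t < 0 -> is_countermonotonic (mu_ t h.1) (nu_ t h.2) (p_ t h))}.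
Proof.
move=> rmu rnu rp; rewrite (optimal_iff pL pM smu snu bp).
suff step t : (0 < (L^T *m M) t t ->
      {ae p, forall w, tnth (whiten M b w.2) t = 1 * tnth (whiten L a w.1) t}) /\
    ((L^T *m M) t t < 0 ->
      {ae p, forall w, tnth (whiten M b w.2) t = -1 * tnth (whiten L a w.1) t}) <->
    {ae pushforward p (hist2 t), forall h : t.-tuple R * t.-tuple R,
       (0 < (L^T *m M) t t -> is_comonotonic (mu_ t h.1) (nu_ t h.2) (p_ t h)) /\
       ((L^T *m M) t t < 0 -> is_countermonotonic (mu_ t h.1) (nu_ t h.2) (p_ t h))}.
  by split=> h t; apply/step.
have mH := @measurable_hist2 R N t.
have [Q lQ] := has_law_exists p mH.
have laws := ae_hist2 (marginal_kernel pL smu (rmu t)) (marginal_kernel pM snu (rnu t)).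
have stepP e := step_kernelP pL pM smu snu bp e (rp t).
rewrite (stepP 1) (stepP (-1)).
move/(ae_law _ lQ) in laws; rewrite !(ae_law _ lQ).
have como h : affine_law (drift L a t (pad N h.1)) (L t t) (mu_ t h.1) /\
    affine_law (drift M b t (pad N h.2)) (M t t) (nu_ t h.2) ->
    (is_comonotonic (mu_ t h.1) (nu_ t h.2) (p_ t h) <-> forall E, measurable E ->
      p_ t h E = stdn [set z | E (signed_step L M a b 1 (h, z))]) /\
    (is_countermonotonic (mu_ t h.1) (nu_ t h.2) (p_ t h) <-> forall E, measurable E ->
      p_ t h E = stdn [set z | E (signed_step L M a b (-1) (h, z))]).
  move=> [l1 l2]; split.
    exact: (comonotonic_affine _ (pL.2 t) (pM.2 t) l1 l2).
  exact: (countermonotonic_affine _ (pL.2 t) (pM.2 t) l1 l2).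
(* Only the clause for the sign at hand is active; at 0 both sides hold trivially. *)
have [D0|D0|D0] := ltrgtP 0 ((L^T *m M) t t); split.
- move=> [/(_ isT) h _]; apply: filterS2 laws h => h0 /como[-> _] kE; split=> // _; exact: kE.
- by move=> h; split=> // _; apply: filterS2 laws h => h0 /como[<- _] [+ _]; exact.
- move=> [_ /(_ isT) h]; apply: filterS2 laws h => h0 /como[_ ->] kE; split=> // _; exact: kE.
- by move=> h; split=> // _; apply: filterS2 laws h => h0 /como[_ <-] [_]; exact.
- by move=> _; apply: filterS laws.
- by [].
Qed.
End kernel_characterization.

(** * Uniqueness *)

Section uniqueness.
Context {R : realType} {N : nat}.
Variables (L M : 'M[R]_N) (a b : 'cV[R]_N) (mu nu : probability (N.-tuple R) R).
Hypotheses (pL : pos_trig L) (pM : pos_trig M).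
Hypotheses (smu : std_vec mu (whiten L a)) (snu : std_vec nu (whiten M b)).
Notation D j := ((L^T *m M) j j).
Notation Z j := (fun w : N.-tuple R * N.-tuple R => tnth (whiten L a w.1) j).
Notation W j := (fun w : N.-tuple R * N.-tuple R => tnth (whiten M b w.2) j).

Lemma optimal_map_unwhiten x : optimal_map a b L M x =
  unwhiten M b [tuple Num.sg (D j) * tnth (whiten L a x) j | j < N].
Proof.
rewrite /optimal_map /unwhiten -!mulmxA; congr (tupv (b + M *m _)).
by apply/colP => j; rewrite mul_diag_mx mxE [RHS]mxE tnth_mktuple mxE /whiten tnth_mktuple.
Qed.

Lemma measurable_optimal_map : measurable_fun setT (optimal_map a b L M).
Proof.
pose S := M *m diag_mx (\row_t Num.sg (D t)) *m invmx L.
have -> : optimal_map a b L M = fun x => tupv (b - S *m a + S *m colv x).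
  by apply/funext => x; rewrite /optimal_map -/S mulmxBr addrAC addrA.
exact: measurable_affine.
Qed.

Lemma induced_by_graph (p : probability (N.-tuple R * N.-tuple R)%type R)
    (F : N.-tuple R -> N.-tuple R) :
  measurable_fun setT F -> is_coupling mu nu p ->
  {ae p, forall w, w.2 = F w.1} -> induced_by mu F p.
Proof.
move=> mF cp wF E mE.
have mG : measurable [set x | E (x, F x)].
  by apply: (measurable_preimageT (f := fun x => (x, F x))) => //; exact: measurable_fun_pair.
rewrite -(cp _ mG).1; apply: ae_eq_prob => //.
  exact: measurable_preimageT measurable_fst mG.
by apply: filterS wF => -[x y] /= ->.
Qed.

Lemma optimal_graph p : (forall t, D t != 0) -> is_optimal mu nu p ->
  {ae p, forall w, w.2 = optimal_map a b L M w.1}.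
Proof.
move=> D0 op; have bp := op.1; move/(optimal_iff pL pM smu snu bp) : op => h.
have : {ae p, forall w, forall j, W j w = Num.sg (D j) * Z j w}.
  apply: filter_forall => j; have [hp hn] := h j.
  have [Dn|Dp|D00] := ltrgtP (D j) 0; first by rewrite ltr0_sg//; exact: hn.
    by rewrite gtr0_sg//; exact: hp.
  by have := D0 j; rewrite D00 eqxx.
apply: filterS => w hw; rewrite optimal_map_unwhiten -[LHS](whitenK b _ pM).
by congr (unwhiten M b _); apply: eq_from_tnth => j; rewrite hw [RHS]tnth_mktuple.
Qed.

Lemma optimal_induced p : (forall t, D t != 0) -> is_optimal mu nu p ->
  induced_by mu (optimal_map a b L M) p.
Proof.
move=> D0 op; have [cp _ _] := op.1.
exact: induced_by_graph measurable_optimal_map cp (optimal_graph D0 op).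
Qed.

Lemma sign_coupling_optimal e p : sign_coupling L M a b mu nu e p ->
  (forall j, (0 < D j -> e j = 1) /\ (D j < 0 -> e j = -1)) -> is_optimal mu nu p.
Proof.
move=> [bp We] eD; apply/(optimal_iff pL pM smu snu bp) => j.
have [ep en] := eD j.
by split=> [/ep|/en] ej; have := We j; rewrite ej.
Qed.

(** If the entry at t is 0, both signs at t give optimal couplings. Were their laws equal, Z_t = W_t
    = - Z_t would hold almost surely, although N(0, 1) has no atom at 0. Conversely, nonzero entries
    force every optimal coupling onto the graph of the same map. *)
Lemma unique_optimalP : unique_optimal mu nu <-> forall t, D t != 0.
Proof.
split=> [[p [op up]] t|D0].
  apply/eqP => Dt0.
  pose e (s : R) j := if j == t then s else opt_sign L M j.
  have law s : s ^+ 2 = 1 -> {ae p, forall w, W t w = s * Z t w}.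
    move=> s1; have [j|q sq] := @sign_coupling_exists R N L M a b mu nu pL pM smu snu (e s).
      by rewrite /e; case: eqP => // _; exact: opt_sign_sqr.
    have oq : is_optimal mu nu q.
      apply: sign_coupling_optimal sq _ => j; rewrite /e /opt_sign.
      case: eqP => [->|_]; first by rewrite Dt0 ltxx.
      by case: ltrgtP.
    have [_ /(_ t)] := sq; rewrite /e eqxx.
    have qp := up _ oq.
    move=> [A [mA A0 SA]]; exists A; split=> //; by rewrite -qp.
  have l1 := law 1 (expr1n _ _); have lN : {ae p, forall w, W t w = -1 * Z t w}.
    by apply: law; rewrite sqrrN expr1n.
  have Z0 : {ae p, forall w, Z t w = 0}.
    by apply: filterS2 l1 lN => w ->; rewrite mul1r mulN1r => /eqP; rewrite -subr_eq0 opprK -mulr2n mulrn_eq0/= => /eqP.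
  have [sZ _ _ _] := bicausal_sym_causal smu snu op.1.
  have := std_vec_coord t sZ (measurable_set1 0).
  rewrite stdn_set1.
  rewrite (ae_eq_prob (B := setT)) ?probability_setT//; last 2 first.
  - exact: (measurable_preimageT (measurable_coord t sZ.1) (measurable_set1 0)).
  - by apply: filterS Z0.
  by move/eqP; rewrite onee_eq0.
have [p sp] := @sign_coupling_exists R N L M a b mu nu pL pM smu snu (opt_sign L M) (@opt_sign_sqr _ _ _ _).
have op : is_optimal mu nu p.
  apply: sign_coupling_optimal sp _ => j; rewrite /opt_sign.
  by case: ltrgtP.
exists p; split=> // q oq E mE.
by rewrite (optimal_induced D0 oq mE) (optimal_induced D0 op mE).
Qed.
End uniqueness.

(** * Jointly Gaussian couplings *)

Section gaussian_coupling.
Context {R : realType} {N : nat}.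

(** The inverse of concatenation, to carry events on pairs over to R^(N + N), where the Gaussian law
    is specified. *)
Definition split_tuple (x : (N + N).-tuple R) : N.-tuple R * N.-tuple R :=
  ([tuple tnth x (lshift N i) | i < N], [tuple tnth x (rshift N i) | i < N]).

Lemma measurable_split_tuple : measurable_fun setT split_tuple.
Proof.
apply: measurable_fun_pair; apply/measurable_fun_tnthP => i.
  rewrite (_ : _ \o _ = fun x => tnth x (lshift N i)); last by apply/funext => x /=; rewrite tnth_mktuple.
  exact: measurable_tnth.
rewrite (_ : _ \o _ = fun x => tnth x (rshift N i)); last by apply/funext => x /=; rewrite tnth_mktuple.
exact: measurable_tnth.
Qed.

Lemma split_tuple_cat (x y : N.-tuple R) : split_tuple (cat_tuple x y) = (x, y).
Proof.
by congr (_, _); apply: eq_from_tnth => i; rewrite tnth_mktuple ?tnth_lshift ?tnth_rshift.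
Qed.

Lemma split_tupv (u v : 'cV[R]_N) : split_tuple (tupv (col_mx u v)) = (tupv u, tupv v).
Proof.
by congr (_, _); apply: eq_from_tnth => i; rewrite !tnth_mktuple ?col_mxEu ?col_mxEd.
Qed.

(** Cutting S into its upper and lower halves, the blocks of S S^T give the three products, and
    L^{-1} and M^{-1} reduce them to I, I and P. Both vectors of innovations become linear images of
    one standard vector. *)
Lemma gaussian_coupling_factor (L M A B : 'M[R]_N) (a b : 'cV[R]_N) (rho : 'rV[R]_N)
    (p : probability (N.-tuple R * N.-tuple R)%type R) :
  is_cholesky A L -> is_cholesky B M -> is_gaussian_coupling a b A B L M rho p ->
  exists (k : nat) (QZ QW : 'M[R]_(N, k)) (gamma : probability (k.-tuple R) R),
    [/\ std_vec gamma id, QZ *m QZ^T = 1%:M, QW *m QW^T = 1%:M,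
        QZ *m QW^T = diag_mx rho &
        has_law gamma (fun z => (unwhiten L a (mulv QZ z), unwhiten M b (mulv QW z))) p].
Proof.
move=> cA cB [k [S [gamma [sg SS hE]]]].
have pL : pos_trig L by case: cA.
have pM : pos_trig M by case: cB.
have uL := pos_trig_unit pL; have uM := pos_trig_unit pM.
have := SS; rewrite -{1 2}(vsubmxK S) tr_col_mx mul_col_row => /eq_block_mx[SA SC _ SB].
have uLT : L^T \in unitmx by rewrite unitmx_tr.
have uMT : M^T \in unitmx by rewrite unitmx_tr.
exists k, (invmx L *m usubmx S), (invmx M *m dsubmx S), gamma; split.
- exact: is_std_gaussian_vec.
- rewrite trmx_mul mulmxA -(mulmxA (invmx L)) -SA; case: cA => -> _ _.
  by rewrite trmx_inv mulmxA mulVmx// mul1mx mulmxV.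
- rewrite trmx_mul mulmxA -(mulmxA (invmx M)) -SB; case: cB => -> _ _.
  by rewrite trmx_inv mulmxA mulVmx// mul1mx mulmxV.
- rewrite trmx_mul mulmxA -(mulmxA (invmx L)) -SC trmx_inv !mulmxA mulVmx// mul1mx.
  by rewrite -mulmxA mulmxV// mulmx1.
move=> E mE.
have /hE : measurable (split_tuple @^-1` E) := measurable_preimageT measurable_split_tuple mE.
rewrite /pushforward (_ : _ @^-1` _ = E); last first.
  by apply/seteqP; split=> -[x y] /=; rewrite split_tuple_cat.
have GE z : split_tuple (tupv (col_mx a b + S *m colv z)) =
    (unwhiten L a (mulv (invmx L *m usubmx S) z), unwhiten M b (mulv (invmx M *m dsubmx S) z)).
  rewrite -[X in X *m colv z]vsubmxK mul_col_mx add_col_mx split_tupv.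
  by rewrite /unwhiten /mulv !tupvK !mulmxA !mulmxV// !mul1mx.
by move=> ->; congr (gamma _); apply/seteqP; split=> z /=; rewrite GE.
Qed.

(** The residual is the image of the standard vector under V = Q2 - P Q1, and Q1 V^T = P - P = 0.
    Stated for abstract X and Y so that it serves both directions of causality. *)
Lemma indep_residual {k : nat} (gamma : probability (k.-tuple R) R)
    (p : probability (N.-tuple R * N.-tuple R)%type R)
    (G : k.-tuple R -> N.-tuple R * N.-tuple R)
    (X Y : N.-tuple R * N.-tuple R -> N.-tuple R)
    (P Q : 'M[R]_N) (c c' : 'cV[R]_N) (Q1 Q2 : 'M[R]_(N, k)) (rho : 'rV[R]_N) :
  measurable_fun setT X -> measurable_fun setT Y ->
  std_vec gamma id -> has_law gamma G p ->
  (forall z, X (G z) = unwhiten P c (mulv Q1 z)) ->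
  (forall z, Y (G z) = unwhiten Q c' (mulv Q2 z)) ->
  pos_trig P -> pos_trig Q ->
  Q1 *m Q1^T = 1%:M -> Q1 *m Q2^T = diag_mx rho ->
  indep p X (residual X Y P Q c c' (rho 0)).
Proof.
move=> mX mY sG lG XG YG pP pQ Q11 Q12 A B mA mB.
pose V := Q2 - diag_mx rho *m Q1.
have Q1V : Q1 *m V^T = 0.
  by rewrite linearB /= trmx_mul mulmxBr mulmxA Q11 mul1mx Q12 tr_diag_mx subrr.
have VE z : residual X Y P Q c c' (rho 0) (G z) = mulv V z.
  apply: eq_from_tnth => j; rewrite [LHS]tnth_mktuple XG YG !unwhitenK// ![tnth (mulv _ _) _]tnth_mktuple.
  by rewrite mulmxBl -mulmxA mul_diag_mx !mxE.
have mres := measurable_residual mX mY P Q c c' (rho 0).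
have mXA := measurable_preimageT mX mA; have mrB := measurable_preimageT mres mB.
have iG := indep_comp (measurable_unwhiten P c) (@measurable_id _ _ setT) (std_vec_indep_orthogonal Q11 Q1V sG).
rewrite -(lG _ (measurableI _ _ mXA mrB)) -(lG _ mXA) -(lG _ mrB).
have := iG A B mA mB.
have e1 : (unwhiten P c \o (mulv Q1 \o id)) = X \o G by apply/funext => z /=; rewrite XG.
have e2 : id \o (mulv V \o id) = residual X Y P Q c c' (rho 0) \o G by apply/funext => z /=; rewrite VE.
by rewrite e1 e2.
Qed.

Lemma adapted_wasserstein_optimal (L M A B : 'M[R]_N) (a b : 'cV[R]_N)
    (mu nu : probability (N.-tuple R) R) (p : probability (N.-tuple R * N.-tuple R)%type R) :
  is_cholesky A L -> is_cholesky B M -> is_gaussian a A mu -> is_gaussian b B nu ->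
  is_adapted_wasserstein a b A B L M p -> is_optimal mu nu p.
Proof.
move=> cA cB gmu gnu [rho [gp rhoD]].
have pL : pos_trig L by case: cA.
have pM : pos_trig M by case: cB.
have smu := gaussian_whiten cA gmu; have snu := gaussian_whiten cB gnu.
have [k [QZ [QW [gamma [sG ZZ WW ZW lG]]]]] := gaussian_coupling_factor cA cB gp.
have WZ : QW *m QZ^T = diag_mx rho by rewrite -[LHS]trmxK trmx_mul trmxK ZW tr_diag_mx.
have bp : is_bicausal mu nu p.
  split.
  - move=> E mE; rewrite -lG; last exact: (measurable_preimageT measurable_fst mE).
    rewrite -lG; last exact: (measurable_preimageT measurable_snd mE).
    have mZE := measurable_preimageT (measurable_unwhiten L a) mE.
    have mWE := measurable_preimageT (measurable_unwhiten M b) mE.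
    split.
      transitivity (mu (whiten L a @^-1` (unwhiten L a @^-1` E))).
        by rewrite -(std_vec_law_uniq (std_vec_orthonormal ZZ sG) smu mZE).
      by congr (mu _); apply/seteqP; split=> y /=; rewrite whitenK.
    transitivity (nu (whiten M b @^-1` (unwhiten M b @^-1` E))).
      by rewrite -(std_vec_law_uniq (std_vec_orthonormal WW sG) snu mWE).
    by congr (nu _); apply/seteqP; split=> y /=; rewrite whitenK.
  - apply: (causal_of_residual measurable_fst measurable_snd pL pM (rho := rho 0)).
    exact: (indep_residual measurable_fst measurable_snd sG lG _ _ pL pM ZZ ZW).
  - apply: (causal_of_residual measurable_snd measurable_fst pM pL (rho := rho 0)).
    exact: (indep_residual measurable_snd measurable_fst sG lG _ _ pM pL WW WZ).
have unit_row t : rho 0 t ^+ 2 = 1 ->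
    {ae p, forall w, tnth (whiten M b w.2) t = rho 0 t * tnth (whiten L a w.1) t}.
  move=> r1; pose V := QW - diag_mx rho *m QZ.
  (* V V^T = I - P^2, so where rho_t^2 = 1 row t of V has norm 0 and the residual vanishes at t. *)
  have VV : (V *m V^T) t t = 0.
    have -> : V^T = QW^T - QZ^T *m diag_mx rho by rewrite linearB /= trmx_mul tr_diag_mx.
    have VW : V *m QW^T = 1%:M - diag_mx rho *m diag_mx rho by rewrite mulmxBl -mulmxA ZW WW.
    have VZ : V *m QZ^T = 0 by rewrite mulmxBl -mulmxA ZZ WZ mulmx1 subrr.
    rewrite mulmxBr mulmxA VW VZ mul0mx subr0 mul_diag_mx !mxE eqxx mulr1n.
    by rewrite -expr2 r1 subrr.
  have Vt j : V t j = 0.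
    have VVE : \sum_j V t j ^+ 2 = 0.
      by rewrite -[RHS]VV [RHS]mxE; apply: eq_bigr => l _; rewrite [V^T _ _]mxE expr2.
    have /(_ j isT) := psumr_eq0P (fun l _ => sqr_ge0 (V t l)) VVE.
    by move/eqP; rewrite sqrf_eq0 => /eqP.
  have mE : measurable [set w | tnth (residual fst snd L M a b (rho 0) w) t = 0].
    apply: (measurable_preimageT (f := fun w => tnth (residual fst snd L M a b (rho 0) w) t)) (measurable_set1 0).
    exact: measurable_coord (measurable_residual measurable_fst measurable_snd _ _ _ _ _).
  have : {ae p, forall w, tnth (residual fst snd L M a b (rho 0) w) t = 0}.
    apply: (ae_prob1 mE); rewrite -(lG _ mE) (_ : _ @^-1` _ = setT) ?probability_setT//.
    apply/seteqP; split=> z //= _; rewrite tnth_mktuple/= !unwhitenK//.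
    have : (V *m colv z) t 0 = 0 by rewrite mxE big1// => j _; rewrite Vt mul0r.
    by rewrite ![tnth (mulv _ _) _]tnth_mktuple => <-; rewrite mulmxBl -mulmxA mul_diag_mx !mxE.
  by apply: filterS => w; rewrite tnth_mktuple/= => /eqP; rewrite subr_eq0 => /eqP.
apply/(optimal_iff pL pM smu snu bp) => t; have [_ rp rn] := rhoD t; split=> Dt.
  by have := unit_row t; rewrite rp// expr1n; exact.
by have := unit_row t; rewrite rn// sqrrN expr1n; exact.
Qed.
End gaussian_coupling.

Theorem corollary4p4 (R : realType) (N : nat) (hN : (0 < N)%N)
  (a b : 'cV[R]_N) (A B L M : 'M[R]_N)
  (hL : is_cholesky A L) (hM : is_cholesky B M)
  (mu nu : probability (N.-tuple R) R)
  (hmu : is_gaussian a A mu) (hnu : is_gaussian b B nu) :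
  [/\ (* (1) *)
      forall p : probability (N.-tuple R * N.-tuple R)%type R,
        is_bicausal mu nu p ->
      forall (mu_ nu_ : forall t : 'I_N, R.-pker (t.-tuple R) ~> R)
        (p_ : forall t : 'I_N, R.-pker (t.-tuple R * t.-tuple R) ~> (R * R)%type),
        (forall t : 'I_N, is_rcd mu (hist t) (fun x => tnth x t) (mu_ t)) ->
        (forall t : 'I_N, is_rcd nu (hist t) (fun y => tnth y t) (nu_ t)) ->
        (forall t : 'I_N, is_rcd p (hist2 t) (coord2 t) (p_ t)) ->
        (is_optimal mu nu p <->
         forall t : 'I_N,
           {ae pushforward p (hist2 t), forall h : t.-tuple R * t.-tuple R,
             (0 < (L^T *m M) t t ->
                is_comonotonic (mu_ t h.1) (nu_ t h.2) (p_ t h)) /\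
             ((L^T *m M) t t < 0 ->
                is_countermonotonic (mu_ t h.1) (nu_ t h.2) (p_ t h))}),
      (* (2) *)
      (unique_optimal mu nu <-> forall t, (L^T *m M) t t != 0) /\
      ((forall t, (L^T *m M) t t != 0) ->
       forall p : probability (N.-tuple R * N.-tuple R)%type R,
         is_optimal mu nu p -> induced_by mu (optimal_map a b L M) p) &
      (* (3) *)
      forall p : probability (N.-tuple R * N.-tuple R)%type R,
        is_adapted_wasserstein a b A B L M p -> is_optimal mu nu p].
Proof.
have pL : pos_trig L by case: hL.
have pM : pos_trig M by case: hM.
have smu := gaussian_whiten hL hmu; have snu := gaussian_whiten hM hnu.
split=> [p bp mu_ nu_ p_ rmu rnu rp||p].
- exact: (optimal_kernelP pL pM smu snu bp rmu rnu rp).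
- split; first exact: (unique_optimalP pL pM smu snu).
  by move=> D0 p; exact: (optimal_induced pL pM smu snu D0).
- exact: (adapted_wasserstein_optimal hL hM hmu hnu).
Qed.
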